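(* Assume the following. (1) There exist non-random $D_n>\sqrt2$ and non-random $\overline\theta_S\in\mathbb R^{|S|}$ with $\mathbf F_{n,\overline\theta_S}$ nonsingular such that, with $\mathbb P_0^{(n)}$-probability at least $1-p^{-1}$, for all $S\in\mathscr S_{s_{\max}}$, $D_n^{-1}\mathbf I_{|S|}\preceq \mathbf F_{n,\hat\theta_S}\mathbf F_{n,\overline\theta_S}^{-1}\preceq D_n\mathbf I_{|S|}$ and $\|\mathbf F_{n,\overline\theta_S}^{1/2}(\hat\theta_S-\overline\theta_S)\|_2^2\le D_n|S|\log p$. Moreover $\mathbf F_{n,\theta^*_{S_0}}$ is nonsingular and $\zeta_{n,S_0}^2s_0\log p=o(1)$. (2) $\log\big([\max_{i}b''(x_i^\top\theta_0)]\vee\|\mathbf X_{S_0}\|_\infty\vee\rho_{\min,S_0}^{-1}\vee\rho_{\max,S_0}\big)=O(\log p)$ and $s_0\log p=o(n)$; there are constants $A_5,A_6>0$, $A_7\ge0$ with $p^{-A_5}\le\lambda\le A_6p^{-A_7}$; $\alpha\in(0,1)$; $A_6p^{-A_7}<A_4$; and $\log_p(D_n)=o(1)$. (3) $\|\mathbf X\|_{\max}^2s_0^2\log p/\phi_2^2(\widetilde s_n;\mathbf W_0)=o(n)$, where $\widetilde s_n=(K_{\rm dim}+1)s_0$. Then there exists a constant $K_{\rm theta}>0$ such that, for all sufficiently large $n$, each of the three quantities $$\mathbb E\,\Pi_\alpha^n\Big(\theta:\|\theta-\theta_0\|_1>\tfrac{K_{\rm theta}s_0}{\phi_1(\widetilde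 s_n;\mathbf W_0)}\sqrt{\tfrac{\log p}{n}}\Big),\quad \mathbb E\,\Pi_\alpha^n\Big(\theta:\|\theta-\theta_0\|_2>\tfrac{K_{\rm theta}}{\phi_2(\widetilde s_n;\mathbf W_0)}\sqrt{\tfrac{s_0\log p}{n}}\Big),$$ $$\mathbb E\,\Pi_\alpha^n\big(\theta:\|\mathbf F_{n,\theta_0}^{1/2}(\theta-\theta_0)\|_2^2>K_{\rm theta}s_0\log p\big)$$ is at most $2(s_0\log p)^{-1}+4p^{-1}+2p^{-s_0}$.
   Context: Asymptotics are as $n\to\infty$; $p,\mathbf X,\theta_0,s_{\max},w_n,\lambda,D_n$ may depend on $n$, quantities called constants do not. $p\ge n^{c}$ for some constant $c>0$. The covariates $x_1,\dots,x_n\in\mathbb R^p$ are non-random; $\mathbf X=(x_{ij})\in\mathbb R^{n\times p}$ has rows $x_i^\top$. Model: $p_\theta(y\mid x)=\exp\{y\,x^\top\theta-b(x^\top\theta)+k(y)\}$ with $b,k$ known, $b$ strictly convex and three times differentiable; $C_{\rm dev}\ge1$ is a constant depending only on $b$ with $\sup_{|y|\le1/2}b''(x+y)\le C_{\rm dev}b''(x)$ for all $x\in\mathbb R$. $Y_1,\dots,Y_n$ are independent, $Y_i$ with density/mass function $p_{\theta_0}(\cdot\mid x_i)$ for a true $\theta_0\in\mathbb R^p\setminus\{0\}$; $\mathbb P_0^{(n)},\mathbb E$ are the corresponding probability and expectation. $S_\theta=\{j:\theta_j\ne0\}$, $S_0=S_{\theta_0}$, $s_0=|S_0|$, $[p]=\{1,\dots,p\}$,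 $\mathscr S_s=\{S\subset[p]:|S|\le s\}$. For $S\subseteq[p]$: $x_{i,S}=(x_{ij})_{j\in S}$, $\mathbf X_S$ is the submatrix of columns in $S$; for $\theta_S\in\mathbb R^{|S|}$, $L_{n,\theta_S}=\sum_i\{Y_ix_{i,S}^\top\theta_S-b(x_{i,S}^\top\theta_S)+k(Y_i)\}$ ($L_{n,\theta}$ is the case $S=[p]$); $\hat\theta_S=\arg\max L_{n,\theta_S}$ (MLE), $\theta_S^*=\arg\max\mathbb E L_{n,\theta_S}$; $\mathbf F_{n,\theta_S}=\sum_ib''(x_{i,S}^\top\theta_S)x_{i,S}x_{i,S}^\top$ ($\mathbf F_{n,\theta}$ is the case $S=[p]$); $\zeta_{n,S}=\max_i\|\mathbf F_{n,\theta_S^*}^{-1/2}x_{i,S}\|_2$; $\rho_{\min,S},\rho_{\max,S}$ are the smallest and largest eigenvalues of $\mathbf F_{n,\theta_S^*}$. $\|\mathbf A\|_\infty=\max_i\sum_j|a_{ij}|$, $\|\mathbf A\|_{\max}=\max_{i,j}|a_{ij}|$. The relation $D_n^{-1}\mathbf I\preceq\mathbf F\mathbf G^{-1}\preceq D_n\mathbf I$ is read as $D_n^{-1}\mathbf G\preceq\mathbf F\preceq D_n\mathbf G$ in the positive semidefinite order. $\mathbf W_0=\mathrm{diag}(b''(x_1^\top\theta_0),\dots,b''(x_n^\top\theta_0))$; with $\boldsymbol\Sigma=n^{-1}\mathbf X^\top\mathbf W\mathbf X$, $\phi_1^2(s;\mathbf W)=\inf\{|S_\theta|\,\theta^\top\boldsymbol\Sigma\theta/\|\theta\|_1^2:0<|S_\theta|\le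 s\}$ and $\phi_2^2(s;\mathbf W)=\inf\{\theta^\top\boldsymbol\Sigma\theta/\|\theta\|_2^2:0<|S_\theta|\le s\}$. Prior: $s_{\max}$ is an integer with $s_0\le s_{\max}\le\operatorname{rank}(\mathbf X)$; $w_n$ is a probability mass function on $\{0,\dots,s_{\max}\}$ and $A_1,\dots,A_4>0$ are constants with $A_1p^{-A_3}w_n(s-1)\le w_n(s)\le A_2p^{-A_4}w_n(s-1)$ for $1\le s\le s_{\max}$; $\pi_n(S)=w_n(|S|)\binom{p}{|S|}^{-1}$; for $\lambda>0$, $g_S$ is the density of $\mathcal N(\hat\theta_S,\{\lambda\mathbf F_{n,\hat\theta_S}\}^{-1})$ on $\mathbb R^{|S|}$. The (data-dependent) prior is $\Pi_n(d\theta)=\sum_S\pi_n(S)g_S(\theta_S)\,d\theta_S\times\delta_0(d\theta_{S^c})$ and the $\alpha$-fractional posterior is $\Pi_\alpha^n(\mathcal A)=\int_{\mathcal A}e^{\alpha L_{n,\theta}}\Pi_n(d\theta)\big/\int e^{\alpha L_{n,\theta}}\Pi_n(d\theta)$. $K_{\rm dim}>1$ is a fixed constant (it exists under hypotheses (1)–(2)) such that, for all sufficiently large $n$, $\mathbb E\,\Pi_\alpha^n\{\theta:|S_\theta|>K_{\rm dim}s_0\}\le(s_0\log p)^{-1}+2p^{-1}+p^{-s_0}$. *)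

(* Defs.v *)
From HB Require Import structures.
From mathcomp Require Import all_boot all_order all_algebra.
From mathcomp Require Import all_classical all_reals all_analysis.
Set Implicit Arguments.
Unset Strict Implicit.
Unset Printing Implicit Defensive.
Import Order.TTheory GRing.Theory Num.Theory.
Import numFieldNormedType.Exports.
Local Open Scope classical_set_scope.
Local Open Scope ring_scope.

Section linear_algebra.
Context {R : realType}.

Definition quadform d (A : 'M[R]_d) (v : 'cV[R]_d) : R := (v^T *m A *m v) 0 0.

Definition psdmx d (A : 'M[R]_d) : Prop :=
  A^T = A /\ forall v, 0 <= quadform A v.

Definition loewner_le d (A B : 'M[R]_d) : Prop := psdmx (B - A).

(* A^{1/2}: a positive semidefinite A has exactly one positive semidefinite
   square root; other matrices get the junk value 0. *)
Definition sqrtmx d (A : 'M[R]_d) : 'M[R]_d :=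
  xget 0 [set B : 'M[R]_d | psdmx B /\ B *m B = A].

(* The set of eigenvalues is finite, and nonempty for symmetric A and d > 0,
   so these are its minimum and maximum. *)
Definition min_eigenvalue d (A : 'M[R]_d) : R := inf [set a | eigenvalue A a].
Definition max_eigenvalue d (A : 'M[R]_d) : R := sup [set a | eigenvalue A a].

Definition l1norm d (v : 'cV[R]_d) : R := \sum_i `|v i 0|.
Definition l2norm d (v : 'cV[R]_d) : R := Num.sqrt (\sum_i v i 0 ^+ 2).

(* The operator norm induced by the sup norm.  The entrywise maximum
   of absolute values is the library's [mx_norm]. *)
Definition max_row_sum m n (A : 'M[R]_(m, n)) : R :=
  \big[Num.max/0]_i \sum_j `|A i j|.

Definition supp p (theta : 'cV[R]_p) : {set 'I_p} :=
  [set j | theta j 0 != 0]%SET.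

(* Vectors indexed by S are columns of size #|S|, along [enum_val]. *)
Definition subcols n p (X : 'M[R]_(n, p)) (S : {set 'I_p}) : 'M[R]_(n, #|S|) :=
  colsub (fun k : 'I_#|S| => enum_val k) X.

Definition extend0 p (S : {set 'I_p}) (t : 'cV[R]_#|S|) : 'cV[R]_p :=
  \col_j \sum_(k < #|S| | enum_val k == j) t k 0.

(* phi_1 and phi_2; s is real because it is applied to (K_dim + 1) s_0. *)
Definition gram n p (X : 'M[R]_(n, p)) (W : 'M[R]_n) : 'M[R]_p :=
  n%:R^-1 *: (X^T *m W *m X).

Definition sparse_cone (p : nat) (s : R) : set 'cV[R]_p :=
  [set t | (0 < #|supp t|)%N /\ #|supp t|%:R <= s].

Definition phi1 n p (X : 'M[R]_(n, p)) (s : R) (W : 'M[R]_n) : R :=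
  Num.sqrt (inf [set #|supp t|%:R * quadform (gram X W) t / l1norm t ^+ 2
                | t in sparse_cone s]).

Definition phi2 n p (X : 'M[R]_(n, p)) (s : R) (W : 'M[R]_n) : R :=
  Num.sqrt (inf [set quadform (gram X W) t / l2norm t ^+ 2
                | t in sparse_cone s]).

End linear_algebra.

Definition is_argmax {T : Type} {disp} {V : porderType disp} (f : T -> V) (t : T)
  : Prop := forall u, (f u <= f t)%O.

(* Takes the value 0 if f has no maximizer. *)
Definition argmax {R : realType} d {disp} {V : porderType disp}
  (f : 'cV[R]_d -> V) : 'cV[R]_d := xget 0 [set t | is_argmax f t].

(* The Lebesgue integral over R^d, as an iterated integral; it is only applied
   to nonnegative functions, for which this is Tonelli's theorem. *)
Fixpoint lebesgue_cV {R : realType} d : ('cV[R]_d -> \bar R) -> \bar R :=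
  match d return ('cV[R]_d -> \bar R) -> \bar R with
  | 0%N => fun f => f 0
  | d'.+1 => fun f =>
      (\int[lebesgue_measure]_x
         lebesgue_cV (fun v : 'cV[R]_d' =>
           f (col_mx (x%:M : 'cV[R]_1) v : 'cV[R]_(1 + d'))))%E
  end.

(* Only meaningful for nonsingular Sigma. *)
Definition gauss_pdf {R : realType} d (m : 'cV[R]_d) (Sigma : 'M[R]_d)
    (t : 'cV[R]_d) : R :=
  (Num.sqrt ((2 * pi) ^+ d * \det Sigma))^-1
  * expR (- quadform (invmx Sigma) (t - m) / 2).

Definition strictly_convex {R : realType} (b : R -> R) : Prop :=
  forall x y t, x != y -> 0 < t < 1 ->
    b (t * x + (1 - t) * y) < t * b x + (1 - t) * b y.

Section glm.
Context {R : realType} (b k : R -> R).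

Definition glm_density (eta y : R) : R := expR (y * eta - b eta + k y).

Definition loglik n d (X : 'M[R]_(n, d)) (y : 'cV[R]_n) (t : 'cV[R]_d) : R :=
  \sum_i (y i 0 * (X *m t) i 0 - b ((X *m t) i 0) + k (y i 0)).

Definition fisher n d (X : 'M[R]_(n, d)) (t : 'cV[R]_d) : 'M[R]_d :=
  \sum_i b^`(2)%classic ((X *m t) i 0) *: ((row i X)^T *m row i X).

Definition weight_mx n d (X : 'M[R]_(n, d)) (t : 'cV[R]_d) : 'M[R]_n :=
  diag_mx (\row_i b^`(2)%classic ((X *m t) i 0)).

Definition mle n p (X : 'M[R]_(n, p)) (y : 'cV[R]_n) (S : {set 'I_p})
  : 'cV[R]_#|S| := argmax (loglik (subcols X S) y).

(* The integral of f against the data-dependent prior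
   sum_S pi_n(S) g_S(theta_S) dtheta_S x delta_0(dtheta_{S^c}). *)
Definition prior_integral n p (X : 'M[R]_(n, p)) (w : nat -> R) (lambda : R)
    (y : 'cV[R]_n) (f : 'cV[R]_p -> \bar R) : \bar R :=
  (\sum_(S : {set 'I_p})
     (w #|S| / 'C(p, #|S|)%:R)%:E
     * lebesgue_cV (fun t : 'cV[R]_#|S| =>
         (gauss_pdf (mle X y S)
            (invmx (lambda *: fisher (subcols X S) (mle X y S))) t)%:E
         * f (extend0 t)))%E.

Definition frac_posterior n p (X : 'M[R]_(n, p)) (w : nat -> R)
    (lambda alpha : R) (y : 'cV[R]_n) (A : set 'cV[R]_p) : R :=
  fine (prior_integral X w lambda y
          (fun theta => (expR (alpha * loglik X y theta) * \1_A theta)%:E))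
  / fine (prior_integral X w lambda y
          (fun theta => (expR (alpha * loglik X y theta))%:E)).

Section sampling.
Context (n : nat) {disp} {T : measurableType disp} (P : probability T R).
Context (Y : 'I_n -> {RV P >-> R}).

Definition data_vector (omega : T) : 'cV[R]_n := \col_i Y i omega.

Definition mutually_independent : Prop :=
  forall B : 'I_n -> set R, (forall i, measurable (B i)) ->
    P (\bigcap_i (Y i @^-1` B i)) = (\prod_i P (Y i @^-1` B i))%E.

(* nu is the dominating measure: Lebesgue measure for densities, a counting
   measure for mass functions. *)
Definition glm_sample p (nu : {measure set R -> \bar R}) (X : 'M[R]_(n, p))
    (theta0 : 'cV[R]_p) : Prop :=
  mutually_independent /\
  forall i (B : set R), measurable B ->
    P (Y i @^-1` B) =
      (\int[nu]_(y in B) (glm_density ((X *m theta0) i 0) y)%:E)%E.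

Context (p : nat) (X : 'M[R]_(n, p)).

Definition theta_star (S : {set 'I_p}) : 'cV[R]_#|S| :=
  argmax (fun t => ('E_P[fun omega =>
    loglik (subcols X S) (data_vector omega) t])%E).

Definition fisher_star (S : {set 'I_p}) : 'M[R]_#|S| :=
  fisher (subcols X S) (theta_star S).

Definition zeta (S : {set 'I_p}) : R :=
  \big[Num.max/0]_i
    l2norm (invmx (sqrtmx (fisher_star S)) *m (row i (subcols X S))^T).

Definition expected_posterior (w : nat -> R) (lambda alpha : R)
    (A : set 'cV[R]_p) : \bar R :=
  ('E_P[fun omega =>
     frac_posterior X w lambda alpha (data_vector omega) A])%E.

End sampling.
End glm.

Arguments data_vector {R n disp T P} Y omega.
Arguments glm_sample {R} b k {n disp T} P Y {p} nu X theta0.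
Arguments theta_star {R} b k {n disp T} P Y {p} X S.
Arguments fisher_star {R} b k {n disp T} P Y {p} X S.
Arguments zeta {R} b k {n disp T} P Y {p} X S.
Arguments expected_posterior {R} b k {n disp T} P Y {p} X w lambda alpha A.

Definition pmf_upto {R : realType} (smax : nat) (w : nat -> R) : Prop :=
  [/\ forall s, 0 <= w s, forall s, (smax < s)%N -> w s = 0
    & \sum_(s < smax.+1) w s = 1].

Definition tail_bound {R : realType} (s0 p : nat) : R :=
  (s0%:R * ln p%:R)^-1 + 2 * p%:R^-1 + p%:R ^- s0.

(* Main.v *)
Require Import Defs.
From HB Require Import structures.
From mathcomp Require Import all_boot all_order all_algebra.
From mathcomp Require Import all_classical all_reals all_analysis measurable_realfun.
From mathcomp Require Import ring lra.
From mathcomp Require Import complex.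
Set Implicit Arguments.
Unset Strict Implicit.
Unset Printing Implicit Defensive.
Import Order.TTheory GRing.Theory Num.Theory.
Import numFieldNormedType.Exports.
Local Open Scope classical_set_scope.
Local Open Scope ring_scope.

(** Throughout, Q is the quadratic form of the Fisher information at theta0 and
    L = log p.

    The compatibility constants phi_1 and phi_2 turn distance from theta0 in the
    l1 or l2 norm into a large value of Q, as long as theta is sparse
    (l1norm_far, l2norm_far).  Parameters that are not sparse are accounted for by
    the dimension bound, so everything comes down to the expected posterior mass of
    the sparse theta with Q(theta - theta0) > K s0 L, and this mass is a ratio: a
    numerator, the integral of the fractional likelihood over that set, divided by
    the evidence.

    The evidence is bounded below by its part in the true model S0.  Exponential
    moments of the observations are explicit, so each coordinate of the standardized
    score is sub-Gaussian and a union bound gives the size of the score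
    (score_bound).  A concave log-likelihood whose gradient at theta0 is that
    small has its maximizer within Q-distance of order s0 L (mle_near), where the
    observed information is within a factor Cdev of the true one (fisher_near).  The
    Gaussian prior component of S0 therefore charges the ellipsoid
    Q(theta - theta0) <= s0, on which the likelihood is comparable to that at theta0,
    with mass at least exp(- C s0 L) (gaussian_evidence, evidence_lower).

    In the numerator the prior component of a model S depends on the data.  Its
    assumed closeness to a fixed centre and a fixed information matrix gives a
    pointwise bound by exp(C |S| L) times a fixed Gaussian density
    (gauss_pdf_dominated).  Once the prior is fixed, expectation and integration
    over theta can be exchanged, and the expected fractional likelihood ratio is
    exp(- sum of Jensen gaps of b) (fractional_likelihood_mean).  The gaps increase
    along rays from theta0, so they may be evaluated on the ellipsoid
    {Q = K s0 L}; by the assumption on the design that ellipsoid is small in sup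
    norm on sparse vectors (sparse_linpred_le), and there the gaps sum to at least
    a constant times Q (jensen_gap_sum_ge).  A large K makes the resulting
    exp(- c K s0 L) beat all the factors exp(C s0 L) (contraction_exponent).

    The posterior mass need not be a measurable function of the data, because the
    maximum likelihood estimators are arbitrary maximizers.  Its expectation is the
    lower integral, which is monotone without measurability and subadditive when one
    of two summands is measurable (le_lower_integral, lower_integralD_le).  Hence
    the posterior is bounded pointwise by the posterior mass of the large dimensions
    plus measurable functions, and no more is asked of it (expected_posterior_le). *)

(** * Quadratic forms and square roots of matrices *)

Section quadratic_forms.
Context {R : realType}.

Lemma quadformE d (A : 'M[R]_d) v : quadform A v = \sum_i \sum_j v i 0 * A i j * v j 0.
Proof.
rewrite /quadform mxE exchange_big /=; apply: eq_bigr => j _.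
by rewrite mxE big_distrl /=; apply: eq_bigr => i _; rewrite mxE.
Qed.

Lemma quadformB d (A B : 'M[R]_d) v :
  quadform (A - B) v = quadform A v - quadform B v.
Proof. by rewrite /quadform mulmxBr mulmxBl !mxE. Qed.

Lemma quadformZ d c (A : 'M[R]_d) v : quadform (c *: A) v = c * quadform A v.
Proof. by rewrite /quadform -scalemxAr -scalemxAl mxE. Qed.

Lemma quadformZv d c (A : 'M[R]_d) v :
  quadform A (c *: v) = c ^+ 2 * quadform A v.
Proof.
by rewrite /quadform [(c *: v)^T]linearZ /= -!scalemxAl -!scalemxAr !mxE mulrA expr2.
Qed.

Lemma quadformN d (A : 'M[R]_d) v : quadform A (- v) = quadform A v.
Proof. by rewrite -scaleN1r quadformZv sqrrN expr1n mul1r. Qed.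

Lemma l2norm_sqr d (v : 'cV[R]_d) : l2norm v ^+ 2 = \sum_i v i 0 ^+ 2.
Proof. by rewrite sqr_sqrtr// sumr_ge0// => i _; rewrite sqr_ge0. Qed.

Lemma l2norm_ge0 d (v : 'cV[R]_d) : 0 <= l2norm v.
Proof. exact: sqrtr_ge0. Qed.

Lemma l2norm_sqr_quadform d (B : 'M[R]_d) v :
  B^T = B -> l2norm (B *m v) ^+ 2 = quadform (B *m B) v.
Proof.
move=> Bsym; rewrite l2norm_sqr /quadform.
rewrite (_ : v^T *m (B *m B) *m v = (B *m v)^T *m (B *m v)); last first.
  by rewrite trmx_mul Bsym !mulmxA.
by rewrite [RHS]mxE; apply: eq_bigr => i _; rewrite [in RHS]mxE expr2.
Qed.

(** The parallelogram bound: it replaces the triangle inequality for the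
    seminorm of a positive semidefinite matrix. *)
Lemma quadform_add_le d (A : 'M[R]_d) u v : psdmx A ->
  quadform A (u + v) <= 2 * (quadform A u + quadform A v).
Proof.
move=> [_ /(_ (u - v))].
have -> : quadform A (u + v) = 2 * (quadform A u + quadform A v) - quadform A (u - v).
  rewrite /quadform.
  have -> : (u + v)^T = u^T + v^T by rewrite linearD.
  have -> : (u - v)^T = u^T - v^T by rewrite linearB.
  by rewrite !(mulmxDl, mulmxDr, mulNmx, mulmxN) !mxE; ring.
by move=> ?; rewrite gerBl.
Qed.

Lemma cauchy_schwarz (I : finType) (x y : I -> R) :
  (\sum_i x i * y i) ^+ 2 <= (\sum_i x i ^+ 2) * (\sum_i y i ^+ 2).
Proof.
set a := \sum_i x i ^+ 2; set c := \sum_i y i ^+ 2; set s := \sum_i x i * y i.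
have a0 : 0 <= a by apply: sumr_ge0 => i _; exact: sqr_ge0.
have H t : 0 <= t ^+ 2 * a - 2 * t * s + c.
  have <- : \sum_i (t * x i - y i) ^+ 2 = t ^+ 2 * a - 2 * t * s + c.
    rewrite /a /c /s !mulr_sumr -sumrB -big_split /=.
    by apply: eq_bigr => i _; ring.
  by apply: sumr_ge0 => i _; exact: sqr_ge0.
have [a_eq0|a_neq0] := eqVneq a 0.
  have s0 : s = 0.
    rewrite /s big1// => i _.
    have /eqP := a_eq0; rewrite psumr_eq0; last by move=> j _; exact: sqr_ge0.
    by move=> /allP /(_ i (mem_index_enum _)) /=; rewrite sqrf_eq0 => /eqP ->; rewrite mul0r.
  by rewrite s0 a_eq0 mul0r expr0n.
have a_gt0 : 0 < a by rewrite lt_neqAle eq_sym a_neq0.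
have := H (s / a).
have -> : (s / a) ^+ 2 * a - 2 * (s / a) * s + c = c - s ^+ 2 / a by field.
by rewrite subr_ge0 ler_pdivrMr// mulrC.
Qed.

Lemma inner_le_l2norm d (u v : 'cV[R]_d) :
  `|(u^T *m v) 0 0| <= l2norm u * l2norm v.
Proof.
rewrite -(ler_pXn2r (n := 2))// ?nnegrE ?mulr_ge0 ?l2norm_ge0//.
rewrite real_normK ?num_real// exprMn !l2norm_sqr mxE.
by under eq_bigr do rewrite mxE; exact: cauchy_schwarz.
Qed.

End quadratic_forms.

Section square_root.
Context {R : realType}.

(** A function of a diagonalizable matrix is a polynomial in it, once the function is
    interpolated at the eigenvalues. *)
Lemma interpolation (F : fieldType) (s : seq F) (f : F -> F) :
  exists q : {poly F}, {in s, forall x, q.[x] = f x}.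
Proof.
elim: s => [|a s [q qP]]; first by exists 0.
have [a_s|a_s] := boolP (a \in s).
  by exists q => x; rewrite inE => /predU1P[->|]; exact: qP.
pose m := \prod_(x <- s) ('X - x%:P).
have ma : m.[a] != 0 by rewrite -rootE root_prod_XsubC.
exists (q + ((f a - q.[a]) / m.[a]) *: m) => x; rewrite inE !hornerE.
have [-> _|xa /= xs] := eqVneq x a; first by rewrite divfK// addrC subrK.
have /rootP -> : root m x by rewrite root_prod_XsubC.
by rewrite mulr0 addr0 qP.
Qed.

(** Over the complex numbers A is unitarily similar to a diagonal matrix whose
    entries are eigenvalues of A, hence real and nonnegative; a real polynomial
    that interpolates the fourth root at these entries does the job.  The fourth
    root, rather than the square root, is what makes the square root
    q(A)^2 visibly positive semidefinite. *)
Lemma psdmx_fourth_root n (A : 'M[R]_n.+1) : psdmx A ->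
  exists q : {poly R}, horner_mx A (q ^+ 4) = A.
Proof.
move=> [Asym Apos].
pose f : {rmorphism R -> R[i]} := real_complex R.
pose A' := map_mx f A.
have A'herm : A' \is hermsymmx.
  apply: realsym_hermsym; last first.
    by apply/mxOverP => i j; rewrite mxE complex_real.
  apply/is_hermitianmxP; rewrite expr0 scale1r.
  by apply/matrixP => i j; rewrite !mxE -{1}Asym mxE.
have /orthomx_spectralP A'E := hermitian_normalmx A'herm.
have sp_real := hermitian_spectral_diag_real A'herm.
set P := spectralmx A' in A'E; set sp := spectral_diag A' in A'E sp_real.
have Punit : P \in unitmx by exact: spectral_unit.
pose a j := complex.Re (sp 0 j).
have spE j : sp 0 j = f (a j).
  by rewrite /a /f /= RRe_real//; exact: (mxOverP sp_real).
have a_ge0 j : 0 <= a j.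
  have /eigenvalueP[v vA v0] : eigenvalue A (a j).
    rewrite -(eigenvalue_map f); apply/eigenvalueP; exists (row j P).
      rewrite -/A' A'E -row_mul !mulmxA mulmxV// mul1mx.
      by apply/rowP => k; rewrite mxE mul_diag_mx !mxE spE.
    apply/negP => /eqP r0.
    have : row j (P *m invmx P) = 0 by rewrite row_mul r0 mul0mx.
    rewrite mulmxV// => /rowP /(_ j); rewrite !mxE eqxx => /eqP.
    by rewrite oner_eq0.
  have := Apos v^T; rewrite /quadform trmxK vA -scalemxAl mxE.
  have v2_gt0 : 0 < (v *m v^T) 0 0.
    rewrite mxE; under eq_bigr do rewrite mxE.
    have [k vk0] : exists k, v 0 k != 0.
      by apply/existsP; apply: contraNT v0 => /existsPn H;
         apply/eqP/rowP => k; rewrite mxE; apply/eqP; move: (H k); rewrite negbK.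
    rewrite (bigD1 k)//= ltr_pwDl//.
      by rewrite -expr2 exprn_even_gt0.
    by apply: sumr_ge0 => l _; rewrite -expr2 sqr_ge0.
  by rewrite pmulr_lge0.
have [q qP] := interpolation [seq a j | j <- enum 'I_n.+1]
                 (fun x => Num.sqrt (Num.sqrt x)).
exists q; apply: (map_mx_inj (f := f)); rewrite map_horner_mx -/A'.
have diagE : horner_mx (diag_mx sp) (map_poly f (q ^+ 4)) = diag_mx sp.
  rewrite horner_mx_diag; congr diag_mx; apply/rowP => j; rewrite mxE spE.
  rewrite horner_map horner_exp qP ?map_f ?mem_enum//.
  rewrite (_ : 4 = 2 * 2)%N// exprM sqr_sqrtr ?sqrtr_ge0// sqr_sqrtr//.
rewrite {1}A'E -{2}(invmxK P) horner_mx_uconj ?unitmx_inv//.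
by rewrite diagE invmxK -A'E.
Qed.

Lemma sqrtmx_spec d (A : 'M[R]_d) : psdmx A ->
  psdmx (sqrtmx A) /\ sqrtmx A *m sqrtmx A = A.
Proof.
move=> psdA; rewrite /sqrtmx; case: xgetP => [B _ //|no].
suff [B HB] : exists B : 'M[R]_d, psdmx B /\ B *m B = A by case: (no B).
case: d A psdA {no} => [|n] A psdA.
  exists 0; split; last by apply/matrixP => -[].
  split; first by rewrite trmx0.
  by move=> v; rewrite /quadform mulmx0 mul0mx mxE.
have [q qP] := psdmx_fourth_root psdA.
pose N := horner_mx A q.
have Nsym : N^T = N.
  rewrite /N; elim/poly_ind: q {qP N} => [|q c IH].
    by rewrite rmorph0 trmx0.
  rewrite rmorphD rmorphM /= horner_mx_X horner_mx_C linearD/= tr_scalar_mx.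
  rewrite (_ : _ * A = horner_mx A q *m A)// trmx_mul IH (proj1 psdA).
  by rewrite (comm_mx_horner _ (comm_mx_refl A)).
exists (N *m N); split; last by rewrite -[RHS]qP rmorphXn /= -/N (exprD N 2 2).
split; first by rewrite trmx_mul Nsym.
by move=> v; rewrite -l2norm_sqr_quadform// sqr_ge0.
Qed.

Lemma l2norm_sqrtmx d (A : 'M[R]_d) v : psdmx A ->
  l2norm (sqrtmx A *m v) ^+ 2 = quadform A v.
Proof.
by move=> /sqrtmx_spec[[Bsym _] BB]; rewrite l2norm_sqr_quadform// BB.
Qed.

End square_root.

(** * Lower integrals and the iterated Lebesgue integral *)

Section lower_integral.
Context d (T : measurableType d) (R : realType) (mu : {measure set T -> \bar R}).
Implicit Types f g : T -> \bar R.
Import HBNNSimple.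
Local Open Scope ereal_scope.

(** The integral of a nonnegative function is defined as a supremum over simple
    functions below it, so monotonicity needs no measurability.  This matters
    because the data-dependent prior is not measurable in the data. *)
Lemma le_lower_integral f g : (forall x, 0 <= f x) -> (forall x, f x <= g x) ->
  \int[mu]_x f x <= \int[mu]_x g x.
Proof.
move=> f0 fg; have g0 x : 0 <= g x by exact: le_trans (f0 x) (fg x).
rewrite !ge0_integralTE//; apply: ereal_sup_le => _ [h /= hf <-].
by exists h => // x; exact: le_trans (hf x) (fg x).
Qed.

(** Lower integrals are superadditive in general; subadditivity survives when one
    of the summands is measurable, since a simple function h below f + g
    splits as h <= (h - g)^+ + g with (h - g)^+ measurable and below f. *)
Lemma lower_integralD_le f g : (forall x, 0 <= f x) -> (forall x, 0 <= g x) ->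
  measurable_fun setT g ->
  \int[mu]_x (f x + g x) <= \int[mu]_x f x + \int[mu]_x g x.
Proof.
move=> f0 g0 mg.
rewrite [X in X <= _]ge0_integralTE; last by move=> x; rewrite adde_ge0.
apply: ge_ereal_sup => _ [h /= hfg <-].
pose k x := maxe ((h x)%:E - g x) 0.
have mh : measurable_fun setT (fun x => (h x)%:E).
  exact/measurable_EFinP/measurable_funP.
have mk : measurable_fun setT k by apply: measurable_maxe => //; exact: emeasurable_funB.
have k0 x : 0 <= k x by rewrite /k le_max lexx orbT.
have kf x : k x <= f x.
  rewrite /k ge_max f0 andbT.
  have := hfg x; have := g0 x; case: (g x) => [r| |] //= _.
    by rewrite EFinN leeBlDr.
  by move=> _; rewrite addeNy ?leNye.
rewrite -integralT_nnsfun.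
apply: (@le_trans _ _ (\int[mu]_x (k x + g x))).
  apply: le_lower_integral => x; first by rewrite lee_fin.
  have := g0 x; rewrite /k; case: (g x) => [r| |] //= r0.
    by rewrite -leeBlDr// EFinN le_max lexx.
  by rewrite addey ?leey// gt_eqF// (lt_le_trans ltNy0)// le_max lexx orbT.
rewrite ge0_integralD//; apply: leeD2r.
exact: le_lower_integral.
Qed.

End lower_integral.

Definition measurable_vec (R : realType) d (T : measurableType d) n
    (v : T -> 'cV[R]_n) : Prop :=
  forall i, measurable_fun setT (fun s => v s i 0).

(** Column vectors carry no sigma-algebra here, so joint measurability is tested by
    composing with measurable functions into T and measurable vectors.  In
    this form closure under the usual operations is immediate, and so is the
    passage to slices that the recursion on the dimension needs. *)
Definition jointly_measurable (R : realType) d (T : measurableType d) n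
    d2 (U : measurableType d2) (f : T -> 'cV[R]_n -> U) : Prop :=
  forall d' (T' : measurableType d') (psi : T' -> T) (v : T' -> 'cV[R]_n),
    measurable_fun setT psi -> measurable_vec v ->
    measurable_fun setT (fun s => f (psi s) (v s)).

Section iterated_integral.
Context {R : realType}.

Lemma measurable_natb d (T : measurableType d) (P : T -> bool) :
  measurable_fun setT P -> measurable_fun setT (fun s => (P s)%:R : R).
Proof.
move=> mP; apply: (@measurableT_comp _ _ _ _ _ _ (fun b : bool => b%:R : R)) => //.
Qed.

Lemma measurable_col_mx d (T : measurableType d) n (x : T -> R)
    (v : T -> 'cV[R]_n) : measurable_fun setT x -> measurable_vec v ->
  measurable_vec (fun s => col_mx ((x s)%:M : 'cV_1) (v s)).
Proof.
move=> mx mv i; rewrite -(splitK i); case: (fintype.split i) => [j|j] /=.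
  under eq_fun do rewrite col_mxEu ord1 mxE eqxx mulr1n.
  exact: mx.
by under eq_fun do rewrite col_mxEd; exact: mv.
Qed.

Lemma measurable_mulmx d (T : measurableType d) m n (A : 'M[R]_(m, n))
    (v : T -> 'cV[R]_n) : measurable_vec v -> measurable_vec (fun s => A *m v s).
Proof.
move=> mv i; under eq_fun do rewrite mxE.
by apply: measurable_sum => j; apply: measurable_funM.
Qed.

Lemma measurable_subvec d (T : measurableType d) n (v : T -> 'cV[R]_n) m :
  measurable_vec v -> measurable_vec (fun s => v s - m).
Proof.
move=> mv i; under eq_fun do rewrite !mxE.
exact: measurable_funB.
Qed.

Lemma measurable_quadform d (T : measurableType d) n (A : 'M[R]_n)
    (v : T -> 'cV[R]_n) : measurable_vec v ->
  measurable_fun setT (fun s => quadform A (v s)).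
Proof.
move=> mv; under eq_fun do rewrite quadformE.
apply: measurable_sum => i; apply: measurable_sum => j.
by apply: measurable_funM; [apply: measurable_funM|].
Qed.

Lemma jointly_measurable_slice d (T : measurableType d) n
    (f : T -> 'cV[R]_(1 + n) -> \bar R) : jointly_measurable f ->
  jointly_measurable (fun (wx : T * R) v =>
    f wx.1 (col_mx (wx.2%:M : 'cV_1) v)).
Proof.
move=> mf d' T' psi v mpsi mv; apply: mf.
  exact: (measurableT_comp measurable_fst mpsi).
by apply: measurable_col_mx => //; exact: (measurableT_comp measurable_snd mpsi).
Qed.

Lemma lebesgue_cV_ge0 n (f : 'cV[R]_n -> \bar R) :
  (forall v, 0 <= f v)%E -> (0 <= lebesgue_cV f)%E.
Proof.
elim: n f => [|n IH] f f0 //=.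
by apply: integral_ge0 => x _; exact: IH.
Qed.

Lemma le_lebesgue_cV n (f g : 'cV[R]_n -> \bar R) :
  (forall v, 0 <= f v)%E -> (forall v, f v <= g v)%E ->
  (lebesgue_cV f <= lebesgue_cV g)%E.
Proof.
elim: n f g => [|n IH] f g f0 fg //=.
by apply: le_lower_integral => x; [exact: lebesgue_cV_ge0|exact: IH].
Qed.

Lemma measurable_lebesgue_cV d (T : measurableType d) n
    (f : T -> 'cV[R]_n -> \bar R) : (forall w v, 0 <= f w v)%E ->
  jointly_measurable f -> measurable_fun setT (fun w => lebesgue_cV (f w)).
Proof.
elim: n d T f => [|n IH] d T f f0 mf /=.
  by apply: (mf _ _ id (fun=> 0)) => // i; exact: measurable_cst.
have := @measurable_fun_fubini_tonelli_F _ _ T _ R lebesgue_measure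
  (fun wx : T * R => lebesgue_cV (fun v => f wx.1 (col_mx (wx.2%:M : 'cV_1) v))).
apply; last by move=> wx; exact: lebesgue_cV_ge0.
apply: (IH _ _ (fun (wx : T * R) v => f wx.1 (col_mx (wx.2%:M : 'cV_1) v))) => //.
exact: jointly_measurable_slice.
Qed.

(** The exchange is done one coordinate at a time, by Tonelli's theorem for two
    measures. *)
Lemma tonelli_lebesgue_cV d (T : measurableType d)
    (P : {sigma_finite_measure set T -> \bar R}) n
    (f : T -> 'cV[R]_n -> \bar R) : (forall w v, 0 <= f w v)%E ->
  jointly_measurable f ->
  (\int[P]_w lebesgue_cV (f w) = lebesgue_cV (fun v => \int[P]_w f w v))%E.
Proof.
elim: n f => [|n IH] f f0 mf //=.
pose F (wx : T * R) := lebesgue_cV (fun v => f wx.1 (col_mx (wx.2%:M : 'cV_1) v)).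
transitivity (\int[lebesgue_measure]_x \int[P]_w F (w, x))%E; last first.
  apply: eq_integral => x _; rewrite -IH// => d' T' psi v mpsi mv.
  by apply: mf => //; apply: measurable_col_mx => //; exact: measurable_cst.
apply: (@fubini_tonelli _ _ T _ R P lebesgue_measure F).
- apply: (@measurable_lebesgue_cV _ _ _
    (fun (wx : T * R) v => f wx.1 (col_mx (wx.2%:M : 'cV_1) v))) => //.
  exact: jointly_measurable_slice.
- by move=> wx; exact: lebesgue_cV_ge0.
Qed.

(** The first argument is a dummy: its type R is an arbitrary choice. *)
Definition measurable_cV n (f : 'cV[R]_n -> \bar R) : Prop :=
  jointly_measurable (fun _ : R => f).

Lemma measurable_cV_slice n (f : 'cV[R]_(1 + n) -> \bar R) : measurable_cV f ->
  jointly_measurable (fun (x : R) v => f (col_mx (x%:M : 'cV_1) v)).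
Proof.
move=> mf d' T' psi v mpsi mv; apply: (mf _ _ psi) => //.
exact: measurable_col_mx.
Qed.

Lemma measurable_cV_slice1 n (f : 'cV[R]_(1 + n) -> \bar R) (x : R) :
  measurable_cV f -> measurable_cV (fun v => f (col_mx (x%:M : 'cV_1) v)).
Proof.
move=> mf d' T' psi v mpsi mv; apply: (mf _ _ psi) => //.
by apply: measurable_col_mx => //; exact: measurable_cst.
Qed.

Lemma lebesgue_cVZl n (c : R) (f : 'cV[R]_n -> \bar R) : 0 <= c ->
  (forall v, 0 <= f v)%E -> measurable_cV f ->
  (lebesgue_cV (fun v => c%:E * f v) = c%:E * lebesgue_cV f)%E.
Proof.
move=> c0; elim: n f => [|n IH] f f0 mf //=.
under eq_integral.
  move=> x _; rewrite IH//; last exact: measurable_cV_slice1.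
  over.
rewrite ge0_integralZl_EFin//; first by move=> x _; exact: lebesgue_cV_ge0.
apply: (@measurable_lebesgue_cV _ _ _ (fun (x : R) v => f (col_mx (x%:M : 'cV_1) v))) => //.
exact: measurable_cV_slice.
Qed.

End iterated_integral.

(** * Positive definite matrices and Gaussian integrals *)

Section positive_definite.
Context {R : realType}.

Definition posdefmx d (A : 'M[R]_d) : Prop :=
  A^T = A /\ forall v, v != 0 -> 0 < quadform A v.

Lemma quadform0 d (A : 'M[R]_d) : quadform A 0 = 0.
Proof. by rewrite /quadform mulmx0 mxE. Qed.

Lemma posdef_psd d (A : 'M[R]_d) : posdefmx A -> psdmx A.
Proof.
move=> [As Ap]; split=> // v; have [->|/Ap/ltW//] := eqVneq v 0.
by rewrite quadform0.
Qed.

Lemma posdef_unit d (A : 'M[R]_d) : posdefmx A -> A \in unitmx.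
Proof.
move=> [As Ap]; rewrite -row_free_unit -kermx_eq0.
apply/eqP/row_matrixP => i; rewrite row0; apply: trmx_inj; rewrite trmx0.
apply/eqP; apply: contraT => /Ap; rewrite /quadform trmxK -row_mul mulmx_ker row0.
by rewrite mul0mx mxE ltxx.
Qed.

Lemma psd_unit_posdef d (A : 'M[R]_d) : psdmx A -> A \in unitmx -> posdefmx A.
Proof.
move=> psdA Au; have [[Bs _] BB] := sqrtmx_spec psdA.
split; first exact: (proj1 psdA).
move=> v v0; rewrite lt_neqAle (proj2 psdA) andbT eq_sym.
apply: contra v0 => /eqP q0.
have /eqP : l2norm (sqrtmx A *m v) ^+ 2 = 0 by rewrite l2norm_sqrtmx.
rewrite l2norm_sqr psumr_eq0; last by move=> i _; exact: sqr_ge0.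
move=> /allP H; have Bv : sqrtmx A *m v = 0.
  apply/colP => i; rewrite [RHS]mxE; apply/eqP; rewrite -sqrf_eq0.
  exact: (H i (mem_index_enum _)).
by rewrite -(mulKmx Au v) -BB -mulmxA Bv !mulmx0.
Qed.

Lemma posdefZ d c (A : 'M[R]_d) : 0 < c -> posdefmx A -> posdefmx (c *: A).
Proof.
move=> c0 [As Ap]; split; first by rewrite linearZ /= As.
by move=> v v0; rewrite quadformZ mulr_gt0// Ap.
Qed.

Lemma loewner_le_quadform d (A B : 'M[R]_d) v :
  loewner_le A B -> quadform A v <= quadform B v.
Proof. by move=> [_ /(_ v)]; rewrite quadformB subr_ge0. Qed.

Lemma loewner_le_posdef d (A B : 'M[R]_d) :
  posdefmx A -> loewner_le A B -> posdefmx B.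
Proof.
move=> [As Ap] AB; split; last first.
  by move=> v v0; apply: lt_le_trans (loewner_le_quadform v AB); exact: Ap.
have [sAB _] := AB; move: sAB; rewrite linearB /= As => /eqP.
by rewrite (inj_eq (addIr _)) => /eqP.
Qed.

(** Completing the square in the last n coordinates: s is the Schur complement
    of the lower right block N.  Every integral below is computed one
    coordinate at a time with this identity, so that no change of variables in
    several dimensions is needed. *)
Lemma schur_complement n (M : 'M[R]_(1 + n)) : posdefmx M ->
  exists s (k : 'cV[R]_n) (N : 'M[R]_n),
    [/\ posdefmx N, 0 < s, \det M = s * \det N &
      forall x v, quadform M (col_mx (x%:M : 'cV_1) v) =
        s * x ^+ 2 + quadform N (v + x *: k)].
Proof.
move=> Mpd; have [Ms Mp] := Mpd.
pose r := ursubmx M; pose N := drsubmx M; pose a := ulsubmx M.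
have ME : M = block_mx a r r^T N.
  rewrite -[LHS]submxK -/a -/r -/N; congr block_mx.
  by rewrite /r trmx_ursub Ms.
have Ns : N^T = N by rewrite /N trmx_drsub Ms.
have quadE x v : quadform M (col_mx (x%:M : 'cV_1) v) =
    a 0 0 * x ^+ 2 + 2 * x * (r *m v) 0 0 + quadform N v.
  rewrite /quadform ME tr_col_mx tr_scalar_mx mul_row_block mul_row_col.
  rewrite !mulmxDl !mul_scalar_mx !mul_mx_scalar.
  have -> : v^T *m r^T = (r *m v)^T by rewrite trmx_mul.
  rewrite -?scalemxAl.
  by rewrite !mxE; ring.
have Npd : posdefmx N.
  split=> // v v0; have := Mp (col_mx ((0 : R)%:M : 'cV_1) v).
  rewrite quadE expr0n !mulr0 mul0r !add0r; apply.
  apply: contra v0 => /eqP; rewrite -[X in _ = X](vsubmxK (0 : 'cV[R]_(1 + n))).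
  by move=> /eq_col_mx[_ ->]; rewrite linear0.
have Nu := posdef_unit Npd.
pose k := invmx N *m r^T.
have Nk : N *m k = r^T by rewrite /k mulmxA mulmxV// mul1mx.
have kN : k^T *m N = r by have := trmx_mul N k; rewrite Nk Ns trmxK.
pose s := a 0 0 - (r *m k) 0 0.
have sqE x v : quadform M (col_mx (x%:M : 'cV_1) v) =
    s * x ^+ 2 + quadform N (v + x *: k).
  rewrite quadE /s /quadform.
  have -> : (v + x *: k)^T = v^T + x *: k^T by rewrite linearD /= linearZ.
  rewrite !mulmxDl -!scalemxAl kN !mulmxDr -!scalemxAr -(mulmxA v^T N k) Nk.
  have -> : v^T *m r^T = (r *m v)^T by rewrite trmx_mul.
  by rewrite !mxE; ring.
exists s, k, N; split=> //.
  have := Mp (col_mx ((1 : R)%:M : 'cV_1) (- (1 *: k))).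
  rewrite sqE addNr quadform0 addr0 expr1n mulr1; apply.
  apply/negP => /eqP; rewrite -[X in _ = X](vsubmxK (0 : 'cV[R]_(1 + n))).
  move=> /eq_col_mx[/matrixP/(_ 0 0) + _]; rewrite !mxE eqxx => /eqP.
  by rewrite oner_eq0.
have -> : M = block_mx 1%:M (k^T) 0 1%:M *m block_mx (s%:M : 'M[R]_1) 0 r^T N.
  have kr : k^T *m r^T = r *m k by rewrite -Nk mulmxA kN.
  rewrite mulmx_block !mul1mx !mul0mx ?mulmx0 !add0r kN kr.
  rewrite [LHS]ME; congr block_mx.
  by apply/matrixP => i j; rewrite !ord1 [RHS]mxE [in RHS]mxE eqxx mulr1n /s subrK.
by rewrite det_mulmx det_ublock !det1 mulr1 mul1r det_lblock det_scalar1.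
Qed.

End positive_definite.

Section gaussian_integral.
Context {R : realType}.
Local Notation mu := (@lebesgue_measure R).

Lemma cons_cV n (m : 'cV[R]_(1 + n)) :
  exists x v, m = col_mx (x%:M : 'cV_1) v.
Proof.
exists (m 0 0), (dsubmx m); rewrite -[LHS]vsubmxK.
suff -> : usubmx m = (m 0 0)%:M by [].
apply/matrixP => i j; rewrite !ord1 !mxE eqxx mulr1n.
by congr (m _ _); exact/val_inj.
Qed.

Lemma cons_cVB n (x y : R) (u v : 'cV[R]_n) :
  col_mx (x%:M : 'cV_1) u - col_mx (y%:M : 'cV_1) v =
  col_mx ((x - y)%:M : 'cV_1) (u - v).
Proof. by rewrite opp_col_mx add_col_mx raddfB. Qed.

Lemma integral_gauss1 (s m : R) : 0 < s ->
  (\int[mu]_x (expR (- (s * (x - m) ^+ 2) / 2))%:E =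
   (Num.sqrt (2 * pi / s))%:E)%E.
Proof.
move=> s0; pose sg := (Num.sqrt s)^-1.
have sq0 : 0 < Num.sqrt s by rewrite sqrtr_gt0.
have sg0 : sg != 0 by rewrite invr_eq0 gt_eqF.
have sg2 : sg ^+ 2 = s^-1 by rewrite exprVn sqr_sqrtr// ltW.
have peak0 := normal_peak_gt0 sg0.
transitivity (\int[mu]_x ((normal_peak sg)^-1%:E * (normal_pdf m sg x)%:E))%E.
  apply: eq_integral => x _; rewrite normal_pdfE// -EFinM; congr EFin.
  rewrite mulKf ?gt_eqF// /normal_fun sg2; congr expR.
  rewrite -[_ *+ 2]mulr_natr; field; lra.
rewrite ge0_integralZl_EFin//.
- rewrite integral_normal_pdf mule1 /normal_peak invrK sg2; congr (Num.sqrt _)%:E.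
  by rewrite -mulr_natr; ring.
- by move=> x _; rewrite lee_fin normal_pdf_ge0.
- by apply/measurable_EFinP; exact: measurable_normal_pdf.
- by rewrite invr_ge0 ltW.
Qed.

Lemma measurable_cV_gauss n (M : 'M[R]_n) m :
  measurable_cV (fun t => (expR (- quadform M (t - m) / 2))%:E).
Proof.
move=> d' T' psi v _ mv; apply/measurable_EFinP.
apply: measurableT_comp => //; apply: measurable_funM => //.
apply: measurableT_comp => //.
by apply: measurable_quadform; exact: measurable_subvec.
Qed.

(** The determinant is shown to be positive in the same induction, because the
    value of the inner integral already divides by the determinant of N. *)
Lemma gaussian_integral n (M : 'M[R]_n) (m : 'cV[R]_n) : posdefmx M ->
  0 < \det M /\
  lebesgue_cV (fun t => (expR (- quadform M (t - m) / 2))%:E) =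
    (Num.sqrt ((2 * pi) ^+ n / \det M))%:E.
Proof.
elim: n M m => [|n IH] M m Mpd /=.
  rewrite det_mx00 ltr01 divr1 expr0 sqrtr1 /quadform; split=> //.
  by rewrite (_ : (_ *m _ *m _) = 0) ?mxE ?oppr0 ?mul0r ?expR0//; apply/matrixP => i j; rewrite !mxE big_ord0.
have [s [k [N [Npd s0 detE quadE]]]] := schur_complement Mpd.
have [N0 _] := IH N 0 Npd.
rewrite detE mulr_gt0//; split=> //.
have [m1 [m2 mE]] := cons_cV (m : 'cV_(1 + n)).
have shiftE x v : col_mx (x%:M : 'cV_1) v - m = col_mx ((x - m1)%:M : 'cV_1) (v - m2).
  by rewrite mE; exact: cons_cVB.
have inner x : lebesgue_cV (fun v : 'cV_n =>
     (expR (- quadform M (col_mx (x%:M : 'cV_1) v - m) / 2))%:E) =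
   ((Num.sqrt ((2 * pi) ^+ n / \det N))%:E
     * (expR (- (s * (x - m1) ^+ 2) / 2))%:E)%E.
  pose m' := m2 - (x - m1) *: k.
  transitivity (lebesgue_cV (fun v : 'cV_n =>
     ((expR (- (s * (x - m1) ^+ 2) / 2))%:E *
      (expR (- quadform N (v - m') / 2))%:E)%E)).
    congr lebesgue_cV; apply/funext => v; rewrite -EFinM -expRD; congr (expR _)%:E.
    rewrite shiftE quadE /m' opprB addrA addrAC (addrAC v).
    ring.
  rewrite lebesgue_cVZl ?expR_ge0//.
  - by rewrite (IH N m' Npd).2 muleC.
  exact: measurable_cV_gauss.
under eq_integral do rewrite inner.
rewrite ge0_integralZl_EFin ?sqrtr_ge0//.
- rewrite integral_gauss1// -EFinM -sqrtrM; last first.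
    by rewrite divr_ge0 ?exprn_ge0 ?mulr_ge0 ?pi_ge0// ltW.
  congr (Num.sqrt _)%:E; rewrite exprSr; field.
  by rewrite !gt_eqF.
apply/measurable_EFinP; apply: measurableT_comp => //.
apply: measurable_funM => //; apply: measurableT_comp => //.
by apply: measurable_funM => //; apply: measurable_funX; exact: measurable_funB.
Qed.

(** Both determinants are read off Gaussian integrals, which are monotone. *)
Lemma posdef_det_le n (A B : 'M[R]_n) : posdefmx A -> loewner_le A B ->
  \det A <= \det B.
Proof.
move=> Apd AB; have Bpd := loewner_le_posdef Apd AB.
have [A0 AE] := gaussian_integral 0 Apd; have [B0 BE] := gaussian_integral 0 Bpd.
have c0 : 0 < (2 * pi : R) ^+ n by rewrite exprn_gt0// mulr_gt0// pi_gt0.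
have : ((Num.sqrt ((2 * pi) ^+ n / \det B))%:E <=
        (Num.sqrt ((2 * pi) ^+ n / \det A))%:E)%E.
  rewrite -AE -BE; apply: le_lebesgue_cV => v; first by rewrite lee_fin expR_ge0.
  rewrite lee_fin ler_expR !mulNr lerN2 ler_pM2r//; exact: loewner_le_quadform.
rewrite lee_fin ler_sqrt; last by rewrite divr_ge0// ltW.
by rewrite (ler_pM2l c0) lef_pV2.
Qed.

(** The ellipsoid contains, in the coordinates of successive Schur complements,
    the cube of half-width 1. *)
Lemma ellipsoid_volume_ge n (M : 'M[R]_n) (m : 'cV[R]_n) : posdefmx M ->
  ((2 ^+ n / Num.sqrt (\det M))%:E <=
   lebesgue_cV (fun t => ((quadform M (t - m) <= n%:R)%R%:R : R)%:E))%E.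
Proof.
elim: n M m => [|n IH] M m Mpd /=.
  rewrite det_mx00 sqrtr1 expr0 divr1 /quadform.
  by rewrite (_ : (_ *m _ *m _) = 0) ?mxE ?lexx//; apply/matrixP => i j; rewrite !mxE big_ord0.
have [s [k [N [Npd s0 detE quadE]]]] := schur_complement Mpd.
have [N0 _] := gaussian_integral 0 Npd.
have [m1 [m2 mE]] := cons_cV (m : 'cV_(1 + n)).
have shiftE x v : col_mx (x%:M : 'cV_1) v - m = col_mx ((x - m1)%:M : 'cV_1) (v - m2).
  by rewrite mE; exact: cons_cVB.
have sq0 : 0 < Num.sqrt s by rewrite sqrtr_gt0.
pose h := (Num.sqrt s)^-1; have h0 : 0 < h by rewrite invr_gt0.
pose V := 2 ^+ n / Num.sqrt (\det N).
have V0 : 0 <= V by rewrite divr_ge0 ?exprn_ge0 ?sqrtr_ge0.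
apply: (@le_trans _ _ (\int[mu]_x (V%:E * (\1_`[m1 - h, m1 + h] x)%:E))%E).
  rewrite ge0_integralZl_EFin//.
  - rewrite integral_indic//= setIT lebesgue_measure_itv/= lte_fin.
    rewrite ifT; last by lra.
    rewrite -EFinB -EFinM lee_fin /V /h detE (sqrtrM _ (ltW s0)) exprS.
    rewrite le_eqVlt; apply/orP; left; apply/eqP; field.
    by rewrite !gt_eqF// sqrtr_gt0.
  - by apply/measurable_EFinP; exact: measurable_indic.
apply: le_lower_integral => x; first by rewrite mule_ge0 ?lee_fin.
rewrite indicE; case: (boolP (x \in _)) => /=.
  rewrite mem_setE in_itv /= => /andP[xl xr]; rewrite mule1.
  apply: (le_trans (IH N (m2 - (x - m1) *: k) Npd)).
  apply: le_lebesgue_cV => v; first by rewrite lee_fin ler0n.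
  rewrite lee_fin ler_nat.
  case qN : (quadform N _ <= _) => //; rewrite shiftE quadE.
  suff -> : s * (x - m1) ^+ 2 + quadform N (v - m2 + (x - m1) *: k) <= n.+1%:R by [].
  rewrite -natr1 [leRHS]addrC lerD//; last first.
    by move: qN; rewrite opprB addrA addrAC.
  have h2 : h ^+ 2 = s^-1 by rewrite exprVn sqr_sqrtr// ltW.
  rewrite -ler_pdivlMl// mulr1 -h2; nra.
move=> _; rewrite mule0; apply: lebesgue_cV_ge0 => v; by rewrite lee_fin ler0n.
Qed.

End gaussian_integral.

(** * Calculus of the cumulant function *)

Section cumulant_function.
Context {R : realType} (b : R -> R).
Hypothesis b_diff : forall (m : nat) (x : R), (m < 3)%N ->
  derivable b^`(m)%classic x 1.
Local Notation b1 := (b^`(1)%classic).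
Local Notation b2 := (b^`(2)%classic).

Lemma half01 : 0 < (2^-1 : R) < 1.
Proof. by apply/andP; split; lra. Qed.

Lemma unit_interval_coef (a s : R) : 0 < a < 1 -> 0 <= s <= 1 ->
  0 <= a + s * (1 - a) <= 1 /\ 0 <= a - s * a <= 1.
Proof.
move=> /andP[a0 a1] /andP[s0 s1].
have sa : 0 <= s * (1 - a) by rewrite mulr_ge0// subr_ge0 ltW.
have sa' : 0 <= (1 - s) * (1 - a) by apply: mulr_ge0; rewrite subr_ge0// ltW.
have sb : 0 <= s * a by rewrite mulr_ge0// ltW.
have sb' : 0 <= (1 - s) * a by apply: mulr_ge0; rewrite ?subr_ge0// ltW.
by split; apply/andP; split; lra.
Qed.

Lemma is_derive_b (x : R) : is_derive x 1 b (b1 x).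
Proof.
by rewrite derive1n1 derive1E; apply: DeriveDef => //; have := @b_diff 0 x; rewrite derive1n0; exact.
Qed.

Lemma is_derive_b1 (x : R) : is_derive x 1 b1 (b2 x).
Proof.
by rewrite (derive1nS b 1) derive1E; apply: DeriveDef => //; exact: b_diff.
Qed.

Lemma is_derive_line (f df : R -> R) (x h t : R) : (forall x : R, is_derive x 1 f (df x)) ->
  is_derive t 1 (fun s => f (x + s * h)) (h * df (x + t * h)).
Proof.
move=> fd.
have dl : is_derive t 1 (fun s => x + s * h) h.
  have -> : (fun s => x + s * h) = cst x \+ (h \*: (@id R)).
    by apply/funext => s /=; rewrite /GRing.scale /= mulrC.
  by apply: is_derive_eq; rewrite add0r scaler1.
by rewrite mulrC; exact: (@is_derive1_comp _ f (fun s : R => x + s * h) t _ h (fd _) dl).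
Qed.

Lemma within_continuous (f df : R -> R) (a c : R) :
  (forall x : R, is_derive x 1 f (df x)) -> {within `[a, c], continuous f}.
Proof.
move=> fd; apply: derivable_within_continuous => x _.
exact: (@ex_derive _ _ _ _ _ _ _ (fd x)).
Qed.

Lemma mvt_line (f df : R -> R) (x h t : R) : (forall x : R, is_derive x 1 f (df x)) ->
  0 <= t -> exists2 c, 0 <= c <= t & f (x + t * h) - f x = h * df (x + c * h) * t.
Proof.
move=> fd t0; have ld s := is_derive_line x h s fd.
have [|c cin] := @MVT_segment _ _ _ 0 t t0 (fun s _ => ld s).
  exact: within_continuous ld.
by rewrite mul0r addr0 subr0 => E; exists c => //; move: cin; rewrite in_itv.
Qed.

Lemma taylor2 (x h : R) : exists2 t, 0 <= t <= 1 &
  b (x + h) = b x + b1 x * h + b2 (x + t * h) * h ^+ 2 / 2.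
Proof.
pose F (s : R) : R := b (x + s * h) - (b x + (b1 x * h) * s).
pose dF (s : R) : R := h * b1 (x + s * h) - b1 x * h.
have Fd (s : R) : is_derive s 1 F (dF s).
  have l1 := is_derive_line x h s is_derive_b.
  have l2 : is_derive s 1 (fun s => b x + (b1 x * h) * s) (b1 x * h).
    have -> : (fun s => b x + (b1 x * h) * s) = cst (b x) \+ ((b1 x * h) \*: (@id R)).
      by apply/funext => u.
    by apply: is_derive_eq; rewrite add0r scaler1.
  exact: is_deriveB.
pose G (s : R) := s ^+ 2; pose dG (s : R) := 2 * s.
have Gd (s : R) : is_derive s 1 G (dG s).
  rewrite /G /dG; apply: is_derive_eq.
  by rewrite /GRing.scale /= mulr1 mulr_natl mulr2n.
have dG0 (s : R) : s \in `]0, 1[ -> dG s != 0.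
  by rewrite in_itv /= => /andP[s0 _]; rewrite /dG mulf_neq0// gt_eqF.
have [c] := cauchy_MVT ltr01 (within_continuous Fd) (within_continuous Gd)
  (fun s _ => Fd s) (fun s _ => Gd s) dG0.
rewrite in_itv /= => /andP[c0 c1] E.
have [t /andP[t0 tc] Et] := mvt_line x h is_derive_b1 (ltW c0).
exists t; first by rewrite t0 (le_trans tc (ltW c1)).
move: E; rewrite /F /G /dF /dG mul1r mul0r addr0 !mulr1 mulr0 addr0 subrr subr0 expr1n expr0n subr0 divr1.
have -> : h * b1 (x + c * h) - b1 x * h = h * (b1 (x + c * h) - b1 x) by ring.
rewrite Et => E.
have {}E : b (x + h) - (b x + b1 x * h) = b2 (x + t * h) * h ^+ 2 / 2.
  rewrite -E; field; lra.
by rewrite -[LHS](subrK (b x + b1 x * h)) E addrC.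
Qed.

Hypothesis b_convex : strictly_convex b.
Variable Cdev : R.
Hypothesis Cdev1 : 1 <= Cdev.
Hypothesis b_dev : forall x y, `|y| <= 2^-1 -> b2 (x + y) <= Cdev * b2 x.

(** A negative second derivative at x would, by the deviation bound, stay
    negative on a neighbourhood, where b would then be midpoint concave. *)
Lemma b2_ge0 x : 0 <= b2 x.
Proof.
rewrite leNgt; apply/negP => b2x.
have neg (t : R) : `|t| <= 1 -> b2 (x + t * 2^-1) < 0.
  move=> t1; apply: (@le_lt_trans _ _ (Cdev * b2 x)); last by rewrite pmulr_rlt0 // (lt_le_trans ltr01).
  apply: b_dev; rewrite normrM (ger0_norm (x := 2^-1))// ?invr_ge0//.
  by rewrite ler_piMl// invr_ge0.
have [s /andP[s0 s1] Es] := taylor2 x 2^-1.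
have [t /andP[t0 t1] Et] := taylor2 x (- 2^-1).
have ns := neg s; have nt := neg (- t).
have {}ns : b2 (x + s * 2^-1) < 0 by apply: ns; rewrite ger0_norm.
have {}nt : b2 (x + t * - 2^-1) < 0 by rewrite mulrN -mulNr; apply: nt; rewrite normrN ger0_norm.
have := @b_convex (x + 2^-1) (x - 2^-1) 2^-1.
have -> : 2^-1 * (x + 2^-1) + (1 - 2^-1) * (x - 2^-1) = x by field.
have xne : x + 2^-1 != x - 2^-1.
  by rewrite -subr_eq0 (_ : _ - _ = 1) ?oner_neq0//; field.
move=> /(_ xne half01); rewrite Es Et.
set U := b2 _ in ns *; set V := b2 _ in nt *.
have -> : 2^-1 * (b x + b1 x / 2 + U * 2^-1 ^+ 2 / 2) +
    (1 - 2^-1) * (b x + b1 x * - 2^-1 + V * (- 2^-1) ^+ 2 / 2) =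
    b x + (U + V) / 16 by field.
by move: ns nt; clear; lra.
Qed.

Lemma b2_dev_ge x y : `|y| <= 2^-1 -> b2 x / Cdev <= b2 (x + y).
Proof.
move=> y2; rewrite ler_pdivrMr ?(lt_le_trans ltr01)// mulrC.
by have := @b_dev (x + y) (- y); rewrite addrK normrN; exact.
Qed.

Lemma shrink (t h : R) : 0 <= t <= 1 -> `|h| <= 2^-1 -> `|t * h| <= 2^-1 :> R.
Proof.
move=> /andP[t0 t1] h2; rewrite normrM (ger0_norm t0).
by apply: le_trans h2; rewrite ler_piMl.
Qed.

Lemma b_quadratic_le x h : `|h| <= 2^-1 ->
  b (x + h) <= b x + b1 x * h + Cdev * b2 x * h ^+ 2 / 2.
Proof.
move=> h2; have [t t01 ->] := taylor2 x h.
rewrite lerD2l ler_pM2r// ler_wpM2r ?sqr_ge0//.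
by apply: b_dev; exact: shrink.
Qed.

Lemma b_quadratic_ge x h : `|h| <= 2^-1 ->
  b x + b1 x * h + b2 x / Cdev * h ^+ 2 / 2 <= b (x + h).
Proof.
move=> h2; have [t t01 ->] := taylor2 x h.
rewrite lerD2l ler_pM2r// ler_wpM2r ?sqr_ge0//.
by apply: b2_dev_ge; exact: shrink.
Qed.

Definition jensen_gap (a x h : R) := a * b (x + h) + (1 - a) * b x - b (x + a * h).

(** Expanding b at the intermediate point x + a h cancels the first order terms. *)
Lemma jensen_gap_quadratic (a x h : R) : 0 < a < 1 -> `|h| <= 2^-1 ->
  a * (1 - a) / (2 * Cdev) * (b2 x * h ^+ 2) <= jensen_gap a x h.
Proof.
move=> a01 h2; rewrite /jensen_gap; have /andP[a0 a1] := a01.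
have C0 : 0 < Cdev by apply: lt_le_trans Cdev1.
set z := x + a * h.
have [s s01] := taylor2 z ((1 - a) * h).
have [t t01] := taylor2 z (- a * h).
have -> : z + (1 - a) * h = x + h by rewrite /z; ring.
have -> : z + - a * h = x by rewrite /z; ring.
have -> : z + s * ((1 - a) * h) = x + (a + s * (1 - a)) * h by rewrite /z; ring.
have -> : z + t * (- a * h) = x + (a - t * a) * h by rewrite /z; ring.
have b2s : b2 x / Cdev <= b2 (x + (a + s * (1 - a)) * h).
  by apply: b2_dev_ge; apply: shrink => //; exact: (unit_interval_coef a01 s01).1.
have b2t : b2 x / Cdev <= b2 (x + (a - t * a) * h).
  by apply: b2_dev_ge; apply: shrink => //; exact: (unit_interval_coef a01 t01).2.
move=> -> ->; rewrite -subr_ge0.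
set B := b2 x in b2s b2t *; set U := b2 _ in b2s *; set V := b2 _ in b2t *.
have -> : a * (b z + b1 z * ((1 - a) * h) + U * ((1 - a) * h) ^+ 2 / 2) +
   (1 - a) * (b z + b1 z * (- a * h) + V * (- a * h) ^+ 2 / 2) - b z -
   a * (1 - a) / (2 * Cdev) * (B * h ^+ 2) =
   (a * (1 - a) * h ^+ 2 / 2) * ((1 - a) * (U - B / Cdev) + a * (V - B / Cdev)).
  field; lra.
rewrite mulr_ge0//.
  by rewrite divr_ge0// mulr_ge0 ?sqr_ge0// mulr_ge0//; lra.
by rewrite addr_ge0// mulr_ge0//; lra.
Qed.

Lemma b1_mono y u : 0 <= u * (b1 (y + u) - b1 y).
Proof.
have [c _] := mvt_line y u is_derive_b1 ler01.
rewrite mul1r mulr1 => ->; rewrite mulrA -expr2 mulr_ge0 ?sqr_ge0 ?b2_ge0//.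
Qed.

(** The derivative of t |-> jensen_gap a x (t h) is
    a h (b'(x + t h) - b'(x + a t h)), which is nonnegative since b' increases. *)
Lemma jensen_gap_mono (a x h t : R) : 0 < a < 1 -> 0 <= t <= 1 ->
  jensen_gap a x (t * h) <= jensen_gap a x h.
Proof.
move=> /andP[a0 a1] /andP[t0 t1].
pose F (s : R) : R := a * b (x + s * h) - b (x + s * (a * h)).
pose dF (s : R) : R := a * (h * b1 (x + s * h)) - a * h * b1 (x + s * (a * h)).
have Fd (s : R) : is_derive s 1 F (dF s).
  have l1 := is_derive_line x h s is_derive_b.
  have l2 := is_derive_line x (a * h) s is_derive_b.
  have l3 : is_derive s 1 (a \*: (fun s => b (x + s * h))) (a *: (h * b1 (x + s * h))).
    exact: is_deriveZ.
  exact: (is_deriveB l3 l2).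
have [|c] := @MVT_segment _ _ _ t 1 t1 (fun s _ => Fd s).
  exact: within_continuous Fd.
rewrite in_itv /= => /andP[tc c1] E.
have dF0 : 0 <= dF c.
  have c0 : 0 <= c by exact: le_trans tc.
  have [->|cn0] := eqVneq c 0.
    rewrite /dF !mul0r !addr0; have -> : a * (h * b1 x) - a * h * b1 x = 0 by ring.
    by [].
  have := b1_mono (x + c * (a * h)) (c * (1 - a) * h).
  have -> : x + c * (a * h) + c * (1 - a) * h = x + c * h by ring.
  have cp : 0 < c by rewrite lt_neqAle eq_sym cn0.
  rewrite /dF; set p := b1 _; set q := b1 _ => H.
  have -> : a * (h * p) - a * h * q = (a / (c * (1 - a))) * (c * (1 - a) * h * (p - q)).
    by field; apply/andP; split; lra.
  by rewrite mulr_ge0// divr_ge0// ?mulr_ge0//; lra.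
have : 0 <= F 1 - F t by rewrite E mulr_ge0// subr_ge0.
rewrite /F /jensen_gap !mul1r mulrCA; lra.
Qed.

Lemma continuous_cumulant : continuous b.
Proof.
move=> x; apply: differentiable_continuous; apply/derivable1_diffP.
exact: (@ex_derive _ _ _ _ _ _ _ (is_derive_b x)).
Qed.

Lemma measurable_cumulant : measurable_fun setT b.
Proof. by apply: continuous_measurable_fun; exact: continuous_cumulant. Qed.

End cumulant_function.

(** * Measures with densities and independence *)

Section density.
Context d1 d2 (T : measurableType d1) (U : measurableType d2) (R : realType).
Context (mu1 : {measure set U -> \bar R}) (mu2 : {measure set T -> \bar R}).
Context (h : T -> U) (G : T -> R) (c : R).
Hypothesis mh : measurable_fun setT h.
Hypothesis mG : measurable_fun setT G.
Hypothesis G0 : forall x, 0 <= G x.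
Hypothesis mu1E : forall B, measurable B ->
  (c%:E * mu1 B = \int[mu2]_(x in h @^-1` B) (G x)%:E)%E.
Import HBNNSimple.
Local Open Scope ereal_scope.

Lemma nnsfun_density (g : {nnsfun U >-> R}) :
  c%:E * \int[mu1]_y (g y)%:E = \int[mu2]_x ((g (h x))%:E * (G x)%:E).
Proof.
have mpre r : measurable (h @^-1` (g @^-1` [set r])).
  by rewrite -[X in measurable X]setTI; apply: mh.
rewrite integralT_nnsfun sintegralE.
transitivity (\int[mu2]_x (\sum_(r \in range g)
    (r%:E * ((\1_(h @^-1` (g @^-1` [set r])) x)%:E * (G x)%:E)))); last first.
  apply: eq_integral => x _; rewrite [in RHS]fimfunE -EFinM mulr_fsuml //.
  rewrite -fsumEFin//; apply: eq_fsbigr => r _.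
  by rewrite -!EFinM mulrA.
rewrite ge0_integral_fsum//; last 2 first.
- move=> r; apply: measurable_funeM; apply: emeasurable_funM.
    exact/measurable_EFinP/measurable_indic.
  exact/measurable_EFinP.
- move=> r x _; rewrite -EFinM lee_fin.
  rewrite indicE; case: (boolP (x \in _)) => [|_]; last by rewrite mul0r mulr0.
  by rewrite inE /= => <-; rewrite mul1r mulr_ge0.
rewrite ge0_mule_fsumr; last by move=> r; exact: nnsfun_mulemu_ge0.
apply: eq_fsbigr => r /set_mem[y _ <-].
rewrite ge0_integralZl_EFin//; last 2 first.
- by move=> x _; rewrite -EFinM lee_fin mulr_ge0.
- apply: emeasurable_funM; first exact/measurable_EFinP/measurable_indic.
  exact/measurable_EFinP.
rewrite muleCA mu1E//; congr (_ * _).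
rewrite integral_mkcond; apply: eq_integral => x _.
by rewrite patchE indicE; case: ifP => _; rewrite ?mul1e ?mul0e.
Qed.

(** A measure given on all measurable sets by a density integrates every
    nonnegative function through that density.  It serves for the law of
    one observation and, with G the product of the other factors, for
    passing from independent events to products of functions. *)
Lemma integral_density (f : U -> \bar R) : measurable_fun setT f ->
  (forall y, 0 <= f y) ->
  c%:E * \int[mu1]_y f y = \int[mu2]_x (f (h x) * (G x)%:E).
Proof.
move=> mf f0; pose f_ := nnsfun_approx measurableT mf.
have f_cvg y : (EFin \o f_ ^~ y) @ \oo --> f y.
  exact: (@cvg_nnsfun_approx _ _ _ _ measurableT f mf (fun y _ => f0 y) y I).
have f_nd y : nondecreasing_seq (fun n => (f_ n y)%:E).
  by move=> m n mn; rewrite lee_fin; exact/lefP/nd_nnsfun_approx.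
have mf_ n : measurable_fun setT (fun y => (f_ n y)%:E).
  exact/measurable_EFinP/measurable_funP.
have L1 := @cvg_monotone_convergence _ _ _ mu1 setT measurableT
  (fun n y => (f_ n y)%:E) mf_ (fun n y _ => _) (fun y _ => f_nd y).
have {}L1 : (fun n => \int[mu1]_y (f_ n y)%:E) @ \oo --> \int[mu1]_y f y.
  have := L1 (fun n y => _); rewrite (_ : \int[mu1]_y limn _ = \int[mu1]_y f y).
    by apply=> n y; rewrite lee_fin.
  by apply: eq_integral => y _; apply/cvg_lim => //; exact: f_cvg.
have L2 := @cvg_monotone_convergence _ _ _ mu2 setT measurableT
  (fun n x => (f_ n (h x))%:E * (G x)%:E).
have {}L2 : (fun n => \int[mu2]_x ((f_ n (h x))%:E * (G x)%:E)) @ \oo -->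
    \int[mu2]_x (f (h x) * (G x)%:E).
  rewrite (_ : \int[mu2]_x (f (h x) * (G x)%:E) =
      \int[mu2]_x (limn (fun n => (f_ n (h x))%:E * (G x)%:E))).
    apply: L2.
    - move=> n; apply: emeasurable_funM; last exact/measurable_EFinP.
      exact: (measurableT_comp (mf_ n) mh).
    - by move=> n x _; rewrite mule_ge0 ?lee_fin.
    - move=> x _ m n mn; apply: lee_wpmul2r; first by rewrite lee_fin.
      exact: f_nd.
  apply: eq_integral => x _; apply/esym/cvg_lim => //.
  by apply: cvgeZr => //; exact: f_cvg.
have : (fun n => c%:E * \int[mu1]_y (f_ n y)%:E) @ \oo --> c%:E * \int[mu1]_y f y.
  exact: cvgeZl.
under eq_fun do rewrite nnsfun_density.
by move=> /cvg_lim <- //; rewrite (cvg_lim _ L2).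
Qed.

End density.

Section independence.
Context {R : realType} (n : nat) {disp} {T : measurableType disp}.
Context (P : probability T R) (Y : 'I_n -> {RV P >-> R}).
Hypothesis indep : mutually_independent Y.
Local Open Scope ereal_scope.

(** Independence gives the product formula when all the g i are indicators; the
    indicators are then replaced by arbitrary functions one coordinate at a
    time, the other factors acting as a density. *)
Lemma integral_prod_indep (g : 'I_n -> R -> R) :
  (forall i, measurable_fun setT (g i)) -> (forall i y, (0 <= g i y)%R) ->
  (forall i, \int[P]_w (g i (Y i w))%:E < +oo) ->
  \int[P]_w (\prod_i g i (Y i w))%:E = \prod_i \int[P]_w (g i (Y i w))%:E.
Proof.
suff H m : (m <= n)%N -> forall g : 'I_n -> R -> R,
    (forall i, measurable_fun setT (g i)) -> (forall i y, (0 <= g i y)%R) ->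
    (forall i, \int[P]_w (g i (Y i w))%:E < +oo) ->
    (forall i : 'I_n, (m <= i)%N -> exists2 B, measurable B & g i = \1_B) ->
    \int[P]_w (\prod_i g i (Y i w))%:E = \prod_i \int[P]_w (g i (Y i w))%:E.
  move=> mg g0 gfin; apply: (H n) => // i; rewrite leqNgt ltn_ord //.
elim: m => [|m IH] mn {}g mg g0 gfin gind.
  have /choice[B HB] : forall i, exists B, measurable B /\ g i = \1_B.
    by move=> i; have [B ? ?] := gind i (leq0n _); exists B.
  have mYB i : measurable (Y i @^-1` B i).
    rewrite -[X in measurable X]setTI; apply: measurable_funP => //.
    exact: (HB i).1.
  transitivity (\int[P]_w (\1_(\bigcap_i (Y i @^-1` B i)) w)%:E).
    apply: eq_integral => w _; congr EFin; rewrite indicE.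
    case: (boolP (w \in _)) => [|].
      rewrite inE => wB; apply: big1 => i _; rewrite (HB i).2 indicE mem_set//.
      exact: wB.
    rewrite notin_setE => wB.
    have [i wi] : exists i, ~ B i (Y i w).
      by apply/existsNP => H; apply: wB => i _; exact: H.
    by rewrite (bigD1 i)//= (HB i).2 indicE memNset// mul0r.
  rewrite integral_indic//; last by apply: fin_bigcap_measurable => // i _.
  rewrite setIT; etransitivity; first exact: (indep (fun i => (HB i).1)).
  apply: eq_bigr => i _; rewrite (HB i).2.
  by rewrite -[in LHS](setIT (_ @^-1` _)) -integral_indic.
pose i0 : 'I_n := Ordinal mn.
pose G w := (\prod_(i | i != i0) g i (Y i w))%R.
pose c := \prod_(i | i != i0) \int[P]_w (g i (Y i w))%:E.
have int0 i : 0 <= \int[P]_w (g i (Y i w))%:E.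
  by apply: integral_ge0 => w _; rewrite lee_fin.
have cfin : c \is a fin_num.
  by apply: prode_fin_num => i _; rewrite ge0_fin_numE.
have mYg i : measurable_fun setT (fun w => g i (Y i w)).
  exact: (measurableT_comp (mg i) (measurable_funP (Y i))).
have mG : measurable_fun setT G.
  rewrite /G; under eq_fun do rewrite big_mkcond /=.
  by apply: measurable_prod => i _; case: (i != i0) => //; exact: mYg.
have G0 w : (0 <= G w)%R by exact: prodr_ge0.
have key B : measurable B -> (fine c)%:E * distribution P (Y i0) B =
    \int[P]_(w in Y i0 @^-1` B) (G w)%:E.
  move=> mB; pose g' i := if i == i0 then \1_B else g i.
  have g'0 : g' i0 = \1_B by rewrite /g' eqxx.
  have g'E i : i != i0 -> g' i = g i by rewrite /g' => /negbTE ->.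
  have mYB : measurable (Y i0 @^-1` B).
    by rewrite -[X in measurable X]setTI; exact: measurable_funP.
  have g'i0 : \int[P]_w (g' i0 (Y i0 w))%:E = P (Y i0 @^-1` B).
    by rewrite g'0 -[in RHS](setIT (_ @^-1` _)) -integral_indic.
  have := IH (ltnW mn) g'.
  rewrite (bigD1 i0)//= g'i0 (eq_bigr (fun i => \int[P]_w (g i (Y i w))%:E)); last first.
    by move=> i ii0; rewrite g'E.
  rewrite -/c fineK// muleC => <-.
  - rewrite [RHS]integral_mkcond; apply: eq_integral => w _.
    rewrite (bigD1 i0)//= g'0 (eq_bigr (fun i => g i (Y i w))); last first.
      by move=> i ii0; rewrite g'E.
    rewrite -/(G w) indicE patchE; case: ifPn => [|].
      by rewrite inE /= => ?; rewrite mem_set// mul1r.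
    by rewrite notin_setE /= => ?; rewrite memNset// mul0r.
  - by move=> i; rewrite /g'; case: ifP => // _; exact: measurable_indic.
  - by move=> i y; rewrite /g'; case: ifP.
  - move=> i; have [->|ii0] := eqVneq i i0.
      by rewrite g'i0 (le_lt_trans (probability_le1 _ _))// ltry.
    by rewrite g'E.
  - move=> i mi; have [->|ii0] := eqVneq i i0; first by exists B.
    by rewrite g'E//; apply: gind; rewrite ltn_neqAle mi eq_sym andbT.
have mgi : measurable_fun setT (fun y => (g i0 y)%:E) by exact/measurable_EFinP.
have gi0 y : 0 <= (g i0 y)%:E by rewrite lee_fin.
have E := integral_density (measurable_funP (Y i0)) mG G0 key mgi gi0.
rewrite ge0_integral_distribution// fineK// in E.
rewrite [RHS](bigD1 i0)//= -/c muleC E.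
by apply: eq_integral => w _; rewrite (bigD1 i0)//= EFinM.
Qed.

End independence.

(** * Expectations in the generalized linear model *)

Section glm_expectations.
Context {R : realType} (b k : R -> R) (nu : {measure set R -> \bar R}).
Hypothesis b_diff : forall (m : nat) (x : R), (m < 3)%N ->
  derivable b^`(m)%classic x 1.
Hypothesis b_convex : strictly_convex b.
Hypothesis mk : measurable_fun setT k.
Hypothesis density1 : forall eta : R,
  (\int[nu]_y (glm_density b k eta y)%:E = 1)%E.
Context (n : nat) {disp} {T : measurableType disp} (P : probability T R).
Context (Y : 'I_n -> {RV P >-> R}) (p : nat) (X : 'M[R]_(n, p)).
Context (theta0 : 'cV[R]_p).
Hypothesis sampleY : glm_sample b k P Y nu X theta0.
Local Notation eta i := ((X *m theta0) i 0).

Lemma measurable_glm_density eta : measurable_fun setT (glm_density b k eta).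
Proof.
apply: measurableT_comp => //; apply: measurable_funD => //.
apply: measurable_funB => //; exact: measurable_funM.
Qed.

Lemma measurable_expRM (t : R) i : measurable_fun setT (fun w => expR (t * Y i w)).
Proof. by apply: measurableT_comp => //; apply: measurable_funM. Qed.

(** Tilting by exp (t y) moves the density at eta to the density at eta + t, up to
    the normalization. *)
Lemma mgf_obs i t :
  (\int[P]_w (expR (t * Y i w))%:E = (expR (b (eta i + t) - b (eta i)))%:E)%E.
Proof.
have law B : measurable B -> (1%:E * distribution P (Y i) B =
    \int[nu]_(y in id @^-1` B) (glm_density b k (eta i) y)%:E)%E.
  by move=> mB; rewrite mul1e -(sampleY.2 i _ mB).
have mf : measurable_fun setT (fun y : R => (expR (t * y))%:E).
  apply/measurable_EFinP; apply: measurableT_comp => //; exact: measurable_funM.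
have f0 (y : R) : (0 <= (expR (t * y))%:E)%E by rewrite lee_fin expR_ge0.
have dens0 y : 0 <= glm_density b k (eta i) y by exact: expR_ge0.
have := integral_density (@measurable_id _ _ setT) (measurable_glm_density (eta i))
  dens0 law mf f0.
rewrite mul1e ge0_integral_distribution// => ->.
transitivity (\int[nu]_y ((expR (b (eta i + t) - b (eta i)))%:E *
   (glm_density b k (eta i + t) y)%:E))%E.
  apply: eq_integral => y _; rewrite -!EFinM /glm_density -!expRD.
  by congr (expR _)%:E; ring.
rewrite ge0_integralZl_EFin ?expR_ge0//.
- by rewrite density1 mule1.
- by move=> y _; rewrite lee_fin expR_ge0.
- by apply/measurable_EFinP; exact: measurable_glm_density.
Qed.

Lemma mgf_sample (u : 'I_n -> R) :
  (\int[P]_w (expR (\sum_i u i * Y i w))%:E =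
   (expR (\sum_i (b (eta i + u i) - b (eta i))))%:E)%E.
Proof.
transitivity (\int[P]_w (\prod_i expR (u i * Y i w))%:E)%E.
  by apply: eq_integral => w _; rewrite expR_sum.
rewrite (integral_prod_indep (g := fun i y => expR (u i * y)) sampleY.1).
- under eq_bigr do rewrite mgf_obs.
  by rewrite expR_sum prodEFin.
- move=> i; apply: measurableT_comp => //; exact: measurable_funM.
- by move=> i y; rewrite expR_ge0.
- by move=> i; rewrite mgf_obs ltry.
Qed.

Lemma integrable_obs i : P.-integrable setT (fun w => (Y i w)%:E).
Proof.
have int_exp t : P.-integrable setT (fun w => (expR (t * Y i w))%:E).
  apply/integrableP; split; first exact/measurable_EFinP/measurable_expRM.
  under eq_integral do rewrite abse_EFin ger0_norm ?expR_ge0//.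
  by rewrite mgf_obs ltry.
apply: (le_integrable _ _ _ (integrableD _ (int_exp 1) (int_exp (- 1)))) => //.
  exact/measurable_EFinP/measurable_funP.
move=> w _ /=; rewrite lee_fin mul1r mulN1r (ger0_norm (addr_ge0 (expR_ge0 _) (expR_ge0 _))).
have := expR_ge1Dx (Y i w); have := expR_ge1Dx (- Y i w).
have := expR_ge0 (Y i w); have := expR_ge0 (- Y i w).
by case: (ger0P (Y i w)) => _; lra.
Qed.

Definition obs_mean i : R := fine (\int[P]_w (Y i w)%:E)%E.

Lemma obs_meanE i : (\int[P]_w (Y i w)%:E = (obs_mean i)%:E)%E.
Proof. by rewrite fineK// integrable_fin_num//; exact: integrable_obs. Qed.

(** Nonnegativity of the Kullback-Leibler divergence: Jensen's inequality in the form E[x] <= E[exp x] - 1, applied to the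
    log-likelihood ratio, whose exponential has mean one. *)
Lemma obs_mean_kl i x :
  obs_mean i * x - b x <= obs_mean i * eta i - b (eta i).
Proof.
pose d := x - eta i; pose c := b (eta i) - b x.
have mexp : measurable_fun setT (fun w => expR (d * Y i w + c)).
  apply: measurableT_comp => //; apply: measurable_funD => //; exact: measurable_funM.
have Eexp : (\int[P]_w (expR (d * Y i w + c))%:E = 1)%E.
  transitivity (\int[P]_w ((expR c)%:E * (expR (d * Y i w))%:E))%E.
    by apply: eq_integral => w _; rewrite -EFinM -expRD addrC.
  rewrite ge0_integralZl_EFin ?expR_ge0//.
  - by rewrite mgf_obs -EFinM -expRD /c /d (_ : _ + _ = 0) ?expR0//; rewrite subrKC; ring.
  - exact/measurable_EFinP/measurable_expRM.
have intc : P.-integrable setT (fun w : T => (1 + c)%:E).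
  exact: finite_measure_integrable_cst.
have intd : P.-integrable setT (fun w => (d%:E * (Y i w)%:E)%E).
  by apply: integrableZl => //; exact: integrable_obs.
have : ((1 + c + d * obs_mean i)%:E <= 1)%E.
  rewrite -Eexp.
  apply: (@le_trans _ _ (\int[P]_w ((1 + c)%:E + d%:E * (Y i w)%:E))%E).
    rewrite integralD//; rewrite integralZl//; last exact: integrable_obs.
    by rewrite obs_meanE integral_cst//= probability_setT mule1 -EFinM -EFinD.
  apply: le_integral => //.
  - exact: integrableD.
  - apply/integrableP; split; first exact/measurable_EFinP.
    under eq_integral do rewrite abse_EFin ger0_norm ?expR_ge0//.
    by rewrite Eexp ltry.
  - move=> w _; rewrite -EFinM -EFinD lee_fin.
    by have := expR_ge1Dx (d * Y i w + c); lra.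
rewrite lee_fin /c /d; lra.
Qed.

Lemma expected_loglik d (Z : 'M[R]_(n, d)) t :
  (forall i, P.-integrable setT (fun w => (k (Y i w))%:E)) ->
  ('E_P[fun w => loglik b k Z (data_vector Y w) t] =
   (\sum_i (obs_mean i * (Z *m t) i 0 - b ((Z *m t) i 0)) +
    \sum_i fine (\int[P]_w (k (Y i w))%:E))%:E)%E.
Proof.
move=> intk; rewrite unlock.
pose f i w := ((((Z *m t) i 0)%:E * (Y i w)%:E + (- b ((Z *m t) i 0))%:E) + (k (Y i w))%:E)%E.
have intc i : P.-integrable setT (fun w : T => (- b ((Z *m t) i 0))%:E).
  exact: finite_measure_integrable_cst.
have intZ i : P.-integrable setT (fun w => (((Z *m t) i 0)%:E * (Y i w)%:E)%E).
  by apply: integrableZl => //; exact: integrable_obs.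
have intZc i : P.-integrable setT
    (fun w => (((Z *m t) i 0)%:E * (Y i w)%:E + (- b ((Z *m t) i 0))%:E)%E).
  exact: integrableD.
transitivity (\int[P]_w (\sum_i f i w))%E.
  apply: eq_integral => w _; rewrite /loglik -sumEFin; apply: eq_bigr => i _.
  by rewrite /f /data_vector mxE -EFinM -!EFinD mulrC.
rewrite integral_sum//; last by move=> i; exact: integrableD.
rewrite -big_split /= -sumEFin; apply: eq_bigr => i _.
rewrite /f integralD// integralD// integralZl//; last exact: integrable_obs.
rewrite obs_meanE integral_cst//= probability_setT mule1.
rewrite -[X in (_ + X)%E]fineK ?integrable_fin_num//.
by rewrite -EFinM -!EFinD mulrC.
Qed.

(** The maximizer of the expected log-likelihood need not be unique when the
    columns of the design are dependent, but its linear predictor is. *)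
Lemma theta_star_linpred d (Z : 'M[R]_(n, d)) (t0 : 'cV[R]_d) :
  (forall i, P.-integrable setT (fun w => (k (Y i w))%:E)) ->
  Z *m t0 = X *m theta0 ->
  Z *m argmax (fun t => ('E_P[fun w => loglik b k Z (data_vector Y w) t])%E) =
  X *m theta0.
Proof.
move=> intk Zt0.
pose V (t : 'cV[R]_d) := \sum_i (obs_mean i * (Z *m t) i 0 - b ((Z *m t) i 0)).
set L := fun t => _.
have LE t s : (L t <= L s)%E = (V t <= V s).
  by rewrite /L !expected_loglik// lee_fin lerD2r.
have t0max : is_argmax L t0.
  move=> t; rewrite LE; apply: ler_sum => i _.
  by rewrite [in leRHS]Zt0; exact: obs_mean_kl.
rewrite /argmax; case: xgetP => [t _ /= tmax|/(_ t0)//].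
apply/colP => i0; apply/eqP; apply: contraT => ne.
pose m := 2^-1 *: t + (1 - 2^-1) *: t0.
have Zm i : (Z *m m) i 0 = 2^-1 * (Z *m t) i 0 + (1 - 2^-1) * (X *m theta0) i 0.
  by rewrite /m mulmxDr -!scalemxAr Zt0 !mxE.
have strict i : (Z *m t) i 0 != (X *m theta0) i 0 ->
    b ((Z *m m) i 0) < 2^-1 * b ((Z *m t) i 0) + (1 - 2^-1) * b ((X *m theta0) i 0).
  by move=> H; rewrite Zm; apply: b_convex => //; exact: half01.
have weak i :
    b ((Z *m m) i 0) <= 2^-1 * b ((Z *m t) i 0) + (1 - 2^-1) * b ((X *m theta0) i 0).
  have [e|/strict/ltW//] := eqVneq ((Z *m t) i 0) ((X *m theta0) i 0).
  by rewrite Zm e -!mulrDl subrKC !mul1r.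
have : 2^-1 * V t + (1 - 2^-1) * V t0 < V m.
  rewrite /V !mulr_sumr -big_split /= (bigD1 i0)//= [ltRHS](bigD1 i0)//=.
  apply: ltr_leD; last (apply: ler_sum => i _; have := weak i); last first.
    by rewrite Zt0 Zm; lra.
  by have := strict i0 ne; rewrite Zt0 Zm; lra.
have := tmax m; rewrite LE; have := t0max t; rewrite LE; have := tmax t0; rewrite LE.
lra.
Qed.

End glm_expectations.

(** * Fisher information and the score *)

Section fisher_information.
Context {R : realType} (b : R -> R).
Local Notation b1 := (b^`(1)%classic).
Local Notation b2 := (b^`(2)%classic).

Lemma quadform_sum (I : finType) d (A : I -> 'M[R]_d) v :
  quadform (\sum_i A i) v = \sum_i quadform (A i) v.
Proof. by rewrite /quadform mulmx_sumr mulmx_suml summxE. Qed.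

Lemma quadform_fisher n d (Z : 'M[R]_(n, d)) t v :
  quadform (fisher b Z t) v = \sum_i b2 ((Z *m t) i 0) * (Z *m v) i 0 ^+ 2.
Proof.
rewrite quadform_sum; apply: eq_bigr => i _; rewrite quadformZ; congr (_ * _).
rewrite /quadform mulmxA -mulmxA; have -> : v^T *m (row i Z)^T = (row i Z *m v)^T.
  by rewrite trmx_mul.
by rewrite -row_mul mxE big_ord1 !mxE expr2.
Qed.

Lemma fisher_sym n d (Z : 'M[R]_(n, d)) t : (fisher b Z t)^T = fisher b Z t.
Proof.
rewrite /fisher linear_sum /=; apply: eq_bigr => i _.
by rewrite linearZ /= trmx_mul trmxK.
Qed.

Lemma fisher_psd n d (Z : 'M[R]_(n, d)) t : (forall x, 0 <= b2 x) ->
  psdmx (fisher b Z t).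
Proof.
move=> b2p; split=> [|v]; first exact: fisher_sym.
by rewrite quadform_fisher sumr_ge0// => i _; rewrite mulr_ge0// sqr_ge0.
Qed.

Lemma sqrtmx_unit d (F : 'M[R]_d) : posdefmx F -> sqrtmx F \in unitmx.
Proof.
move=> Fpd; have [_ BB] := sqrtmx_spec (posdef_psd Fpd).
by have := posdef_unit Fpd; rewrite -{1}BB unitmx_mul => /andP[].
Qed.

(** Cauchy-Schwarz after standardizing by the square root of F: this is how
    zeta controls the linear predictors. *)
Lemma row_le_quadform n d (Z : 'M[R]_(n, d)) (F : 'M[R]_d) zeta v i :
  posdefmx F -> l2norm (invmx (sqrtmx F) *m (row i Z)^T) <= zeta ->
  `|(Z *m v) i 0| <= zeta * Num.sqrt (quadform F v).
Proof.
move=> Fpd zi; have [[Bs _] BB] := sqrtmx_spec (posdef_psd Fpd).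
have Bu := sqrtmx_unit Fpd; set B := sqrtmx F in zi Bs BB Bu *.
have -> : (Z *m v) i 0 = ((invmx B *m (row i Z)^T)^T *m (B *m v)) 0 0.
  by rewrite trmx_mul trmxK trmx_inv Bs mulmxA mulmxKV// -row_mul [RHS]mxE.
apply: le_trans (inner_le_l2norm _ _) _; apply: ler_pM => //; rewrite ?l2norm_ge0//.
by rewrite -BB -(l2norm_sqr_quadform _ Bs) sqrtr_sqr ger0_norm// l2norm_ge0.
Qed.

End fisher_information.

Section score.
Context {R : realType} (b k : R -> R) (nu : {measure set R -> \bar R}).
Hypothesis b_diff : forall (m : nat) (x : R), (m < 3)%N ->
  derivable b^`(m)%classic x 1.
Variable Cdev : R.
Hypothesis Cdev1 : 1 <= Cdev.
Hypothesis b_dev : forall x y, `|y| <= 2^-1 ->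
  b^`(2)%classic (x + y) <= Cdev * b^`(2)%classic x.
Hypothesis mk : measurable_fun setT k.
Hypothesis density1 : forall eta : R,
  (\int[nu]_y (glm_density b k eta y)%:E = 1)%E.
Context (n : nat) {disp} {T : measurableType disp} (P : probability T R).
Context (Y : 'I_n -> {RV P >-> R}) (p : nat) (X : 'M[R]_(n, p)).
Context (theta0 : 'cV[R]_p).
Hypothesis sampleY : glm_sample b k P Y nu X theta0.
Local Notation eta i := ((X *m theta0) i 0).
Local Notation b1 := (b^`(1)%classic).
Local Notation b2 := (b^`(2)%classic).

(** Sub-Gaussian behaviour of the centred observations; the restriction to tilts of
    size at most 1/2 is the range of the deviation bound on b''. *)
Lemma centered_mgf_le (u : 'I_n -> R) : (forall i, `|u i| <= 2^-1) ->
  (\int[P]_w (expR (\sum_i u i * (Y i w - b1 (eta i))))%:E <=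
   (expR (Cdev / 2 * \sum_i b2 (eta i) * u i ^+ 2))%:E)%E.
Proof.
move=> u2.
have -> : (\int[P]_w (expR (\sum_i u i * (Y i w - b1 (eta i))))%:E =
    (expR (- \sum_i u i * b1 (eta i)))%:E *
    \int[P]_w (expR (\sum_i u i * Y i w))%:E)%E.
  rewrite -ge0_integralZl_EFin ?expR_ge0//.
  - apply: eq_integral => w _; rewrite -EFinM -expRD; congr (expR _)%:E.
    by rewrite -sumrN -big_split; apply: eq_bigr => i _ /=; ring.
  - apply/measurable_EFinP; apply: measurableT_comp => //.
    by apply: measurable_sum => i; apply: measurable_funM.
rewrite (mgf_sample mk density1 sampleY) -EFinM -expRD lee_fin ler_expR.
rewrite -sumrN -big_split mulr_sumr; apply: ler_sum => i _.
change (- (u i * b1 (eta i)) + (b (eta i + u i) - b (eta i)) <=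
  Cdev / 2 * (b2 (eta i) * u i ^+ 2)).
by have := b_quadratic_le b_diff b_dev (eta i) (u2 i); lra.
Qed.

(** The bound is stated with a function rather than an event: it is at least 1
    wherever some coordinate of the standardized score exceeds a, and its
    integral is a sum of Chernoff bounds over the 2 d signed
    coordinates. *)
Lemma score_bound d (Z : 'M[R]_(n, d)) (t0 : 'cV[R]_d) (zeta s a : R) :
  Z *m t0 = X *m theta0 -> posdefmx (fisher b Z t0) ->
  (forall i, l2norm (invmx (sqrtmx (fisher b Z t0)) *m (row i Z)^T) <= zeta) ->
  0 < s -> s * zeta <= 2^-1 ->
  exists sf : T -> R, [/\ measurable_fun setT sf, forall w, 0 <= sf w,
    (\int[P]_w (sf w)%:E <=
      ((2 * d)%:R * expR (Cdev / 2 * s ^+ 2 - s * a))%:E)%E &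
    forall w, sf w < 1 -> forall v,
      (\sum_i (Y i w - b1 (eta i)) * (Z *m v) i 0) ^+ 2 <=
      d%:R * a ^+ 2 * quadform (fisher b Z t0) v].
Proof.
move=> Zt0; set F := fisher b Z t0 => Fpd zbound s0 sz.
have [[Bs _] BB] := sqrtmx_spec (posdef_psd Fpd).
have Bu := sqrtmx_unit Fpd; set B := sqrtmx F in zbound Bs BB Bu.
pose Q := Z *m invmx B.
have Qle i j : `|Q i j| <= zeta.
  apply: le_trans (zbound i).
  have -> : Q i j = (invmx B *m (row i Z)^T) j 0.
    rewrite (_ : invmx B *m (row i Z)^T = (row i Z *m invmx B)^T).
      by rewrite -row_mul !mxE.
    by rewrite trmx_mul trmx_inv Bs.
  rewrite -(ler_pXn2r (n := 2))// ?nnegrE ?l2norm_ge0//.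
  rewrite real_normK ?num_real// l2norm_sqr (bigD1 j)//= lerDl.
  by apply: sumr_ge0 => l _; exact: sqr_ge0.
have Q1 j : \sum_i b2 (eta i) * Q i j ^+ 2 = 1.
  pose e := delta_mx j 0 : 'cV[R]_d.
  have -> : \sum_i b2 (eta i) * Q i j ^+ 2 = quadform F (invmx B *m e).
    rewrite quadform_fisher Zt0; apply: eq_bigr => i _; congr (_ * _ ^+ 2).
    by rewrite mulmxA -colE [RHS]mxE.
  rewrite -BB -l2norm_sqr_quadform// mulKVmx// l2norm_sqr (bigD1 j)//=.
  rewrite big1 ?addr0; first by rewrite mxE !eqxx expr1n.
  by move=> l lj; rewrite mxE (negbTE lj) expr0n.
pose S j w := \sum_i Q i j * (Y i w - b1 (eta i)).
pose sg (e : bool) : R := (-1) ^+ e.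
have mS j : measurable_fun setT (S j).
  apply: measurable_sum => i; apply: measurable_funM => //.
  exact: measurable_funB.
pose term (je : 'I_d * bool) w := expR (s * (sg je.2 * S je.1 w - a)).
have mterm je : measurable_fun setT (term je).
  apply: measurableT_comp => //; apply: measurable_funM => //.
  by apply: measurable_funB => //; apply: measurable_funM => //; exact: mS.
exists (fun w => \sum_je term je w); split.
- by apply: measurable_sum.
- by move=> w; apply: sumr_ge0 => je _; rewrite expR_ge0.
- under eq_integral do rewrite -sumEFin.
  rewrite ge0_integral_sum//; last 2 first.
  + by move=> je; exact/measurable_EFinP.
  + by move=> je w _; rewrite lee_fin expR_ge0.
  apply: (@le_trans _ _ (\sum_(je : 'I_d * bool)
      (expR (Cdev / 2 * s ^+ 2 - s * a))%:E)%E).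
    apply: lee_sum => -[j e] _; rewrite /term /=.
    pose u i := s * sg e * Q i j.
    have u2 i : `|u i| <= 2^-1.
      rewrite /u !normrM normrX normrN1 expr1n mulr1 (ger0_norm (ltW s0)).
      by apply: le_trans sz; rewrite ler_pM2l.
    have -> : (\int[P]_w (expR (s * (sg e * S j w - a)))%:E = (expR (- (s * a)))%:E
        * \int[P]_w (expR (\sum_i u i * (Y i w - b1 (eta i))))%:E)%E.
      rewrite -ge0_integralZl_EFin ?expR_ge0//.
      - apply: eq_integral => w _; rewrite -EFinM -expRD; congr (expR _)%:E.
        rewrite mulrBr mulrA /S mulr_sumr addrC; congr (_ + _).
        by apply: eq_bigr => i _; rewrite mulrA.
      - apply/measurable_EFinP; apply: measurableT_comp => //.
        apply: measurable_sum => i; apply: measurable_funM => //.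
        exact: measurable_funB.
    apply: (le_trans (lee_wpmul2l _ (centered_mgf_le u2))).
      by rewrite lee_fin expR_ge0.
    rewrite -EFinM -expRD lee_fin ler_expR addrC lerD2r ler_wpM2l//.
      by rewrite divr_ge0// (le_trans ler01).
    rewrite -[leRHS]mulr1 -(Q1 j) mulr_sumr; apply: ler_sum => i _.
    have sg2 : sg e ^+ 2 = 1 by rewrite /sg sqrr_sign.
    by rewrite /u !exprMn sg2 mulr1 mulrCA.
  rewrite sumEFin lee_fin sumr_const card_prod card_ord card_bool.
  by rewrite -[leLHS]mulr_natl mulnC.
- move=> w sfw v.
  have Sle j : S j w ^+ 2 <= a ^+ 2.
    have tlt e : sg e * S j w < a.
      rewrite ltNge; apply/negP => aS; move: sfw; apply/negP; rewrite -leNgt.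
      rewrite (bigD1 (j, e))//= ler_wpDr//.
        by apply: sumr_ge0 => je _; rewrite expR_ge0.
      rewrite /term /= -expR0 ler_expR; apply: mulr_ge0; first exact: ltW.
      by rewrite subr_ge0.
    have := tlt true; have := tlt false; rewrite /sg expr0 expr1 mul1r mulN1r.
    move=> h1 h2; rewrite -subr_ge0 subr_sqr; apply: mulr_ge0.
      by rewrite subr_ge0 ltW.
    by rewrite -lerBlDr sub0r ltW.
  have -> : \sum_i (Y i w - b1 (eta i)) * (Z *m v) i 0 = \sum_j S j w * (B *m v) j 0.
    rewrite /S; under [RHS]eq_bigr do rewrite mulr_suml.
    rewrite exchange_big /=; apply: eq_bigr => i _.
    have -> : (Z *m v) i 0 = \sum_j Q i j * (B *m v) j 0.
      by rewrite -(mulmxKV Bu Z) -/Q -mulmxA mxE.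
    by rewrite mulr_sumr; apply: eq_bigr => j _; ring.
  apply: le_trans (cauchy_schwarz _ _) _.
  rewrite -l2norm_sqr l2norm_sqr_quadform// BB ler_wpM2r//.
    exact: (posdef_psd Fpd).2.
  apply: (@le_trans _ _ (\sum_(j < d) a ^+ 2)); first by apply: ler_sum => j _; exact: Sle.
  by rewrite sumr_const card_ord mulr_natl.
Qed.

End score.

(** * A lower bound for the evidence *)

Section gaussian_density.
Context {R : realType}.

Lemma trmxB d (A B : 'M[R]_d) : (A - B)^T = A^T - B^T.
Proof. by apply/matrixP => i j; rewrite !mxE. Qed.

Lemma trmxZ d a (A : 'M[R]_d) : (a *: A)^T = a *: A^T.
Proof. by apply/matrixP => i j; rewrite !mxE. Qed.

Lemma loewner_sandwich d (A B : 'M[R]_d) c c' : A^T = A -> B^T = B ->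
  (forall v, c * quadform A v <= quadform B v) ->
  (forall v, quadform B v <= c' * quadform A v) ->
  loewner_le (c *: A) B /\ loewner_le B (c' *: A).
Proof.
move=> As Bs cAB BcA; split; split; rewrite ?trmxB ?trmxZ ?As ?Bs// => v.
  by rewrite quadformB quadformZ subr_ge0.
by rewrite quadformB quadformZ subr_ge0.
Qed.

Lemma scaled_le (c x y x' y' : R) : x = x' -> y = y' -> c * x' <= y' -> c * x <= y.
Proof. by move=> -> ->. Qed.

Lemma le_scaled (c x y x' y' : R) : x = x' -> y = y' -> y' <= c * x' -> y <= c * x.
Proof. by move=> -> ->. Qed.

Lemma gauss_pdfE d (m : 'cV[R]_d) (M : 'M[R]_d) t : posdefmx M ->
  gauss_pdf m (invmx M) t =
  Num.sqrt (\det M / (2 * pi) ^+ d) * expR (- quadform M (t - m) / 2).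
Proof.
move=> Mpd; rewrite /gauss_pdf invmxK det_inv; congr (_ * _).
have [M0 _] := gaussian_integral 0 Mpd.
have c0 : 0 < (2 * pi : R) ^+ d by rewrite exprn_gt0// mulr_gt0// pi_gt0.
by rewrite -sqrtrV ?divr_ge0 ?ltW// invfM invrK mulrC.
Qed.

Lemma gauss_pdf_ge0 d (m : 'cV[R]_d) (M : 'M[R]_d) t : 0 <= gauss_pdf m M t.
Proof. by rewrite mulr_ge0 ?expR_ge0// invr_ge0 sqrtr_ge0. Qed.

Lemma integral_gauss_pdf d (m : 'cV[R]_d) (M : 'M[R]_d) : posdefmx M ->
  lebesgue_cV (fun t => (gauss_pdf m (invmx M) t)%:E) = 1%E.
Proof.
move=> Mpd; under eq_fun do rewrite gauss_pdfE// EFinM.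
have [M0 E] := gaussian_integral m Mpd.
have c0 : 0 < (2 * pi : R) ^+ d by rewrite exprn_gt0// mulr_gt0// pi_gt0.
rewrite lebesgue_cVZl ?sqrtr_ge0//.
- rewrite E -EFinM -sqrtrM ?divr_ge0 ?ltW//.
  by rewrite mulrA divfK ?gt_eqF// divff ?gt_eqF// sqrtr1.
exact: measurable_cV_gauss.
Qed.

(** A Gaussian prior whose precision and centre are comparable to those of the
    ellipsoid {Q(u - t0) <= d} gives that ellipsoid a mass that is bounded below
    without reference to the precision. *)
Lemma gaussian_evidence d (F Fh : 'M[R]_d) t t0 (L : 'cV[R]_d -> R) (l C lambda rho : R) :
  posdefmx F -> 0 < C -> 0 < lambda -> loewner_le (C^-1 *: F) Fh ->
  loewner_le Fh (C *: F) -> quadform F (t - t0) <= rho ->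
  (forall u, quadform F (u - t0) <= d%:R -> l <= L u) ->
  ((expR l * (Num.sqrt ((lambda / C / (2 * pi)) ^+ d) *
     expR (- (lambda * C * (d%:R + rho)))))%:E
   <= lebesgue_cV (fun u => (gauss_pdf t (invmx (lambda *: Fh)) u)%:E *
                             (expR (L u))%:E))%E.
Proof.
move=> Fpd C0 l0 lo up trho Lu.
have iC0 : 0 < C^-1 by rewrite invr_gt0.
have CFpd := posdefZ iC0 Fpd.
have Fhpd : posdefmx Fh := loewner_le_posdef CFpd lo.
have lFpd := posdefZ l0 Fhpd.
have [F0 _] := gaussian_integral 0 Fpd.
have twopi : 0 < 2 * pi :> R by rewrite mulr_gt0// pi_gt0.
set A := (lambda / C / (2 * pi)) ^+ d.
have A0 : 0 <= A by rewrite exprn_ge0// !divr_ge0// ltW.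
have detle : A * \det F <= \det (lambda *: Fh) / (2 * pi) ^+ d.
  have := posdef_det_le CFpd lo; rewrite !detZ => detle.
  have -> : A * \det F = lambda ^+ d * (C^-1 ^+ d * \det F) / (2 * pi) ^+ d.
    by rewrite /A !expr_div_n exprVn; ring.
  by rewrite ler_pM2r ?invr_gt0 ?exprn_gt0// ler_pM2l// exprn_gt0.
pose E := lambda * C * (d%:R + rho).
pose K := Num.sqrt (A * \det F) * (expR l * expR (- E)).
have K0 : 0 <= K by rewrite mulr_ge0 ?sqrtr_ge0// mulr_ge0 ?expR_ge0.
apply: (@le_trans _ _ (lebesgue_cV (fun u =>
    K%:E * ((quadform F (u - t0) <= d%:R)%R%:R : R)%:E)%E)); last first.
  apply: le_lebesgue_cV => u; first by rewrite mule_ge0 ?lee_fin.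
  rewrite -!EFinM lee_fin gauss_pdfE//; case: (boolP (quadform F (u - t0) <= d%:R)) => [uq|_]; last first.
    by rewrite mulr0 mulr_ge0 ?expR_ge0// mulr_ge0 ?expR_ge0 ?sqrtr_ge0.
  rewrite mulr1 -[leRHS]mulrA; apply: ler_pM; rewrite ?sqrtr_ge0 ?mulr_ge0 ?expR_ge0//.
    by rewrite ler_wsqrtr.
  rewrite -!expRD ler_expR /E quadformZ.
  have qh : quadform Fh (u - t) <= 2 * C * (d%:R + rho).
    apply: le_trans (loewner_le_quadform _ up) _; rewrite quadformZ.
    rewrite (mulrC 2) -mulrA ler_pM2l//.
    have -> : u - t = (u - t0) + - (t - t0) by rewrite opprB addrA subrK.
    apply: le_trans (quadform_add_le _ _ (posdef_psd Fpd)) _.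
    by rewrite quadformN ler_pM2l// lerD.
  have h1 : lambda * quadform Fh (u - t) / 2 <= lambda * C * (d%:R + rho).
    rewrite ler_pdivrMr// -!mulrA ler_pM2l//; apply: le_trans qh _.
    by rewrite le_eqVlt; apply/orP; left; apply/eqP; ring.
  by rewrite mulNr addrC lerD ?Lu// lerN2.
rewrite lebesgue_cVZl//; last first.
  move=> d' T' psi v _ mv; apply/measurable_EFinP; apply: measurable_natb.
  by apply: measurable_fun_ler => //; apply: measurable_quadform; exact: measurable_subvec.
apply: (@le_trans _ _ (K%:E * (2 ^+ d / Num.sqrt (\det F))%:E)%E); last first.
  by apply: lee_wpmul2l; [rewrite lee_fin|exact: ellipsoid_volume_ge].
rewrite -EFinM lee_fin /K (sqrtrM _ A0) -/E.
have sF : 0 < Num.sqrt (\det F) by rewrite sqrtr_gt0.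
have -> : Num.sqrt A * Num.sqrt (\det F) * (expR l * expR (- E)) *
   (2 ^+ d / Num.sqrt (\det F)) = expR l * (Num.sqrt A * expR (- E)) * 2 ^+ d.
  by field; rewrite gt_eqF.
rewrite ler_peMr ?mulr_ge0 ?expR_ge0 ?sqrtr_ge0//.
by rewrite exprn_ege1// ler1n.
Qed.

End gaussian_density.

Section evidence.
Context {R : realType} (b k : R -> R).
Hypothesis b_diff : forall (m : nat) (x : R), (m < 3)%N ->
  derivable b^`(m)%classic x 1.
Hypothesis b_convex : strictly_convex b.
Variable Cdev : R.
Hypothesis Cdev1 : 1 <= Cdev.
Hypothesis b_dev : forall x y, `|y| <= 2^-1 ->
  b^`(2)%classic (x + y) <= Cdev * b^`(2)%classic x.
Local Notation b1 := (b^`(1)%classic).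
Local Notation b2 := (b^`(2)%classic).
Context (n d : nat) (Z : 'M[R]_(n, d)) (y : 'cV[R]_n) (t0 : 'cV[R]_d).
Variables r0 zeta : R.
Local Notation F := (fisher b Z t0).
Local Notation L := (loglik b k Z y).
Hypothesis Fpd : posdefmx F.
Hypothesis r0_ge0 : 0 <= r0.
Hypothesis zeta_ge0 : 0 <= zeta.
Hypothesis score_le : forall v,
  (\sum_i (y i 0 - b1 ((Z *m t0) i 0)) * (Z *m v) i 0) ^+ 2 <= r0 * quadform F v.
Hypothesis linpred_le : forall v i,
  `|(Z *m v) i 0| <= zeta * Num.sqrt (quadform F v).

Let C0 : 0 < Cdev. Proof. exact: lt_le_trans Cdev1. Qed.

Lemma loglik_diff t : L t - L t0 =
  \sum_i (y i 0 - b1 ((Z *m t0) i 0)) * (Z *m (t - t0)) i 0 -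
  \sum_i (b ((Z *m t0) i 0 + (Z *m (t - t0)) i 0) - b ((Z *m t0) i 0)
          - b1 ((Z *m t0) i 0) * (Z *m (t - t0)) i 0).
Proof.
rewrite /loglik -!sumrB; apply: eq_bigr => i _.
have -> : (Z *m (t - t0)) i 0 = (Z *m t) i 0 - (Z *m t0) i 0.
  by rewrite mulmxBr !mxE.
by rewrite subrKC; ring.
Qed.

Lemma linpred_half v q : quadform F v <= q -> zeta * Num.sqrt q <= 2^-1 ->
  forall i, `|(Z *m v) i 0| <= 2^-1.
Proof.
move=> vq zq i; apply: le_trans (linpred_le v i) (le_trans _ zq).
by apply: ler_wpM2l => //; rewrite ler_wsqrtr.
Qed.

Lemma score_norm_le v q : quadform F v <= q ->
  `|\sum_i (y i 0 - b1 ((Z *m t0) i 0)) * (Z *m v) i 0| <= Num.sqrt (r0 * q).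
Proof.
move=> vq; rewrite -sqrtr_sqr ler_wsqrtr//; apply: le_trans (score_le v) _.
exact: ler_wpM2l.
Qed.

Lemma loglik_lower t q : quadform F (t - t0) <= q -> zeta * Num.sqrt q <= 2^-1 ->
  L t0 - (Num.sqrt (r0 * q) + Cdev * q / 2) <= L t.
Proof.
move=> tq zq; have half := linpred_half tq zq.
have sc := score_norm_le tq.
suff : - (Num.sqrt (r0 * q) + Cdev * q / 2) <= L t - L t0 by lra.
rewrite loglik_diff.
set A := \sum_i _ in sc *; set B := \sum_i _.
have Bq : B <= Cdev * q / 2.
  apply: (@le_trans _ _ (Cdev / 2 * quadform F (t - t0))).
    rewrite quadform_fisher mulr_sumr; apply: ler_sum => i _.
    by have := b_quadratic_le b_diff b_dev ((Z *m t0) i 0) (half i); lra.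
  by rewrite [leRHS]mulrAC; apply: ler_wpM2l => //; rewrite divr_ge0// ltW.
have := ler_norm (- A); rewrite normrN; lra.
Qed.

Lemma loglik_upper t q : quadform F (t - t0) = q -> zeta * Num.sqrt q <= 2^-1 ->
  L t <= L t0 + Num.sqrt (r0 * q) - q / (2 * Cdev).
Proof.
move=> tq zq; have tq' : quadform F (t - t0) <= q by rewrite tq.
have half := linpred_half tq' zq; have sc := ler_normlW (score_norm_le tq').
have := loglik_diff t.
set A := \sum_i _ in sc *; set B := \sum_i _.
have Bq : q / (2 * Cdev) <= B.
  rewrite -tq quadform_fisher mulr_suml; apply: ler_sum => i _.
  have := b_quadratic_ge b_diff Cdev1 b_dev ((Z *m t0) i 0) (half i).
  rewrite invfM (mulrC 2^-1) !mulrA; rewrite [X in _ + X / 2]mulrAC; lra.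
lra.
Qed.

Lemma b_convex_le x z s : 0 < s < 1 ->
  b (s * x + (1 - s) * z) <= s * b x + (1 - s) * b z.
Proof.
move=> s01; have [->|ne] := eqVneq x z; first by rewrite -!mulrDl subrKC !mul1r.
exact/ltW/b_convex.
Qed.

Lemma loglik_concave t u s : 0 < s < 1 ->
  s * L t + (1 - s) * L u <= L (s *: t + (1 - s) *: u).
Proof.
move=> s01; rewrite /loglik !mulr_sumr -big_split /=; apply: ler_sum => i _.
have -> : (Z *m (s *: t + (1 - s) *: u)) i 0 =
    s * (Z *m t) i 0 + (1 - s) * (Z *m u) i 0.
  by rewrite mulmxDr -!scalemxAr !mxE.
by have := b_convex_le ((Z *m t) i 0) ((Z *m u) i 0) s01; lra.
Qed.

(** On the sphere of squared radius rho the quadratic term beats the score, so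
    the concave log-likelihood cannot be maximal outside. *)
Lemma mle_near t rho : is_argmax L t -> 4 * Cdev ^+ 2 * r0 < rho ->
  zeta * Num.sqrt rho <= 2^-1 -> quadform F (t - t0) <= rho.
Proof.
move=> tmax r0rho zrho; rewrite leNgt; apply/negP => far.
set q := quadform F (t - t0) in far.
have rho0 : 0 < rho.
  by apply: le_lt_trans r0rho; rewrite mulr_ge0// mulr_ge0// sqr_ge0.
have q0 : 0 < q by exact: lt_trans far.
pose s := Num.sqrt (rho / q).
have s0 : 0 < s by rewrite sqrtr_gt0 divr_gt0.
have s1 : s < 1 by rewrite -sqrtr1 ltr_sqrt// ltr_pdivrMr// mul1r.
have s2 : s ^+ 2 = rho / q by rewrite sqr_sqrtr// divr_ge0// ltW.
pose m := s *: t + (1 - s) *: t0.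
have mt0 : m - t0 = s *: (t - t0).
  by rewrite /m scalerBl scale1r scalerBr addrA addrAC addrK.
have mq : quadform F (m - t0) = rho.
  by rewrite mt0 quadformZv s2 -/q divfK// gt_eqF.
have Lm := loglik_upper mq zrho.
have s01 : 0 < s < 1 by rewrite s0.
have cc := loglik_concave t t0 s01.
have Lt := tmax t0.
have : Num.sqrt (r0 * rho) < rho / (2 * Cdev).
  rewrite -[ltRHS]ger0_norm; last by rewrite divr_ge0 ?mulr_ge0// ltW.
  rewrite -sqrtr_sqr ltr_sqrt; last by rewrite exprn_gt0// divr_gt0// mulr_gt0.
  rewrite expr_div_n ltr_pdivlMr; last by rewrite exprn_gt0// mulr_gt0.
  rewrite mulrAC expr2 ltr_pM2r//; apply: le_lt_trans r0rho.
  by rewrite le_eqVlt; apply/orP; left; apply/eqP; ring.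
have : L t0 <= L m.
  have : 0 <= s * (L t - L t0) by rewrite mulr_ge0 ?subr_ge0// ltW.
  by move: cc; rewrite -/m; lra.
lra.
Qed.

(** Where all linear predictors have moved by at most 1/2, the deviation bound on
    b'' compares the weights of the two matrices one by one. *)
Lemma fisher_near t rho : quadform F (t - t0) <= rho ->
  zeta * Num.sqrt rho <= 2^-1 ->
  loewner_le (Cdev^-1 *: F) (fisher b Z t) /\
  loewner_le (fisher b Z t) (Cdev *: F).
Proof.
move=> trho zrho; have half := linpred_half trho zrho.
have Zt i : (Z *m t) i 0 = (Z *m t0) i 0 + (Z *m (t - t0)) i 0.
  by rewrite mulmxBr !mxE subrKC.
apply: (loewner_sandwich (fisher_sym b Z t0) (fisher_sym b Z t)) => v.
  apply: (scaled_le (quadform_fisher b Z t0 v) (quadform_fisher b Z t v)).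
  rewrite mulr_sumr; apply: ler_sum => i _.
  by rewrite mulrA ler_wpM2r ?sqr_ge0// Zt mulrC; exact: b2_dev_ge.
apply: (le_scaled (quadform_fisher b Z t0 v) (quadform_fisher b Z t v)).
rewrite mulr_sumr; apply: ler_sum => i _.
by rewrite mulrA ler_wpM2r ?sqr_ge0// Zt; exact: b_dev.
Qed.

Lemma measurable_loglik d1 (T' : measurableType d1) (v : T' -> 'cV[R]_d)
    (u : T' -> 'cV[R]_n) : measurable_fun setT k ->
  measurable_vec u -> measurable_vec v ->
  measurable_fun setT (fun s => loglik b k Z (u s) (v s)).
Proof.
move=> mk mu mv; apply: measurable_sum => i.
have mZ := measurable_mulmx Z mv i.
apply: measurable_funD; last exact: measurableT_comp.
apply: measurable_funB; first exact: measurable_funM.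
exact: (measurableT_comp (measurable_cumulant b_diff) mZ).
Qed.

(** Only the ellipsoid of squared radius d around t0 is used: on it the
    log-likelihood loses at most sqrt(r0 d) through the score and Cdev d / 2
    through the curvature, and the last two factors bound its prior mass. *)
Lemma evidence_lower t rho lambda alpha : is_argmax L t ->
  4 * Cdev ^+ 2 * r0 < rho -> zeta * Num.sqrt rho <= 2^-1 ->
  zeta * Num.sqrt d%:R <= 2^-1 -> 0 < lambda -> 0 < alpha < 1 ->
  ((expR (alpha * L t0 - (Num.sqrt (r0 * d%:R) + Cdev * d%:R / 2)) *
    (Num.sqrt ((lambda / Cdev / (2 * pi)) ^+ d) *
     expR (- (lambda * Cdev * (d%:R + rho)))))%:E
   <= lebesgue_cV (fun u => (gauss_pdf t (invmx (lambda *: fisher b Z t)) u)%:E *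
                             (expR (alpha * L u))%:E))%E.
Proof.
move=> tmax r0rho zrho zd l0 /andP[a0 a1].
have trho := mle_near tmax r0rho zrho.
have [lo up] := fisher_near trho zrho.
apply: (gaussian_evidence (L := fun u => alpha * L u) Fpd C0 l0 lo up trho) => u uq.
have Llo := loglik_lower uq zd.
set S := Num.sqrt (r0 * d%:R) in Llo *.
have S0 : 0 <= S + Cdev * d%:R / 2.
  by rewrite addr_ge0 ?sqrtr_ge0// divr_ge0// mulr_ge0// ltW.
apply: (@le_trans _ _ (alpha * (L t0 - (S + Cdev * d%:R / 2)))).
  by rewrite mulrBr lerD2l lerN2 ler_piMl// ltW.
by rewrite ler_pM2l.
Qed.

End evidence.

(** * Sparse vectors and the prior on models *)

Section null_coordinates.
Context {R : realType}.

Lemma cons_cV_neq0 n (x : R) (v : 'cV[R]_n) : x != 0 ->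
  (forall i, v i 0 != 0) -> forall i, col_mx (x%:M : 'cV_1) v i 0 != 0.
Proof.
move=> x0 v0 i; rewrite -(splitK i); case: (fintype.split i) => [j|j] /=.
  by rewrite col_mxEu ord1 mxE eqxx mulr1n.
by rewrite col_mxEd.
Qed.

(** Coordinate hyperplanes are Lebesgue null, so under the prior of model S the
    support of theta is almost surely S itself. *)
Lemma le_lebesgue_cV_nonzero n (f g : 'cV[R]_n -> \bar R) :
  (forall v, 0 <= f v)%E -> (forall v, 0 <= g v)%E ->
  (forall v : 'cV[R]_n, (forall i, v i 0 != 0) -> (f v <= g v)%E) ->
  (lebesgue_cV f <= lebesgue_cV g)%E.
Proof.
elim: n f g => [|n IH] f g f0 g0 fg /=; first by apply: fg => -[].
pose F x := lebesgue_cV (fun v => f (col_mx (x%:M : 'cV_1) v)).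
pose G x := lebesgue_cV (fun v => g (col_mx (x%:M : 'cV_1) v)).
have F0 x : (0 <= F x)%E by exact: lebesgue_cV_ge0.
have G0 x : (0 <= G x)%E by exact: lebesgue_cV_ge0.
pose Z (x : R) : \bar R := (+oo * (\1_[set (0 : R)] x)%:E)%E.
have Z0 x : (0 <= Z x)%E by rewrite mule_ge0.
have mZ : measurable_fun setT Z.
  by apply: measurable_funeM; apply/measurable_EFinP; exact: measurable_indic.
have intZ : (\int[lebesgue_measure]_x Z x = 0)%E.
  rewrite ge0_integralZl//.
    by rewrite integral_indic//= setIT lebesgue_measure_set1 mule0.
  by apply/measurable_EFinP; exact: measurable_indic.
apply: (@le_trans _ _ (\int[lebesgue_measure]_x (G x + Z x))%E).
  apply: le_lower_integral => // x; rewrite /Z indicE.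
  have [->|x0] := eqVneq x 0; first by rewrite mem_set// mule1 addey ?leey// gt_eqF// (lt_le_trans ltNy0).
  rewrite memNset ?mule0 ?adde0; last by move=> /eqP; rewrite (negbTE x0).
  by apply: IH => // v v0; apply: fg; exact: cons_cV_neq0.
rewrite -[leRHS]adde0 -intZ.
exact: lower_integralD_le.
Qed.

End null_coordinates.

Section sparse_vectors.
Context {R : realType}.

Lemma mulmx_extend0 n p (X : 'M[R]_(n, p)) (S : {set 'I_p}) (t : 'cV[R]_#|S|) :
  X *m extend0 t = subcols X S *m t.
Proof.
apply/matrixP => i j; rewrite !mxE.
under eq_bigr do rewrite mxE mulr_sumr.
rewrite (exchange_big_dep xpredT)//=; apply: eq_bigr => l _.
rewrite (bigD1 (enum_val l))//= big1 ?addr0; first by rewrite ord1 mxE.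
by move=> m /andP[/eqP <-]; rewrite eqxx.
Qed.

Lemma loglik_extend0 (b k : R -> R) n p (X : 'M[R]_(n, p)) y (S : {set 'I_p})
    (t : 'cV[R]_#|S|) :
  loglik b k X y (extend0 t) = loglik b k (subcols X S) y t.
Proof. by rewrite /loglik mulmx_extend0. Qed.

Lemma extend0_enum p (S : {set 'I_p}) (t : 'cV[R]_#|S|) l :
  extend0 t (enum_val l) 0 = t l 0.
Proof.
rewrite mxE (bigD1 l)//= big1 ?addr0// => m /andP[/eqP/enum_val_inj ->].
by rewrite eqxx.
Qed.

Lemma supp_extend0_full p (S : {set 'I_p}) (t : 'cV[R]_#|S|) :
  (forall l, t l 0 != 0) -> (#|S| <= #|supp (extend0 t)|)%N.
Proof.
move=> t0; apply/subset_leq_card/fintype.subsetP => j jS.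
rewrite inE; have -> : j = enum_val (enum_rank_in jS j) by rewrite enum_rankK_in.
by rewrite extend0_enum.
Qed.

Lemma extend0_restrict p (theta : 'cV[R]_p) :
  exists t : 'cV[R]_#|supp theta|, extend0 t = theta.
Proof.
exists (\col_l theta (enum_val l) 0); apply/colP => j; rewrite mxE.
have [jS|jS] := boolP (j \in supp theta).
  rewrite (bigD1 (enum_rank_in jS j))//=; last by rewrite enum_rankK_in.
  rewrite big1 ?addr0; first by rewrite mxE enum_rankK_in.
  move=> m /andP[/eqP mj] /negP[]; apply/eqP/enum_val_inj.
  by rewrite mj enum_rankK_in.
rewrite big1; first by move: jS; rewrite inE negbK => /eqP.
by move=> m /eqP mj; move: jS; rewrite -mj enum_valP.
Qed.

Lemma measurable_extend0 d (T : measurableType d) p (S : {set 'I_p})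
    (v : T -> 'cV[R]_#|S|) : measurable_vec v ->
  measurable_vec (fun s => extend0 (v s)).
Proof.
move=> mv i; under eq_fun do rewrite mxE big_mkcond.
by apply: measurable_sum => l; case: (enum_val l == i) => //; exact: mv.
Qed.

Lemma card_suppE p (v : 'cV[R]_p) : #|supp v|%:R = \sum_j (v j 0 != 0)%:R :> R.
Proof. by rewrite -sum1_card natr_sum big_mkcond; apply: eq_bigr => j _; rewrite inE; case: eqP. Qed.

Lemma measurable_card_supp d (T : measurableType d) p (v : T -> 'cV[R]_p) :
  measurable_vec v -> measurable_fun setT (fun s => #|supp (v s)|%:R : R).
Proof.
move=> mv; under eq_fun do rewrite card_suppE.
apply: measurable_sum => j; apply: measurable_natb.
by apply: measurableT_comp => //; exact: measurable_fun_eqr.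
Qed.

Lemma card_supp_sub p (u v : 'cV[R]_p) : (#|supp (u - v)| <= #|supp u| + #|supp v|)%N.
Proof.
apply: leq_trans (leq_card_setU _ _); apply: subset_leq_card; apply/fintype.subsetP => j.
rewrite !inE !mxE; apply: contraR; rewrite negb_or !negbK => /andP[/eqP -> /eqP ->].
by rewrite subr0.
Qed.

(** Grouping the models by size leaves the sum of w; it is an inequality because
    smax may exceed p. *)
Lemma sum_model_prior_le1 p smax (w : nat -> R) : pmf_upto smax w ->
  \sum_(S : {set 'I_p}) w #|S| / 'C(p, #|S|)%:R <= 1.
Proof.
move=> [w0 wout w1]; rewrite -[leRHS]w1.
rewrite (partition_big (fun S : {set 'I_p} => inord #|S| : 'I_p.+1) xpredT)//=.
have -> : \sum_(s < p.+1) \sum_(S : {set 'I_p} | (inord #|S| : 'I_p.+1) == s)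
    w #|S| / 'C(p, #|S|)%:R = \sum_(s < p.+1) w s.
  apply: eq_bigr => s _.
  rewrite (eq_bigl (fun S : {set 'I_p} => #|S| == s :> nat)); last first.
    move=> S /=; rewrite -val_eqE /= inordK// ltnS.
    by rewrite (leq_trans (max_card _))// card_ord.
  rewrite (eq_bigr (fun=> w s / 'C(p, s)%:R)); last by move=> S /eqP ->.
  rewrite sumr_const -[X in _ *+ X](_ : #|[set S : {set 'I_p} | #|S| == s]%SET| = _); last first.
    by apply: eq_card => S; rewrite !inE.
  rewrite card_draws card_ord -[LHS]mulr_natr divfK// pnatr_eq0 -lt0n bin_gt0.
  by rewrite -ltnS.
rewrite -!(big_mkord xpredT).
have big m : (smax < m)%N -> \sum_(0 <= s < m) w s = \sum_(0 <= s < smax.+1) w s.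
  move=> sm; rewrite (@big_cat_nat _ _ _ smax.+1)//=.
  suff -> : \sum_(smax.+1 <= s < m) w s = 0 by rewrite addr0.
  by rewrite big_nat_cond big1// => s /andP[/andP[s1 _] _]; exact: wout.
have [ps|sp] := leqP p.+1 smax; last by rewrite big.
rewrite (@big_cat_nat _ _ _ p.+1 _ smax.+1)//=; last by exact: ltnW.
by rewrite lerDl sumr_ge0.
Qed.

End sparse_vectors.

(** * The fractional likelihood far from the truth *)

Section numerator.
Context {R : realType}.

(** The data-dependent Gaussian prior is dominated by a deterministic one, up to a
    factor that costs D and p^lambda per dimension; halving the precision
    absorbs the random centre. *)
Lemma gauss_pdf_dominated d (Fh Fb : 'M[R]_d) th tb t (D lambda L : R) :
  posdefmx Fb -> 0 < D -> 0 < lambda -> loewner_le (D^-1 *: Fb) Fh ->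
  loewner_le Fh (D *: Fb) -> quadform Fb (th - tb) <= D * d%:R * L ->
  gauss_pdf th (invmx (lambda *: Fh)) t <=
  expR (d%:R * ((ln (2 * D ^+ 2) + lambda * L) / 2)) *
  gauss_pdf tb (invmx ((lambda / (2 * D)) *: Fb)) t.
Proof.
move=> Fbpd D0 l0 lo up near.
have iD0 : 0 < D^-1 by rewrite invr_gt0.
have l20 : 0 < lambda / (2 * D) by rewrite divr_gt0// mulr_gt0.
have Fhpd := loewner_le_posdef (posdefZ iD0 Fbpd) lo.
rewrite !gauss_pdfE; [|exact: posdefZ|exact: posdefZ].
have [Fb0 _] := gaussian_integral 0 Fbpd; have [Fh0 _] := gaussian_integral 0 Fhpd.
have c0 : 0 < (2 * pi : R) ^+ d by rewrite exprn_gt0// mulr_gt0// pi_gt0.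
have D20 : 0 < 2 * D ^+ 2 by rewrite mulr_gt0// exprn_gt0.
have detle : \det (lambda *: Fh) <= (2 * D ^+ 2) ^+ d * \det ((lambda / (2 * D)) *: Fb).
  rewrite !detZ; have := posdef_det_le Fhpd up; rewrite detZ => up'.
  have -> : (2 * D ^+ 2) ^+ d * ((lambda / (2 * D)) ^+ d * \det Fb) =
      lambda ^+ d * (D ^+ d * \det Fb).
    rewrite !mulrA -!exprMn; congr (_ ^+ d * _); field; lra.
  by rewrite ler_pM2l// exprn_gt0.
have powE : Num.sqrt ((2 * D ^+ 2) ^+ d) = expR (d%:R * ln (2 * D ^+ 2) / 2).
  rewrite -[X in X ^+ d](@lnK R) ?posrE// -expRM_natl.
  rewrite -[X in expR X](_ : d%:R * ln (2 * D ^+ 2) / 2 *+ 2 = _); last first.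
    by rewrite -mulr_natr divfK.
  by rewrite mulr2n expRD -expr2 sqrtr_sqr ger0_norm// expR_ge0.
have sq : Num.sqrt (\det (lambda *: Fh) / (2 * pi) ^+ d) <=
    expR (d%:R * ln (2 * D ^+ 2) / 2) *
    Num.sqrt (\det ((lambda / (2 * D)) *: Fb) / (2 * pi) ^+ d).
  rewrite -powE -sqrtrM; last by rewrite exprn_ge0// ltW.
  by rewrite ler_wsqrtr// mulrA ler_pM2r ?invr_gt0.
have ex : expR (- quadform (lambda *: Fh) (t - th) / 2) <=
    expR (d%:R * (lambda * L) / 2) * expR (- quadform ((lambda / (2 * D)) *: Fb) (t - tb) / 2).
  rewrite -expRD ler_expR !quadformZ.
  have h1 := loewner_le_quadform (t - th) lo; rewrite quadformZ in h1.
  have h2 := quadform_add_le (t - th) (th - tb) (posdef_psd Fbpd).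
  rewrite addrA subrK in h2.
  set a := quadform Fh _ in h1 *; set e := quadform Fb (t - th) in h1 h2.
  set f := quadform Fb (t - tb) in h2 *; set g := quadform Fb (th - tb) in near h2.
  have h3 : f / 2 - D * d%:R * L <= e by lra.
  have h4 : lambda * (D^-1 * (f / 2 - D * d%:R * L)) <= lambda * a.
    by rewrite ler_pM2l//; apply: le_trans h1; rewrite ler_pM2l.
  have -> : d%:R * (lambda * L) / 2 + - (lambda / (2 * D) * f) / 2 =
     - (lambda * (D^-1 * (f / 2 - D * d%:R * L))) / 2 by field; lra.
  by rewrite !mulNr lerN2 ler_pM2r.
apply: (le_trans (ler_pM _ _ sq ex)); rewrite ?sqrtr_ge0 ?expR_ge0//.
rewrite le_eqVlt; apply/orP; left; apply/eqP.
by rewrite mulrACA -expRD; congr (expR _ * _); ring.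
Qed.

End numerator.

Section likelihood_ratio.
Context {R : realType} (b k : R -> R) (nu : {measure set R -> \bar R}).
Hypothesis b_diff : forall (m : nat) (x : R), (m < 3)%N ->
  derivable b^`(m)%classic x 1.
Hypothesis b_convex : strictly_convex b.
Variable Cdev : R.
Hypothesis Cdev1 : 1 <= Cdev.
Hypothesis b_dev : forall x y, `|y| <= 2^-1 ->
  b^`(2)%classic (x + y) <= Cdev * b^`(2)%classic x.
Hypothesis mk : measurable_fun setT k.
Hypothesis density1 : forall eta : R,
  (\int[nu]_y (glm_density b k eta y)%:E = 1)%E.
Context (n : nat) {disp} {T : measurableType disp} (P : probability T R).
Context (Y : 'I_n -> {RV P >-> R}) (p : nat) (X : 'M[R]_(n, p)).
Context (theta0 : 'cV[R]_p).
Hypothesis sampleY : glm_sample b k P Y nu X theta0.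
Local Notation eta i := ((X *m theta0) i 0).
Local Notation L w theta := (loglik b k X (data_vector Y w) theta).
Local Notation Q v := (quadform (fisher b X theta0) v).

(** The fractional likelihood ratio is an exponential of a linear function of the
    observations, and the Jensen gap is what its cumulant leaves. *)
Lemma fractional_likelihood_mean (alpha : R) theta :
  (\int[P]_w (expR (alpha * L w theta - alpha * L w theta0))%:E =
   (expR (- \sum_i jensen_gap b alpha (eta i) ((X *m (theta - theta0)) i 0)))%:E)%E.
Proof.
pose h i := (X *m (theta - theta0)) i 0.
have hE i : (X *m theta) i 0 = eta i + h i by rewrite /h mulmxBr !mxE subrKC.
pose c := alpha * \sum_i (b (eta i + h i) - b (eta i)).
transitivity (\int[P]_w ((expR (- c))%:E *
    (expR (\sum_i alpha * h i * Y i w))%:E))%E.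
  apply: eq_integral => w _; rewrite -EFinM -expRD; congr (expR _)%:E.
  rewrite /c -!mulrBr /loglik -sumrB -mulrN -sumrN.
  under [X in _ = _ + X]eq_bigr do rewrite -mulrA.
  rewrite -mulr_sumr -mulrDr -big_split; congr (_ * _).
  have dv i : data_vector Y w i 0 = Y i w by rewrite mxE.
  by apply: eq_bigr => i _; rewrite [RHS]/= dv hE; ring.
rewrite ge0_integralZl_EFin ?expR_ge0//; last first.
  apply/measurable_EFinP; apply: measurableT_comp => //.
  by apply: measurable_sum => i; apply: measurable_funM.
rewrite (mgf_sample mk density1 sampleY) -EFinM -expRD; congr (expR _)%:E.
rewrite /c mulr_sumr -!sumrN -big_split; apply: eq_bigr => i _.
by rewrite /jensen_gap -/(h i) /=; ring.
Qed.

(** The gap is monotone along rays, so theta may be moved towards theta0 until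
    it reaches the ellipsoid {Q = q}, where all linear predictors are within
    1/2 and the gap is comparable to Q. *)
Lemma jensen_gap_sum_ge (alpha q kappa : R) v : 0 < alpha < 1 -> 0 < q ->
  q <= Q v -> (forall i, `|(X *m v) i 0| <= kappa * Num.sqrt (Q v)) ->
  kappa * Num.sqrt q <= 2^-1 ->
  alpha * (1 - alpha) / (2 * Cdev) * q <=
  \sum_i jensen_gap b alpha (eta i) ((X *m v) i 0).
Proof.
move=> a01 q0 qv bnd kq; have Qv0 : 0 < Q v by exact: lt_le_trans qv.
pose t := Num.sqrt (q / Q v).
have t0 : 0 <= t by exact: sqrtr_ge0.
have t1 : t <= 1.
  by rewrite -[leRHS]sqrtr1 ler_wsqrtr// ler_pdivrMr// mul1r.
have t2 : t ^+ 2 = q / Q v by rewrite sqr_sqrtr// divr_ge0// ltW.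
have tQ : t * Num.sqrt (Q v) = Num.sqrt q.
  by rewrite -sqrtrM ?divr_ge0 ?ltW// divfK// gt_eqF.
have half i : `|t * (X *m v) i 0| <= 2^-1.
  rewrite normrM (ger0_norm t0); apply: le_trans kq; rewrite -tQ mulrCA.
  exact: ler_wpM2l.
have t01 : 0 <= t <= 1 by rewrite t0.
apply: (@le_trans _ _ (\sum_i jensen_gap b alpha (eta i) (t * (X *m v) i 0))); last first.
  by apply: ler_sum => i _; exact: (jensen_gap_mono b_diff b_convex Cdev1 b_dev).
have -> : q = \sum_i b^`(2)%classic (eta i) * (t * (X *m v) i 0) ^+ 2.
  under eq_bigr do rewrite exprMn mulrCA.
  by rewrite -mulr_sumr -quadform_fisher t2 divfK// gt_eqF.
rewrite mulr_sumr; apply: ler_sum => i _.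
exact: jensen_gap_quadratic.
Qed.

End likelihood_ratio.

(** * The posterior as a ratio *)

Section posterior.
Context {R : realType} (b k : R -> R).
Context (n p : nat) (X : 'M[R]_(n, p)) (theta0 : 'cV[R]_p).
Local Notation s0 := #|supp theta0|.
Local Notation Q v := (quadform (fisher b X theta0) v).
Local Notation L y theta := (loglik b k X y theta).
Local Notation ghat y lambda S := (gauss_pdf (mle b k X y S)
  (invmx (lambda *: fisher b (subcols X S) (mle b k X y S)))).

Definition far_sparse (q m : R) (theta : 'cV[R]_p) : bool :=
  (q < Q (theta - theta0)) && (#|supp theta|%:R <= m).

(** The contribution to the numerator of the far and sparse parameters of model
    S, with the data-dependent prior replaced by a fixed Gaussian; unlike the
    posterior itself it is measurable in the data. *)
Definition far_integrand (S : {set 'I_p}) tb (M : 'M[R]_#|S|) (alpha q m : R) y t : R :=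
  gauss_pdf tb (invmx M) t *
  (expR (alpha * L y (extend0 t) - alpha * L y theta0) *
   (far_sparse q m (extend0 t))%:R).

Definition far_integral (S : {set 'I_p}) tb (M : 'M[R]_#|S|) (alpha q m : R) y : \bar R :=
  lebesgue_cV (fun t => (far_integrand tb M alpha q m y t)%:E).

Lemma far_integrand_ge0 S tb M alpha q m y t :
  0 <= @far_integrand S tb M alpha q m y t.
Proof. by rewrite !mulr_ge0 ?expR_ge0 ?gauss_pdf_ge0. Qed.

Hypothesis b_diff : forall (m : nat) (x : R), (m < 3)%N ->
  derivable b^`(m)%classic x 1.
Hypothesis mk : measurable_fun setT k.

Lemma measurable_far_integrand d (T : measurableType d) (S : {set 'I_p})
    (tb : 'cV[R]_#|S|) (M : 'M[R]_#|S|) (alpha q m : R) (u : T -> 'cV[R]_n) (v : T -> 'cV[R]_#|S|) :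
  measurable_vec u -> measurable_vec v ->
  measurable_fun setT (fun s => @far_integrand S tb M alpha q m (u s) (v s)).
Proof.
move=> mu mv; have mev := measurable_extend0 mv.
have mc : measurable_vec (fun _ : T => theta0) by move=> i; exact: measurable_cst.
apply: measurable_funM.
  apply: measurable_funM => //; apply: measurableT_comp => //.
  apply: measurable_funM => //; apply: measurableT_comp => //.
  by apply: measurable_quadform; exact: measurable_subvec.
apply: measurable_funM.
  apply: measurableT_comp => //; apply: measurable_funB.
    by apply: measurable_funM => //; exact: measurable_loglik.
  by apply: measurable_funM => //; exact: measurable_loglik.
apply: measurable_natb; apply: measurable_and.
  apply: measurable_fun_ltr => //; apply: measurable_quadform.
  exact: measurable_subvec.
by apply: measurable_fun_ler => //; exact: measurable_card_supp.
Qed.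

Lemma measurable_cV_far_integrand S tb M alpha q m y :
  measurable_cV (fun t => (@far_integrand S tb M alpha q m y t)%:E).
Proof.
move=> d' T' psi v _ mv; apply/measurable_EFinP.
by apply: (measurable_far_integrand tb M alpha q m (u := fun=> y)) => // i; exact: measurable_cst.
Qed.

Lemma prior_integral_ge0 w lambda y f : (forall s, 0 <= w s) ->
  (forall theta, 0 <= f theta)%E -> (0 <= prior_integral b k X w lambda y f)%E.
Proof.
move=> w0 f0; apply: sume_ge0 => S _; rewrite mule_ge0 ?lee_fin ?divr_ge0//.
by apply: lebesgue_cV_ge0 => t; rewrite mule_ge0 ?lee_fin ?gauss_pdf_ge0.
Qed.

Lemma le_prior_integral w lambda y f g : (forall s, 0 <= w s) ->
  (forall theta, 0 <= f theta)%E -> (forall theta, f theta <= g theta)%E ->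
  (prior_integral b k X w lambda y f <= prior_integral b k X w lambda y g)%E.
Proof.
move=> w0 f0 fg; apply: lee_sum => S _; apply: lee_wpmul2l.
  by rewrite lee_fin divr_ge0.
apply: le_lebesgue_cV => t; first by rewrite mule_ge0 ?lee_fin ?gauss_pdf_ge0.
by apply: lee_wpmul2l => //; rewrite lee_fin gauss_pdf_ge0.
Qed.

Definition posterior_num w lambda alpha y (A : set 'cV[R]_p) : \bar R := prior_integral b k X w lambda y
  (fun theta => (expR (alpha * L y theta) * \1_A theta)%:E).
Definition posterior_den w lambda alpha y : \bar R := prior_integral b k X w lambda y
  (fun theta => (expR (alpha * L y theta))%:E).

Lemma posterior_num_ge0 w lambda alpha y A : (forall s, 0 <= w s) ->
  (0 <= posterior_num w lambda alpha y A)%E.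
Proof.
by move=> w0; apply: prior_integral_ge0 => // theta.
Qed.

Lemma posterior_num_le_den w lambda alpha y A : (forall s, 0 <= w s) ->
  (posterior_num w lambda alpha y A <= posterior_den w lambda alpha y)%E.
Proof.
move=> w0; apply: le_prior_integral => // theta.
by rewrite lee_fin ler_piMr ?expR_ge0// indicE; case: (_ \in _).
Qed.

Lemma frac_posterior_ge0 w lambda alpha y A : (forall s, 0 <= w s) ->
  0 <= frac_posterior b k X w lambda alpha y A.
Proof.
move=> w0; rewrite divr_ge0// fine_ge0//; first exact: posterior_num_ge0.
by apply: prior_integral_ge0 => // theta; rewrite lee_fin expR_ge0.
Qed.

Lemma frac_posterior_le1 w lambda alpha y A : (forall s, 0 <= w s) ->
  frac_posterior b k X w lambda alpha y A <= 1.
Proof.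
move=> w0; have nd := posterior_num_le_den lambda alpha y A w0.
have n0 := posterior_num_ge0 lambda alpha y A w0.
rewrite /frac_posterior -/(posterior_num _ _ _ _ _) -/(posterior_den _ _ _ _).
have [dy|dfin] := eqVneq (posterior_den w lambda alpha y) +oo%E; first by rewrite dy /= invr0 mulr0.
have dn : posterior_den w lambda alpha y \is a fin_num.
  by rewrite ge0_fin_numE ?(le_trans n0)// lt_neqAle dfin leey.
have nn : posterior_num w lambda alpha y A \is a fin_num.
  by rewrite ge0_fin_numE// (le_lt_trans nd)// ltey_eq dn.
have := fine_le nn dn nd.
have [->|d0] := eqVneq (fine (posterior_den w lambda alpha y)) 0; first by rewrite invr0 mulr0.
by rewrite ler_pdivrMr ?mul1r// lt_neqAle eq_sym d0 fine_ge0// (le_trans n0).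
Qed.

(** The numerator splits according to the dimension of the model: under the prior of
    a model of dimension above m the support has more than m elements almost
    everywhere, so such models only contribute to the posterior mass of large
    dimensions; for the others the prior is replaced by a fixed Gaussian.  The
    junk value 0 of the ratio for an infinite denominator is harmless. *)
Lemma frac_posterior_le (smax : nat) w (D lambda alpha q m l e1 : R)
    (tb : forall S : {set 'I_p}, 'cV[R]_#|S|) y (A : set 'cV[R]_p) :
  pmf_upto smax w -> (s0 <= smax)%N -> 0 < w s0 -> 0 < lambda -> 0 < D ->
  0 <= ln (2 * D ^+ 2) + lambda * l ->
  (forall S : {set 'I_p}, (#|S| <= smax)%N ->
    [/\ posdefmx (fisher b (subcols X S) (tb S)),
      loewner_le (D^-1 *: fisher b (subcols X S) (tb S))
        (fisher b (subcols X S) (mle b k X y S)),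
      loewner_le (fisher b (subcols X S) (mle b k X y S))
        (D *: fisher b (subcols X S) (tb S)) &
      quadform (fisher b (subcols X S) (tb S)) (mle b k X y S - tb S)
        <= D * #|S|%:R * l]) ->
  (forall theta, A theta -> #|supp theta|%:R <= m -> q < Q (theta - theta0)) ->
  0 < e1 ->
  ((expR (alpha * L y theta0) * e1)%:E <= lebesgue_cV (fun u =>
     (ghat y lambda (supp theta0) u)%:E * (expR (alpha * L y (extend0 u)))%:E))%E ->
  ((frac_posterior b k X w lambda alpha y A)%:E <=
   (frac_posterior b k X w lambda alpha y [set theta | m < #|supp theta|%:R])%:E +
   (expR (m * ((ln (2 * D ^+ 2) + lambda * l) / 2)) /
      (w s0 / 'C(p, s0)%:R * e1))%:E *
   \sum_(S : {set 'I_p}) (w #|S| / 'C(p, #|S|)%:R)%:E *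
     far_integral (tb S) ((lambda / (2 * D)) *: fisher b (subcols X S) (tb S))
       alpha q m y)%E.
Proof.
move=> wpmf s0max ws0 l0 D0 lnD good Afar e10 ev.
have [w0 wout _] := wpmf.
set Adim := [set theta | _].
set Kg := expR (m * _); have Kg0 : 0 < Kg by exact: expR_gt0.
set e0 := expR (alpha * L y theta0) in ev.
have e00 : 0 < e0 by exact: expR_gt0.
pose N S := far_integral (tb S)
  ((lambda / (2 * D)) *: fisher b (subcols X S) (tb S)) alpha q m y.
have N0 S : (0 <= N S)%E.
  by apply: lebesgue_cV_ge0 => t; rewrite lee_fin far_integrand_ge0.
pose Sum := (\sum_(S : {set 'I_p}) (w #|S| / 'C(p, #|S|)%:R)%:E * N S)%E.
have Sum0 : (0 <= Sum)%E.
  by apply: sume_ge0 => S _; rewrite mule_ge0 ?lee_fin ?divr_ge0.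
have numle : (posterior_num w lambda alpha y A <=
    posterior_num w lambda alpha y Adim + (Kg * e0)%:E * Sum)%E.
  rewrite /Sum ge0_sume_distrr; last first.
    by move=> S _; rewrite mule_ge0 ?lee_fin ?divr_ge0.
  rewrite -big_split; apply: lee_sum => S _ /=.
  rewrite muleCA -ge0_muleDr; last 2 first.
  - apply: lebesgue_cV_ge0 => t.
    by rewrite mule_ge0 ?lee_fin ?gauss_pdf_ge0// mulr_ge0 ?expR_ge0.
  - by rewrite mule_ge0// lee_fin mulr_ge0// ltW.
  have [Smax|Smax] := leqP #|S| smax; last by rewrite wout// mul0r !mul0e.
  apply: lee_wpmul2l; first by rewrite lee_fin divr_ge0.
  have gA0 B t : (0 <= (ghat y lambda S t)%:E *
      (expR (alpha * L y (extend0 t)) * \1_B (extend0 t))%:E)%E.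
    by rewrite -EFinM lee_fin mulr_ge0 ?gauss_pdf_ge0// mulr_ge0 ?expR_ge0.
  have [Sm|Sm] := leP #|S|%:R m; last first.
    apply: lee_paddr; first by rewrite mule_ge0// lee_fin mulr_ge0// ltW.
    apply: le_lebesgue_cV_nonzero => // t t0.
    apply: lee_wpmul2l; first by rewrite lee_fin gauss_pdf_ge0.
    rewrite lee_fin ler_wpM2l ?expR_ge0// [leRHS]indicE mem_set.
      by rewrite indicE; case: (_ \in _).
    by apply: lt_le_trans Sm _; rewrite ler_nat; exact: supp_extend0_full.
  apply: lee_paddl; first exact: lebesgue_cV_ge0.
  have [Fbpd lo up near] := good S Smax.
  rewrite /N /far_integral -lebesgue_cVZl; last 3 first.
  - by rewrite mulr_ge0// ltW.
  - by move=> t; rewrite lee_fin far_integrand_ge0.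
  - exact: measurable_cV_far_integrand.
  apply: le_lebesgue_cV => // t.
  rewrite -!EFinM lee_fin /far_integrand.
  have dom := gauss_pdf_dominated t Fbpd D0 l0 lo up near.
  set gb := gauss_pdf (tb S) _ _ in dom *.
  have gb0 : 0 <= gb by exact: gauss_pdf_ge0.
  have {}dom : ghat y lambda S t <= Kg * gb.
    apply: le_trans dom _; rewrite ler_wpM2r// ler_expR ler_wpM2r//.
    by rewrite divr_ge0.
  have supS : #|supp (extend0 t)|%:R <= m :> R.
    apply: le_trans Sm; rewrite ler_nat; apply/subset_leq_card/fintype.subsetP => j.
    rewrite inE mxE; apply: contraR => jS; rewrite big1// => l' /eqP lj.
    by move: jS; rewrite -lj enum_valP.
  have indle : \1_A (extend0 t) <= (far_sparse q m (extend0 t))%:R :> R.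
    rewrite indicE; case: (boolP (_ \in A)) => // /set_mem At.
    by rewrite /far_sparse supS (Afar _ At supS).
  have -> : Kg * e0 * (gb * (expR (alpha * L y (extend0 t) - alpha * L y theta0) *
      (far_sparse q m (extend0 t))%:R)) =
      Kg * gb * (expR (alpha * L y (extend0 t)) * (far_sparse q m (extend0 t))%:R).
    have -> : expR (alpha * L y (extend0 t)) =
        e0 * expR (alpha * L y (extend0 t) - alpha * L y theta0).
      by rewrite /e0 -expRD subrKC.
    by ring.
  apply: ler_pM; rewrite ?gauss_pdf_ge0 ?mulr_ge0 ?expR_ge0//.
  by rewrite ler_wpM2l ?expR_ge0.
have pi0 : 0 < w s0 / 'C(p, s0)%:R.
  rewrite divr_gt0// ltr0n bin_gt0; apply: leq_trans (max_card _) _.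
  by rewrite card_ord.
have denge : ((w s0 / 'C(p, s0)%:R * (e0 * e1))%:E <= posterior_den w lambda alpha y)%E.
  rewrite /posterior_den /prior_integral (bigD1 (supp theta0))//=.
  apply: lee_paddr.
    apply: sume_ge0 => S _; rewrite mule_ge0 ?lee_fin ?divr_ge0//.
    by apply: lebesgue_cV_ge0 => t; rewrite mule_ge0 ?lee_fin ?gauss_pdf_ge0 ?expR_ge0.
  by rewrite EFinM; apply: lee_wpmul2l => //; rewrite lee_fin ltW.
rewrite /frac_posterior -/(posterior_num _ _ _ _ A) -/(posterior_num _ _ _ _ Adim) -/(posterior_den _ _ _ _) -/N -/Sum.
have c0 : 0 < w s0 / 'C(p, s0)%:R * (e0 * e1) by rewrite mulr_gt0// mulr_gt0.
have [dy|dfin] := eqVneq (posterior_den w lambda alpha y) +oo%E.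
  by rewrite dy /= !invr0 !mulr0 add0e mule_ge0// lee_fin divr_ge0// ?mulr_ge0// ltW.
have dn : posterior_den w lambda alpha y \is a fin_num.
  by rewrite ge0_fin_numE ?(le_trans _ denge) ?lee_fin ?ltW// lt_neqAle dfin leey.
have fin B : posterior_num w lambda alpha y B \is a fin_num.
  rewrite ge0_fin_numE; last exact: posterior_num_ge0.
  by rewrite (le_lt_trans (posterior_num_le_den _ _ _ _ w0))// ltey_eq dn.
have [Sy|Sfin] := eqVneq Sum +oo%E.
  have K0 : 0 < Kg / (w s0 / 'C(p, s0)%:R * e1) by rewrite divr_gt0// mulr_gt0.
  by rewrite Sy gt0_muley ?lte_fin// addey ?leey// gt_eqF// ltNyr.
have Sn : Sum \is a fin_num by rewrite ge0_fin_numE// lt_neqAle Sfin leey.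
rewrite -(fineK Sn) -EFinM -EFinD lee_fin.
move: numle; rewrite -(fineK (fin A)) -(fineK (fin Adim)) -(fineK Sn) -EFinM -EFinD lee_fin => numle.
move: denge; rewrite -(fineK dn) lee_fin => denge.
have d0 : 0 < fine (posterior_den w lambda alpha y) by exact: lt_le_trans denge.
have S0 : 0 <= fine Sum by exact: fine_ge0.
rewrite -lerBlDl -mulrBl ler_pdivrMr//.
apply: (@le_trans _ _ (Kg * e0 * fine Sum)); first by rewrite lerBlDl.
have -> : Kg * e0 * fine Sum =
    Kg / (w s0 / 'C(p, s0)%:R * e1) * fine Sum * (w s0 / 'C(p, s0)%:R * (e0 * e1)).
  by set c := w s0 / _ in pi0 *; field; rewrite !gt_eqF.
have Kc : 0 < Kg / (w s0 / 'C(p, s0)%:R * e1) by rewrite divr_gt0// mulr_gt0.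
by apply: ler_wpM2l => //; apply: mulr_ge0 => //; exact: ltW.
Qed.

End posterior.

(** * Expected posterior mass at a fixed sample size *)

Section contraction.
Context {R : realType} (b k : R -> R) (nu : {measure set R -> \bar R}).
Hypothesis b_diff : forall (m : nat) (x : R), (m < 3)%N ->
  derivable b^`(m)%classic x 1.
Hypothesis b_convex : strictly_convex b.
Variable Cdev : R.
Hypothesis Cdev1 : 1 <= Cdev.
Hypothesis b_dev : forall x y, `|y| <= 2^-1 ->
  b^`(2)%classic (x + y) <= Cdev * b^`(2)%classic x.
Hypothesis mk : measurable_fun setT k.
Hypothesis density1 : forall eta : R,
  (\int[nu]_y (glm_density b k eta y)%:E = 1)%E.
Context (n : nat) {disp} {T : measurableType disp} (P : probability T R).
Context (Y : 'I_n -> {RV P >-> R}) (p : nat) (X : 'M[R]_(n, p)).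
Context (theta0 : 'cV[R]_p).
Hypothesis sampleY : glm_sample b k P Y nu X theta0.
Hypothesis intk : forall i : 'I_n, P.-integrable [set: T] (fun w => (k (Y i w))%:E).
Local Notation S0 := (supp theta0).
Local Notation s0 := #|supp theta0|.
Local Notation Q v := (quadform (fisher b X theta0) v).

Lemma measurable_data_vector : measurable_vec (data_vector Y).
Proof.
by move=> i; rewrite (_ : (fun w => data_vector Y w i 0) = Y i)//;
  apply/funext => w; rewrite mxE.
Qed.

Lemma measurable_far_integral (S : {set 'I_p}) tb (M : 'M[R]_#|S|) alpha q m :
  measurable_fun setT (fun w => far_integral b k X theta0 tb M alpha q m (data_vector Y w)).
Proof.
apply: (@measurable_lebesgue_cV _ _ _ _
  (fun w t => (far_integrand b k X theta0 tb M alpha q m (data_vector Y w) t)%:E)).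
  by move=> w t; rewrite lee_fin far_integrand_ge0.
move=> d' T' psi v mpsi mv; apply/measurable_EFinP.
have mu : measurable_vec (data_vector Y \o psi).
  by move=> i; exact: (measurableT_comp (measurable_data_vector i) mpsi).
exact: (measurable_far_integrand X theta0 b_diff mk tb M alpha q m mu mv).
Qed.

(** Far from theta0 the expected likelihood ratio is uniformly small, so its average
    under a Gaussian density is. *)
Lemma far_integral_mean_le (S : {set 'I_p}) tb (M : 'M[R]_#|S|) alpha q m kappa :
  posdefmx M -> 0 < alpha < 1 -> 0 < q ->
  (forall theta, #|supp theta|%:R <= m -> forall i,
     `|(X *m (theta - theta0)) i 0| <= kappa * Num.sqrt (Q (theta - theta0))) ->
  kappa * Num.sqrt q <= 2^-1 ->
  (\int[P]_w far_integral b k X theta0 tb M alpha q m (data_vector Y w) <=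
   (expR (- (alpha * (1 - alpha) / (2 * Cdev) * q)))%:E)%E.
Proof.
move=> Mpd a01 q0 kap kq; set c := _ * q.
rewrite /far_integral (tonelli_lebesgue_cV P
  (f := fun w t => (far_integrand b k X theta0 tb M alpha q m (data_vector Y w) t)%:E)); last 2 first.
- by move=> w t; rewrite lee_fin far_integrand_ge0.
- move=> d' T' psi v mpsi mv; apply/measurable_EFinP.
  have mu : measurable_vec (data_vector Y \o psi).
    by move=> i; exact: (measurableT_comp (measurable_data_vector i) mpsi).
  exact: (measurable_far_integrand X theta0 b_diff mk tb M alpha q m mu mv).
apply: (@le_trans _ _ (lebesgue_cV (fun t =>
    (expR (- c))%:E * (gauss_pdf tb (invmx M) t)%:E)%E)).
  apply: le_lebesgue_cV => t.
    by apply: integral_ge0 => w _; rewrite lee_fin far_integrand_ge0.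
  rewrite /far_integrand; case: (boolP (far_sparse _ _ _ _ _ _)) => [/andP[qQ supm]|_]; last first.
    under eq_integral do rewrite !mulr0.
    by rewrite integral0 mule_ge0 ?lee_fin ?expR_ge0 ?gauss_pdf_ge0.
  under eq_integral do rewrite mulr1 EFinM.
  rewrite ge0_integralZl_EFin ?gauss_pdf_ge0//; last first.
    have mc : measurable_vec (fun _ : T => extend0 t) by move=> i; exact: measurable_cst.
    have mc0 : measurable_vec (fun _ : T => theta0) by move=> i; exact: measurable_cst.
    apply/measurable_EFinP; apply: measurableT_comp => //; apply: measurable_funB.
      apply: measurable_funM => //.
      exact: (measurable_loglik b_diff X mk measurable_data_vector mc).
    apply: measurable_funM => //.
    exact: (measurable_loglik b_diff X mk measurable_data_vector mc0).
  rewrite (fractional_likelihood_mean mk density1 sampleY) muleC.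
  apply: lee_wpmul2r; first by rewrite lee_fin gauss_pdf_ge0.
  rewrite lee_fin ler_expR lerN2.
  exact: (jensen_gap_sum_ge b_diff b_convex Cdev1 b_dev a01 q0 (ltW qQ) (kap _ supm) kq).
rewrite lebesgue_cVZl ?expR_ge0//.
- by rewrite integral_gauss_pdf// mule1.
- by move=> t; rewrite lee_fin gauss_pdf_ge0.
- move=> d' T' psi v _ mv; apply/measurable_EFinP; apply: measurable_funM => //.
  apply: measurableT_comp => //; apply: measurable_funM => //.
  apply: measurableT_comp => //.
  by apply: measurable_quadform; exact: measurable_subvec.
Qed.

Lemma fisher_linpred d (Z : 'M[R]_(n, d)) t t' : Z *m t = Z *m t' ->
  fisher b Z t = fisher b Z t'.
Proof. by rewrite /fisher => ->. Qed.

(** The bound of evidence_lower for the true model, relative to the fractional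
    likelihood at theta0: r0 is the bound on the squared standardized score, and
    rho the one on the squared distance of the maximum likelihood estimator. *)
Definition evidence_factor (r0 rho lambda : R) : R :=
  expR (- (Num.sqrt (r0 * s0%:R) + Cdev * s0%:R / 2)) *
  (Num.sqrt ((lambda / Cdev / (2 * pi)) ^+ s0) *
   expR (- (lambda * Cdev * (s0%:R + rho)))).

Lemma evidence_factor_gt0 r0 rho lambda : 0 < lambda ->
  0 < evidence_factor r0 rho lambda.
Proof.
move=> l0; rewrite !mulr_gt0 ?expR_gt0// sqrtr_gt0 exprn_gt0//.
apply: divr_gt0; last by rewrite mulr_gt0// pi_gt0.
by apply: divr_gt0 => //; exact: lt_le_trans ltr01 Cdev1.
Qed.

Lemma integral_compl_le (E : set T) eps : measurable E ->
  ((1 - eps)%:E <= P E)%E -> (\int[P]_w (\1_(~` E) w)%:E <= eps%:E)%E.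
Proof.
move=> mE PE; rewrite integral_indic//; last exact: measurableC.
have -> : ~` E `&` setT = ~` E by rewrite classical_sets.setIT.
have PC : P (~` E) = (1 - P E)%E by exact: probability_setC.
apply: (@le_trans _ _ (P (~` E))); first exact: lexx.
rewrite PC.
move: PE; rewrite -(fineK (fin_num_measure P _ mE)) -EFinB !lee_fin.
by rewrite lerBlDl lerBlDr.
Qed.

Lemma model_weight_gt0 (w : nat -> R) : 0 < w s0 -> 0 < w s0 / 'C(p, s0)%:R.
Proof.
move=> ws0; rewrite divr_gt0// ltr0n bin_gt0; apply: leq_trans (max_card _) _.
by rewrite card_ord.
Qed.

(** Off the event E, and where the score is large, the posterior is bounded by 1; on
    the remaining data frac_posterior_le applies, and the expectation of its last
    term is computed under the fixed Gaussian priors.  The parameter s is the tilt in the Chernoff bound for the score and a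
    the deviation level. *)
Lemma expected_posterior_le (smax : nat) (w : nat -> R)
    (D lambda alpha l eps s a rho kappa q m : R)
    (tb : forall S : {set 'I_p}, 'cV[R]_#|S|) (E : set T) (A : set 'cV[R]_p) :
  fisher_star b k P Y X S0 \in unitmx ->
  pmf_upto smax w -> (s0 <= smax)%N -> 0 < w s0 -> 0 < lambda -> 0 < D ->
  0 <= ln (2 * D ^+ 2) + lambda * l -> 0 < alpha < 1 ->
  (forall S : {set 'I_p}, (#|S| <= smax)%N ->
     fisher b (subcols X S) (tb S) \in unitmx) ->
  measurable E -> ((1 - eps)%:E <= P E)%E ->
  (forall w, E w -> forall S : {set 'I_p}, (#|S| <= smax)%N ->
    let y := data_vector Y w in
    [/\ is_argmax (loglik b k (subcols X S) y) (mle b k X y S),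
      loewner_le (D^-1 *: fisher b (subcols X S) (tb S))
        (fisher b (subcols X S) (mle b k X y S)),
      loewner_le (fisher b (subcols X S) (mle b k X y S))
        (D *: fisher b (subcols X S) (tb S)) &
      l2norm (sqrtmx (fisher b (subcols X S) (tb S)) *m (mle b k X y S - tb S)) ^+ 2
        <= D * #|S|%:R * l]) ->
  0 < s -> s * zeta b k P Y X S0 <= 2^-1 ->
  4 * Cdev ^+ 2 * (s0%:R * a ^+ 2) < rho ->
  zeta b k P Y X S0 * Num.sqrt rho <= 2^-1 ->
  zeta b k P Y X S0 * Num.sqrt s0%:R <= 2^-1 ->
  0 < q ->
  (forall theta, #|supp theta|%:R <= m -> forall i,
     `|(X *m (theta - theta0)) i 0| <= kappa * Num.sqrt (Q (theta - theta0))) ->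
  kappa * Num.sqrt q <= 2^-1 ->
  (forall theta, A theta -> #|supp theta|%:R <= m -> q < Q (theta - theta0)) ->
  (expected_posterior b k P Y X w lambda alpha A <=
   expected_posterior b k P Y X w lambda alpha
     [set theta | (m < #|supp theta|%:R)%R] +
   (eps + (2 * s0)%:R * expR (Cdev / 2 * s ^+ 2 - s * a) +
    expR (m * ((ln (2 * D ^+ 2) + lambda * l) / 2)) /
      (w s0 / 'C(p, s0)%:R * evidence_factor (s0%:R * a ^+ 2) rho lambda) *
      expR (- (alpha * (1 - alpha) / (2 * Cdev) * q)))%:E)%E.
Proof.
move=> Fu wpmf s0max ws0 l0 D0 lnD a01 tbu mE PE HE s_gt0 sz r0rho zrho zs0 q0 kap kq Afar.
have [w0 _ _] := wpmf.
set Adim := [set theta | _].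
have b2p x := b2_ge0 b_diff b_convex Cdev1 b_dev x.
have [t0 t0E] := extend0_restrict theta0.
set Z := subcols X S0.
have Zt0 : Z *m t0 = X *m theta0 by rewrite -mulmx_extend0 t0E.
have ZtS : Z *m theta_star b k P Y X S0 = X *m theta0.
  exact: (theta_star_linpred b_convex mk density1 sampleY intk Zt0).
have FE : fisher_star b k P Y X S0 = fisher b Z t0.
  by apply: fisher_linpred; rewrite ZtS Zt0.
have Fpd : posdefmx (fisher b Z t0).
  apply: psd_unit_posdef; first exact: fisher_psd.
  by move: Fu; rewrite FE.
set zt := zeta b k P Y X S0 in sz zrho zs0.
have zt0 : 0 <= zt by exact: bigmax_ge_id.
have ztle i : l2norm (invmx (sqrtmx (fisher b Z t0)) *m (row i Z)^T) <= zt.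
  by rewrite -FE; exact: (le_bigmax _ (fun i => l2norm (invmx (sqrtmx (fisher_star b k P Y X S0)) *m (row i Z)^T))).
clearbody zt; clear Fu FE ZtS.
have [sf [msf sf0 intsf sfle]] :=
  score_bound b_diff Cdev1 b_dev mk density1 sampleY a Zt0 Fpd ztle s_gt0 sz.
pose N S y := far_integral b k X theta0 (tb S)
  ((lambda / (2 * D)) *: fisher b (subcols X S) (tb S)) alpha q m y.
pose e1 := evidence_factor (s0%:R * a ^+ 2) rho lambda.
rewrite -/e1.
have e10 : 0 < e1 by exact: evidence_factor_gt0.
set Kg := expR (m * _).
pose K := Kg / (w s0 / 'C(p, s0)%:R * e1).
have pi0 : 0 < w s0 / 'C(p, s0)%:R by exact: model_weight_gt0.
have K0 : 0 <= K.
  by apply: divr_ge0; [exact: expR_ge0|apply: ltW; apply: mulr_gt0; [exact: pi0|exact: e10]].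
pose Nsum om := (\sum_(S : {set 'I_p}) (w #|S| / 'C(p, #|S|)%:R)%:E *
  N S (data_vector Y om))%E.
have N0 S y : (0 <= N S y)%E.
  by apply: lebesgue_cV_ge0 => t; rewrite lee_fin far_integrand_ge0.
have Nsum0 om : (0 <= Nsum om)%E.
  by apply: sume_ge0 => S _; rewrite mule_ge0 ?lee_fin ?divr_ge0.
have mN S : measurable_fun setT (fun om => N S (data_vector Y om)).
  exact: measurable_far_integral.
have mNsum : measurable_fun setT Nsum.
  by apply: emeasurable_sum => S; apply: measurable_funeM.
have Fbpd (S : {set 'I_p}) : (#|S| <= smax)%N ->
    posdefmx (fisher b (subcols X S) (tb S)).
  by move=> Smax; apply: psd_unit_posdef; [exact: fisher_psd|exact: tbu].
pose g om := ((\1_(~` E) om)%:E + ((sf om)%:E + K%:E * Nsum om))%E.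
have mEc : measurable (~` E) by exact: measurableC.
have mind : measurable_fun setT (fun om => (\1_(~` E) om)%:E : \bar R).
  by apply/measurable_EFinP; exact: measurable_indic.
have mKN : measurable_fun setT (fun om => K%:E * Nsum om)%E by exact: measurable_funeM.
have mg2 : measurable_fun setT (fun om => (sf om)%:E + K%:E * Nsum om)%E.
  by apply: emeasurable_funD => //; exact/measurable_EFinP.
have mg : measurable_fun setT g by exact: emeasurable_funD.
have KN0 om : (0 <= K%:E * Nsum om)%E by rewrite mule_ge0.
have g20 om : (0 <= (sf om)%:E + K%:E * Nsum om)%E by rewrite adde_ge0// lee_fin.
have g0 om : (0 <= g om)%E by rewrite adde_ge0.
have point om : ((frac_posterior b k X w lambda alpha (data_vector Y om) A)%:E <=
    (frac_posterior b k X w lambda alpha (data_vector Y om) Adim)%:E + g om)%E.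
  have dim0 : (0 <= (frac_posterior b k X w lambda alpha (data_vector Y om) Adim)%:E)%E.
    by rewrite lee_fin frac_posterior_ge0.
  have le1 : ((frac_posterior b k X w lambda alpha (data_vector Y om) A)%:E <= 1)%E.
    by rewrite lee_fin frac_posterior_le1.
  have [omE|omE] := pselect (E om); last first.
    apply: (le_trans le1); apply: lee_paddl => //; apply: lee_paddr => //.
    by rewrite indicE mem_set.
  have [sf1|sf1] := leP 1 (sf om).
    apply: (le_trans le1); apply: lee_paddl => //; apply: lee_paddl => //.
    by apply: lee_paddr.
  have good := HE om omE.
  set y := data_vector Y om in good *.
  have scy v : (\sum_i (y i 0 - b^`(1)%classic ((Z *m t0) i 0)) * (Z *m v) i 0) ^+ 2
      <= s0%:R * a ^+ 2 * quadform (fisher b Z t0) v.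
    have := sfle om sf1 v; rewrite Zt0.
    by under [in X in _ -> X]eq_bigr do rewrite /y [data_vector _ _ _ _]mxE.
  have lin v i : `|(Z *m v) i 0| <= zt * Num.sqrt (quadform (fisher b Z t0) v).
    exact: row_le_quadform.
  have r00 : 0 <= s0%:R * a ^+ 2 :> R by rewrite mulr_ge0// sqr_ge0.
  have [amax _ _ _] := good S0 s0max.
  have ev := evidence_lower b_diff b_convex Cdev1 b_dev Fpd r00 zt0 scy lin
    amax r0rho zrho zs0 l0 a01.
  have ev' : ((expR (alpha * loglik b k X y theta0) * e1)%:E <= lebesgue_cV (fun u =>
     (gauss_pdf (mle b k X y S0) (invmx (lambda *: fisher b Z (mle b k X y S0))) u)%:E *
     (expR (alpha * loglik b k X y (extend0 u)))%:E))%E.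
    under eq_fun do rewrite loglik_extend0.
    apply: le_trans ev; rewrite -/Z -[in leLHS]t0E loglik_extend0 /e1 /evidence_factor.
    by rewrite lee_fin expRD mulrA.
  have := frac_posterior_le b_diff mk (alpha := alpha) (q := q) (m := m) (tb := tb)
    wpmf s0max ws0 l0 D0 lnD _ Afar e10 ev'.
  rewrite -/Adim -/K; move=> H; apply: le_trans (H _) _.
    move=> S Smax; have [_ lo up near] := good S Smax; split=> //; first exact: Fbpd.
    by rewrite -l2norm_sqrtmx//; exact/posdef_psd/Fbpd.
  apply: leeD2l; apply: lee_paddl => //; apply: lee_paddl => //.
  by rewrite lee_fin.
rewrite /expected_posterior unlock.
apply: (@le_trans _ _ (\int[P]_om ((frac_posterior b k X w lambda alpha
    (data_vector Y om) Adim)%:E + g om))%E).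
  apply: le_lower_integral => // om; by rewrite lee_fin frac_posterior_ge0.
apply: (@le_trans _ _ (\int[P]_om (frac_posterior b k X w lambda alpha
    (data_vector Y om) Adim)%:E + \int[P]_om g om)%E).
  by apply: lower_integralD_le => // om; rewrite lee_fin frac_posterior_ge0.
apply: leeD2l.
have msfE : measurable_fun setT (fun om => (sf om)%:E) by exact/measurable_EFinP.
have sfE0 om : (0 <= (sf om)%:E)%E by rewrite lee_fin.
rewrite ge0_integralD// ge0_integralD//.
rewrite !EFinD -addeA; apply: leeD.
  exact: integral_compl_le.
apply: leeD; first exact: intsf.
rewrite ge0_integralZl_EFin// -/K [leRHS]EFinM; apply: lee_wpmul2l; first by rewrite lee_fin.
rewrite ge0_integral_sum//; last 2 first.
- by move=> S; apply: measurable_funeM.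
- by move=> S om _; rewrite mule_ge0 ?lee_fin ?divr_ge0.
set ex := expR _; have ex0 : 0 <= ex by exact: expR_ge0.
apply: (@le_trans _ _ (\sum_(S : {set 'I_p}) (w #|S| / 'C(p, #|S|)%:R * ex)%:E)%E).
  apply: lee_sum => S _; rewrite ge0_integralZl_EFin// ?divr_ge0// [leRHS]EFinM.
  have [Smax|Smax] := leqP #|S| smax; last first.
    by have [_ wout _] := wpmf; rewrite wout// mul0r !mul0e.
  apply: lee_wpmul2l; first by rewrite lee_fin divr_ge0.
  apply: far_integral_mean_le kq => //; apply: posdefZ; last exact: Fbpd.
  by rewrite divr_gt0// mulr_gt0.
rewrite sumEFin lee_fin -mulr_suml ler_piMl//.
exact: (sum_model_prior_le1 _ wpmf).
Qed.

End contraction.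

(** * Compatibility constants of the design *)

Section design.
Context {R : realType} (b : R -> R) (n p : nat) (X : 'M[R]_(n, p)).
Context (theta0 : 'cV[R]_p).
Local Notation W0 := (weight_mx b X theta0).
Local Notation Q v := (quadform (fisher b X theta0) v).

Lemma quadform_gram v : quadform (gram X W0) v = n%:R^-1 * Q v.
Proof.
rewrite quadformZ quadform_fisher; congr (_ * _).
have -> : quadform (X^T *m W0 *m X) v = ((X *m v)^T *m (W0 *m (X *m v))) 0 0.
  by rewrite /quadform trmx_mul !mulmxA.
rewrite mxE; apply: eq_bigr => i _.
by rewrite mul_diag_mx !mxE; ring.
Qed.

Lemma supp_eq0 (v : 'cV[R]_p) : #|supp v| = 0%N -> v = 0.
Proof.
move=> /eqP; rewrite cards_eq0 => /eqP v0; apply/matrixP => i j; rewrite ord1 mxE.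
by move/setP: v0 => /(_ i); rewrite !inE => /negbFE/eqP.
Qed.

Lemma l1norm_ge0 (v : 'cV[R]_p) : 0 <= l1norm v.
Proof. by apply: sumr_ge0. Qed.

Lemma l1norm_sqr_le (v : 'cV[R]_p) : l1norm v ^+ 2 <= #|supp v|%:R * l2norm v ^+ 2.
Proof.
have := cauchy_schwarz (fun j => (v j 0 != 0)%:R : R) (fun j => `|v j 0|).
rewrite l2norm_sqr card_suppE /l1norm.
under [X in X ^+ 2 <= _]eq_bigr => j _.
  rewrite (_ : _ * _ = `|v j 0|); last first.
    by case: eqP => [->|_]; rewrite ?normr0 ?mulr0 ?mul1r.
  over.
under [X in _ <= X * _]eq_bigr => j _.
  rewrite (_ : _ ^+ 2 = (v j 0 != 0)%:R); last by case: (_ != _); rewrite ?expr1n ?expr0n.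
  over.
by under [X in _ <= _ * X]eq_bigr do rewrite real_normK ?num_real//.
Qed.

Hypothesis b2p : forall x, 0 <= b^`(2)%classic x.

Lemma quadform_gram_ge0 v : 0 <= quadform (gram X W0) v.
Proof.
by rewrite quadform_gram mulr_ge0// ?invr_ge0//; case: (fisher_psd X theta0 b2p) => _; apply.
Qed.

Variable s : R.

Lemma phi2_le v : sparse_cone s v ->
  phi2 X s W0 ^+ 2 * l2norm v ^+ 2 <= n%:R^-1 * Q v.
Proof.
move=> vs; rewrite /phi2; set E := [set _ | _ in _].
have Elb : lbound E 0.
  by move=> _ [t _ <-]; rewrite divr_ge0 ?quadform_gram_ge0// sqr_ge0.
rewrite sqr_sqrtr; last by apply: lb_le_inf => //; exists (quadform (gram X W0) v / l2norm v ^+ 2), v.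
rewrite -quadform_gram; have [->|v0] := eqVneq (l2norm v) 0.
  by rewrite expr0n mulr0 quadform_gram_ge0.
rewrite -ler_pdivlMr; last by rewrite exprn_gt0// lt_neqAle eq_sym v0 l2norm_ge0.
by apply: ge_inf; [exists 0|exists v].
Qed.

Lemma phi1_le v : sparse_cone s v ->
  phi1 X s W0 ^+ 2 * l1norm v ^+ 2 <= #|supp v|%:R * (n%:R^-1 * Q v).
Proof.
move=> vs; rewrite /phi1; set E := [set _ | _ in _].
have pos t : 0 <= #|supp t|%:R * quadform (gram X W0) t.
  by rewrite mulr_ge0 ?quadform_gram_ge0.
have Elb : lbound E 0 by move=> _ [t _ <-]; rewrite divr_ge0// sqr_ge0.
rewrite sqr_sqrtr; last first.
  by apply: lb_le_inf => //; exists (#|supp v|%:R * quadform (gram X W0) v / l1norm v ^+ 2), v.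
rewrite -quadform_gram; have [->|v0] := eqVneq (l1norm v) 0.
  by rewrite expr0n mulr0.
rewrite -ler_pdivlMr; last by rewrite exprn_gt0// lt_neqAle eq_sym v0 l1norm_ge0.
by apply: ge_inf; [exists 0|exists v].
Qed.

(** By the Cauchy-Schwarz inequality every compatibility ratio dominates the
    corresponding restricted eigenvalue ratio. *)
Lemma phi2_le_phi1 : 0 < phi2 X s W0 -> phi2 X s W0 <= phi1 X s W0.
Proof.
rewrite /phi2 /phi1; set E := [set _ | _ in _]; set E1 := [set _ | _ in _] => phi0.
have [cone0|/set0P[v vs]] := eqVneq (@sparse_cone R p s) set0.
  by move: phi0; rewrite /E cone0 image_set0 inf0 sqrtr0 ltxx.
have Elb : lbound E 0.
  by move=> _ [t _ <-]; rewrite divr_ge0 ?quadform_gram_ge0// sqr_ge0.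
apply: ler_wsqrtr; apply: lb_le_inf.
  by exists (#|supp v|%:R * quadform (gram X W0) v / l1norm v ^+ 2), v.
move=> _ [t ts <-]; apply: (@le_trans _ _ (quadform (gram X W0) t / l2norm t ^+ 2)).
  by apply: ge_inf; [exists 0|exists t].
have t2 : 0 < l2norm t ^+ 2.
  rewrite exprn_gt0// lt_neqAle l2norm_ge0 andbT eq_sym; apply/negP => /eqP t2.
  case: ts => + _; rewrite card_gt0 => /set0Pn[j]; rewrite inE => /negP; apply.
  have := l2norm_sqr t; rewrite t2 expr0n => /esym/eqP.
  rewrite psumr_eq0; last by move=> i _; exact: sqr_ge0.
  by move=> /allP /(_ j (mem_index_enum _)) /=; rewrite sqrf_eq0.
have t1 : 0 < l1norm t ^+ 2.
  rewrite exprn_gt0// lt_neqAle l1norm_ge0 andbT eq_sym; apply/negP => /eqP t1.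
  case: ts => + _; rewrite card_gt0 => /set0Pn[j]; rewrite inE => /negP; apply.
  move/eqP: t1; rewrite psumr_eq0//.
  by move=> /allP /(_ j (mem_index_enum _)) /=; rewrite normr_eq0.
rewrite ler_pdivrMr// mulrAC ler_pdivlMr// mulrAC -mulrA mulrCA mulrC.
rewrite mulrA; apply: ler_wpM2r; first exact: quadform_gram_ge0.
by rewrite [leRHS]mulrC l1norm_sqr_le.
Qed.

Lemma le_mx_norm i j : `|X i j| <= mx_norm X.
Proof. by rewrite mx_normrE; exact: (le_bigmax _ (fun ij => `|X ij.1 ij.2|) (i, j)). Qed.

(** The sup norm of the linear predictor is at most the largest entry of X times the
    l1 norm, which sparsity compares with the l2 norm and phi2 with the information
    norm.  The factor in front is what the assumption on the design makes
    negligible. *)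
Lemma sparse_linpred_le v i : #|supp v|%:R <= s -> 0 < phi2 X s W0 ->
  `|(X *m v) i 0| <=
  mx_norm X * Num.sqrt (s / n%:R) / phi2 X s W0 * Num.sqrt (Q v).
Proof.
move=> vs phi0; have mx0 : 0 <= mx_norm X.
  by rewrite mx_normrE; exact: bigmax_ge_id.
have [/supp_eq0 ->|sv] := posnP #|supp v|.
  by rewrite mulmx0 mxE normr0 !mulr_ge0 ?sqrtr_ge0// invr_ge0 ltW.
have Xv : `|(X *m v) i 0| <= mx_norm X * l1norm v.
  rewrite mxE mulr_sumr; apply: le_trans (ler_norm_sum _ _ _) _.
  by apply: ler_sum => j _; rewrite normrM ler_wpM2r// le_mx_norm.
apply: le_trans Xv _; rewrite -!mulrA; apply: ler_wpM2l => //.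
rewrite mulrCA mulrC ler_pdivlMr//.
have n0 : 0 <= (n%:R : R)^-1 by rewrite invr_ge0.
have s0 : 0 <= s by exact: le_trans vs.
have Q0 : 0 <= Q v by case: (fisher_psd X theta0 b2p) => _; apply.
rewrite -sqrtrM; last by rewrite mulr_ge0.
rewrite -(ler_pXn2r (n := 2))// ?nnegrE ?mulr_ge0 ?sqrtr_ge0 ?l1norm_ge0//.
rewrite sqr_sqrtr ?mulr_ge0// exprMn.
apply: (@le_trans _ _ (s * l2norm v ^+ 2 * phi2 X s W0 ^+ 2)).
  rewrite ler_wpM2r ?sqr_ge0//; apply: le_trans (l1norm_sqr_le v) _.
  by rewrite ler_wpM2r// sqr_ge0.
have vc : sparse_cone s v by split.
have -> : s * l2norm v ^+ 2 * phi2 X s W0 ^+ 2 =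
  s * (phi2 X s W0 ^+ 2 * l2norm v ^+ 2) by ring.
by rewrite -(mulrA s); apply: ler_wpM2l => //; exact: phi2_le.
Qed.

Lemma l2norm_far v (r : R) : sparse_cone s v -> 0 < phi2 X s W0 -> 0 <= r ->
  (0 < n)%N -> r / phi2 X s W0 < l2norm v -> r ^+ 2 * n%:R < Q v.
Proof.
move=> vs phi0 r0 n0; rewrite ltr_pdivrMr// => rv.
rewrite mulrC -ltr_pdivlMl ?ltr0n//; apply: lt_le_trans (phi2_le vs).
by rewrite -exprMn mulrC ltr_pXn2r// ?nnegrE// mulr_ge0 ?l2norm_ge0// ltW.
Qed.

Lemma l1norm_far v (r : R) : sparse_cone s v -> 0 < phi1 X s W0 -> 0 <= r ->
  (0 < n)%N -> r / phi1 X s W0 < l1norm v -> r ^+ 2 * n%:R < s * Q v.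
Proof.
move=> vs phi0 r0 n0; rewrite ltr_pdivrMr// => rv.
have Q0 : 0 <= Q v by case: (fisher_psd X theta0 b2p) => _; apply.
apply: (@lt_le_trans _ _ (#|supp v|%:R * Q v)); last by rewrite ler_wpM2r//; case: vs.
rewrite mulrC -ltr_pdivlMl ?ltr0n// mulrCA; apply: lt_le_trans (phi1_le vs).
by rewrite -exprMn mulrC ltr_pXn2r// ?nnegrE// mulr_ge0 ?l1norm_ge0// ltW.
Qed.

End design.

(** * Rates *)

Section rates.
Context {R : realType}.

Lemma powR_expR_ln (x a : R) : 0 < x -> x `^ a = expR (a * ln x).
Proof. by move=> x0; rewrite mulrC expRM lnK. Qed.

Lemma leq_bin_expn n m : ('C(n, m) <= n ^ m)%N.
Proof.
apply: (@leq_trans (n ^_ m)); first by rewrite -bin_ffact leq_pmulr// fact_gt0.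
by elim: m => // m IH; rewrite ffactnSr expnSr leq_mul// leq_subr.
Qed.

(** Summing the decay over the dimensions 1, .., smax shows that these carry at most
    half of the total mass. *)
Lemma pmf_upto_null_ge (smax : nat) (w : nat -> R) r : pmf_upto smax w -> r <= 2^-1 ->
  (forall s, (1 <= s <= smax)%N -> w s <= r * w s.-1) -> 2^-1 <= w 0%N.
Proof.
move=> [w0 _ w1] r2 dec.
have : \sum_(i < smax) w i.+1 <= 2^-1.
  apply: (@le_trans _ _ (2^-1 * \sum_(i < smax.+1) w i)); last by rewrite w1 mulr1.
  rewrite big_ord_recr /= mulrDr mulr_sumr; apply: ler_wpDr; first by rewrite mulr_ge0.
  apply: ler_sum => i _; apply: le_trans (dec i.+1 _) _; first exact: ltn_ord.
  by rewrite /= ler_wpM2r.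
by move: w1; rewrite big_ord_recl /=; under eq_bigr do rewrite /bump add1n; lra.
Qed.

Lemma pmf_upto_ge (smax s : nat) (w : nat -> R) r : 0 <= r -> (s <= smax)%N ->
  (forall s, (1 <= s <= smax)%N -> r * w s.-1 <= w s) -> r ^+ s * w 0%N <= w s.
Proof.
move=> r0; elim: s => [|s IH] smx dec; first by rewrite mul1r.
apply: le_trans (dec s.+1 _); last by rewrite smx.
by rewrite exprS -mulrA; apply: ler_wpM2l => //; apply: IH => //; exact: ltnW.
Qed.

(** Iterating the lower decay bound from dimension 0; the 1 in the exponent pays for
    the mass 1/2 of the null model. *)
Lemma pmf_upto_rate (smax s p : nat) (w : nat -> R) (A1 A2 A3 A4 : R) :
  pmf_upto smax w -> (0 < s <= smax)%N -> 0 < A1 -> 0 <= A3 -> 1 <= ln p%:R :> R ->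
  (forall s, (1 <= s <= smax)%N ->
    A1 * p%:R `^ (- A3) * w s.-1 <= w s <= A2 * p%:R `^ (- A4) * w s.-1) ->
  A2 * p%:R `^ (- A4) <= 2^-1 ->
  expR (- ((`|ln A1| + A3 + 1) * (s%:R * ln p%:R))) <= w s.
Proof.
move=> wpmf /andP[s0 smx] A10 A30 L1 dec A2p.
have p0 : 0 < p%:R :> R.
  by rewrite ltNge; apply/negP => /ln0 L0; move: L1; rewrite L0 ler10.
have w0 : 2^-1 <= w 0%N by apply: (pmf_upto_null_ge wpmf A2p) => t /dec/andP[].
have r0 : 0 <= A1 * p%:R `^ (- A3) by rewrite mulr_ge0// ?powR_ge0// ltW.
apply: le_trans (pmf_upto_ge r0 smx _); last by move=> t /dec/andP[].
rewrite powR_expR_ln// -{2}(lnK A10) -expRD -expRM_natl.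
have half : expR (- (s%:R * ln p%:R)) <= w 0%N.
  apply: le_trans w0; rewrite expRN lef_pV2 ?posrE ?expR_gt0//.
  apply: le_trans (expR_ge1Dx _); rewrite -lerBlDl (_ : 2 - 1 = 1 * 1); last by ring.
  by apply: ler_pM => //; rewrite ler1n.
apply: le_trans (ler_wpM2l (expR_ge0 _) half); rewrite -expRD ler_expR.
have sL : 1 <= s%:R * ln p%:R :> R 
  by apply: (@le_trans _ _ s%:R); rewrite ?ler1n// ler_peMr.
have s1 : 0 <= s%:R :> R by [].
have : - `|ln A1| <= ln A1 by rewrite lerNl -normrN ler_norm.
move=> lA; have : - (`|ln A1| * ln p%:R) <= ln A1.
  apply: le_trans lA; rewrite lerN2 ler_peMr//.
move=> lA'; have := ler_wpM2l s1 lA'; rewrite -[_ *+ _]mulr_natl; lra.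
Qed.

(** Since log p >= 1 and s0 >= 1, every factor in the evidence bound and in the
    domination of the prior is at worst exp (C s0 log p) with C free of n.  E below
    collects the exponents of the denominator and G that of the numerator; K is
    then chosen so that cgap K exceeds G + E + 1. *)
Lemma contraction_exponent (B A5 A6 Cdev Kdim cgap R0 M : R) :
  0 <= B -> 0 <= A5 -> 0 <= A6 -> 1 <= Cdev -> 0 <= Kdim -> 0 < cgap -> 0 <= R0 -> 0 <= M ->
  exists K : R, 1 <= K /\
  forall p (theta0 : 'cV[R]_p) (w : nat -> R) (l2D lambda : R),
    let s0 := #|supp theta0| in let L := ln p%:R in
    (0 < s0)%N -> 1 <= L -> expR (- (B * (s0%:R * L))) <= w s0 ->
    expR (- (A5 * L)) <= lambda <= A6 -> l2D <= 3 * L ->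
    expR (Kdim * s0%:R * ((l2D + lambda * L) / 2)) /
      (w s0 / 'C(p, s0)%:R *
       evidence_factor Cdev theta0 (s0%:R * (M * L)) (R0 * s0%:R * L) lambda) *
      expR (- (cgap * (K * s0%:R * L))) <= p%:R ^- s0.
Proof.
move=> B0 A50 A60 C1 Kd0 cg0 R00 M0.
pose u : R := `|ln (Cdev^-1 / (2 * pi))|.
pose E := B + 1 + (Num.sqrt M + Cdev / 2 + (A5 + u) + A6 * Cdev * (1 + R0)).
pose G := Kdim * ((3 + A6) / 2).
exists (1 + (G + E + 1) / cgap); split.
  have u0 : 0 <= u by exact: normr_ge0.
  have sM0 := sqrtr_ge0 M.
  rewrite lerDl divr_ge0 ?(ltW cg0)// /G /E !addr_ge0// ?mulr_ge0// ?addr_ge0// ?divr_ge0//;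
    by rewrite ?(le_trans ler01).
move=> p theta0 w l2D lambda s0 L s00 L1 wlo /andP[llo lup] l2Dle.
have L0 : 0 <= L by exact: le_trans ler01 L1.
have C0 : 0 < Cdev by exact: lt_le_trans ltr01 C1.
have p0 : 0 < p%:R :> R.
  by rewrite ltNge; apply/negP => /ln0 Lz; move: L1; rewrite /L Lz ler10.
have pE : p%:R ^+ s0 = expR (s0%:R * L) :> R.
  by rewrite expRM_natl lnK.
set t := s0%:R * L; have s1 : 1 <= s0%:R :> R by rewrite ler1n.
have t0 : 0 <= t by rewrite mulr_ge0.
have st : s0%:R <= t by rewrite ler_peMr.
have binlo : expR (- t) <= ('C(p, s0)%:R)^-1.
  rewrite expRN -pE lef_pV2 ?posrE ?exprn_gt0// ?ltr0n ?bin_gt0.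
    by rewrite -natrX ler_nat leq_bin_expn.
  by apply: leq_trans (max_card _) _; rewrite card_ord.
have wb : expR (- ((B + 1) * t)) <= w s0 / 'C(p, s0)%:R.
  rewrite (_ : - _ = - (B * t) + - t); last by ring.
  by rewrite expRD; apply: ler_pM; rewrite ?expR_ge0.
have ev1 : expR (- ((Num.sqrt M + Cdev / 2) * t)) <=
    expR (- (Num.sqrt (s0%:R * (M * L) * s0%:R) + Cdev * s0%:R / 2)).
  rewrite ler_expR lerN2 mulrDl; apply: lerD.
    rewrite (_ : _ * s0%:R = M * (s0%:R ^+ 2 * L)); last by ring.
    rewrite sqrtrM//; apply: ler_wpM2l; first exact: sqrtr_ge0.
    rewrite sqrtrM ?sqr_ge0// sqrtr_sqr ger0_norm//; apply: ler_wpM2l => //.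
    rewrite -[leRHS](ger0_norm L0) -sqrtr_sqr; apply: ler_wsqrtr.
    by rewrite expr2 ler_peMl.
  by rewrite mulrAC; apply: ler_wpM2l => //; rewrite divr_ge0// ltW.
have lpos : 0 < lambda by exact: lt_le_trans (expR_gt0 _) llo.
have pi2 : 0 < 2 * pi :> R by rewrite mulr_gt0// pi_gt0.
have ev2 : expR (- ((A5 + u) * t)) <= Num.sqrt ((lambda / Cdev / (2 * pi)) ^+ s0).
  have base : expR (- ((A5 + u) * L)) <= lambda / Cdev / (2 * pi).
    rewrite -mulrA (_ : - _ = - (A5 * L) + - (u * L)); last by ring.
    have k0 : 0 < Cdev^-1 / (2 * pi) by rewrite divr_gt0// invr_gt0.
    rewrite expRD; apply: ler_pM; rewrite ?expR_ge0//.
    rewrite -[leRHS]lnK ?posrE// ler_expR.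
    apply: (@le_trans _ _ (- u)); first by rewrite lerN2 ler_peMr// normr_ge0.
    by rewrite /u lerNl -normrN ler_norm.
  rewrite -[leLHS]ger0_norm ?expR_ge0// -sqrtr_sqr; apply: ler_wsqrtr.
  apply: (@le_trans _ _ (expR (- ((A5 + u) * L)) ^+ s0)); last first.
    by apply: lerXn2r => //; rewrite nnegrE ?expR_ge0// !divr_ge0// ltW.
  rewrite -!expRM_natl ler_expR.
  have : 0 <= (A5 + u) * t by rewrite mulr_ge0// addr_ge0// normr_ge0.
  by rewrite /t; lra.
have ev3 : expR (- (A6 * Cdev * (1 + R0) * t)) <=
    expR (- (lambda * Cdev * (s0%:R + R0 * s0%:R * L))).
  rewrite ler_expR lerN2 -(mulrA (A6 * Cdev)); apply: ler_pM.
  - by rewrite mulr_ge0// ltW.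
  - by rewrite addr_ge0// !mulr_ge0.
  - by rewrite ler_wpM2r// ltW.
  - by rewrite mulrDl mul1r; apply: lerD => //; rewrite /t mulrA.
have den : expR (- (E * t)) <= w s0 / 'C(p, s0)%:R *
    evidence_factor Cdev theta0 (s0%:R * (M * L)) (R0 * s0%:R * L) lambda.
  rewrite (_ : - (E * t) = - ((B + 1) * t) + (- ((Num.sqrt M + Cdev / 2) * t) +
    (- ((A5 + u) * t) + - (A6 * Cdev * (1 + R0) * t)))); last by rewrite /E; ring.
  rewrite expRD [X in _ * X]expRD [X in _ * (_ * X)]expRD.
  apply: ler_pM; rewrite ?expR_ge0 ?mulr_ge0 ?expR_ge0//.
  apply: ler_pM; rewrite ?expR_ge0 ?mulr_ge0 ?expR_ge0//.
  by apply: ler_pM; rewrite ?expR_ge0.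
have num : expR (Kdim * s0%:R * ((l2D + lambda * L) / 2)) <= expR (G * t).
  rewrite ler_expR /G /t.
  rewrite (_ : Kdim * ((3 + A6) / 2) * (s0%:R * L) =
    Kdim * s0%:R * ((3 * L + A6 * L) / 2)); last by ring.
  apply: ler_wpM2l; first by rewrite mulr_ge0.
  rewrite ler_wpM2r//; apply: lerD => //; exact: ler_wpM2r.
rewrite pE -expRN; set den0 := (X in _ / X * _) in den *.
apply: (@le_trans _ _ (expR (G * t) / expR (- (E * t)) * expR (- (cgap * ((1 + (G + E + 1) / cgap) * s0%:R * L))))).
  rewrite ler_wpM2r ?expR_ge0//; apply: ler_pM; rewrite ?expR_ge0 ?invr_ge0//.
    exact: le_trans (expR_ge0 _) den.
  by rewrite lef_pV2 ?posrE ?expR_gt0// (lt_le_trans (expR_gt0 _) den).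
rewrite -expRN -!expRD ler_expR opprK -mulrA -/t.
have -> : cgap * ((1 + (G + E + 1) / cgap) * t) = cgap * t + (G + E + 1) * t.
  by field; rewrite gt_eqF.
have : 0 <= cgap * t by rewrite mulr_ge0// ltW.
by lra.
Qed.

(** With tilt sqrt (log p) the Chernoff exponent is exactly -3 log p, which leaves
    1/p after paying 2 s0 <= p^2 for the union bound. *)
Lemma score_rate (p s0 : nat) (Cdev : R) : (0 < s0 <= p)%N -> 2 <= p%:R :> R ->
  (2 * s0)%:R * expR (Cdev / 2 * Num.sqrt (ln p%:R) ^+ 2 -
    Num.sqrt (ln p%:R) * ((Cdev / 2 + 3) * Num.sqrt (ln p%:R))) <= p%:R^-1.
Proof.
move=> /andP[_ s0p] p2; set L := ln p%:R; set m := _ + 3; have p0 : 0 < p%:R :> R by exact: lt_le_trans p2.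
have L0 : 0 <= L by rewrite ln_ge0// (le_trans _ p2)// ler1n.
rewrite (_ : _ - _ = - (3 * L)); last first.
  have -> : Num.sqrt L * (m * Num.sqrt L) = m * Num.sqrt L ^+ 2 by ring.
  by rewrite sqr_sqrtr// /m; ring.
rewrite expRN expRM_natl lnK ?posrE//.
rewrite natrM ler_pdivrMr ?exprn_gt0//.
rewrite (_ : p%:R^-1 * p%:R ^+ 3 = p%:R * p%:R); last by field; rewrite gt_eqF.
by apply: ler_pM => //; rewrite ler_nat.
Qed.

End rates.

Section sparse_contraction.
Context {R : realType} (b k : R -> R) (nu : {measure set R -> \bar R}).
Hypothesis b_diff : forall (m : nat) (x : R), (m < 3)%N ->
  derivable b^`(m)%classic x 1.
Hypothesis b_convex : strictly_convex b.
Variable Cdev : R.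
Hypothesis Cdev1 : 1 <= Cdev.
Hypothesis b_dev : forall x y, `|y| <= 2^-1 ->
  b^`(2)%classic (x + y) <= Cdev * b^`(2)%classic x.
Hypothesis mk : measurable_fun setT k.
Hypothesis density1 : forall eta : R,
  (\int[nu]_y (glm_density b k eta y)%:E = 1)%E.

(** The deviation level of the standardized score, in units of sqrt (log p); the
    term Cdev / 2 cancels the quadratic term of the Chernoff exponent. *)
Definition score_level : R := Cdev / 2 + 3.
(** The squared information distance from theta0 to the maximum likelihood estimator
    of the true model, in units of s0 log p; the 1 makes the inequality required
    by mle_near strict. *)
Definition mle_radius : R := 4 * Cdev ^+ 2 * score_level ^+ 2 + 1.

Lemma mle_radius_ge1 : 1 <= mle_radius.
Proof. by rewrite lerDr mulr_ge0 ?sqr_ge0// mulr_ge0// sqr_ge0. Qed.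

Lemma mul_sqrt_le_half (x y : R) : 0 <= y -> x ^+ 2 * y <= 4^-1 ->
  x * Num.sqrt y <= 2^-1.
Proof.
move=> y0; rewrite -{1}(sqr_sqrtr y0) -exprMn; set u := _ * _ => u4.
rewrite leNgt; apply/negP => u2; have : 2^-1 * 2^-1 < u * u by apply: ltr_pM.
by move: u4; rewrite expr2; lra.
Qed.

Context (n : nat) {disp} {T : measurableType disp} (P : probability T R).
Context (Y : 'I_n -> {RV P >-> R}) (p : nat) (X : 'M[R]_(n, p)).
Context (theta0 : 'cV[R]_p).
Hypothesis sampleY : glm_sample b k P Y nu X theta0.
Hypothesis intk : forall i : 'I_n, P.-integrable [set: T] (fun w => (k (Y i w))%:E).
Local Notation S0 := (supp theta0).
Local Notation s0 := #|supp theta0|.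
Local Notation Q v := (quadform (fisher b X theta0) v).
Local Notation L := (ln p%:R : R).

(** expected_posterior_le with its free parameters in units of log p: the smallness of
    zeta provides the localization conditions of the evidence bound, and the one of
    the design provides the bound on the linear predictors. *)
Lemma sparse_contraction (smax : nat) (w : nat -> R) (D lambda alpha Kdim K : R)
    (tb : forall S : {set 'I_p}, 'cV[R]_#|S|) (E : set T) (A : set 'cV[R]_p) :
  let phi := phi2 X ((Kdim + 1) * s0%:R) (weight_mx b X theta0) in
  (0 < n)%N -> (0 < s0)%N -> 2 <= p%:R :> R -> 1 <= L ->
  fisher_star b k P Y X S0 \in unitmx ->
  pmf_upto smax w -> (s0 <= smax)%N -> 0 < w s0 -> 0 < lambda -> 1 < D ->
  0 < alpha < 1 -> 0 <= Kdim -> 0 < K ->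
  (forall S : {set 'I_p}, (#|S| <= smax)%N ->
     fisher b (subcols X S) (tb S) \in unitmx) ->
  measurable E -> ((1 - p%:R^-1)%:E <= P E)%E ->
  (forall w, E w -> forall S : {set 'I_p}, (#|S| <= smax)%N ->
    let y := data_vector Y w in
    [/\ is_argmax (loglik b k (subcols X S) y) (mle b k X y S),
      loewner_le (D^-1 *: fisher b (subcols X S) (tb S))
        (fisher b (subcols X S) (mle b k X y S)),
      loewner_le (fisher b (subcols X S) (mle b k X y S))
        (D *: fisher b (subcols X S) (tb S)) &
      l2norm (sqrtmx (fisher b (subcols X S) (tb S)) *m (mle b k X y S - tb S)) ^+ 2
        <= D * #|S|%:R * L]) ->
  zeta b k P Y X S0 ^+ 2 * (mle_radius * s0%:R * L) <= 4^-1 ->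
  0 < phi ->
  mx_norm X ^+ 2 * s0%:R ^+ 2 * L / phi ^+ 2 * ((Kdim + 1) * K) <= 4^-1 * n%:R ->
  expR (Kdim * s0%:R * ((ln (2 * D ^+ 2) + lambda * L) / 2)) /
    (w s0 / 'C(p, s0)%:R *
     evidence_factor Cdev theta0 (s0%:R * (score_level ^+ 2 * L))
       (mle_radius * s0%:R * L) lambda) *
    expR (- (alpha * (1 - alpha) / (2 * Cdev) * (K * s0%:R * L))) <= p%:R ^- s0 ->
  (forall theta, A theta -> #|supp theta|%:R <= Kdim * s0%:R ->
     K * s0%:R * L < Q (theta - theta0)) ->
  (expected_posterior b k P Y X w lambda alpha A <=
   expected_posterior b k P Y X w lambda alpha
     [set theta | (Kdim * s0%:R < #|supp theta|%:R)%R] +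
   (p%:R^-1 + p%:R^-1 + p%:R ^- s0)%:E)%E.
Proof.
move=> phi n0 s00 p2 L1 Fu wpmf s0max ws0 l0 D1 a01 Kd0 K0 tbu mE PE HE zle phi0 Xle
  expo Afar.
have b2p x := b2_ge0 b_diff b_convex Cdev1 b_dev x.
have L0 : 0 < L by exact: lt_le_trans ltr01 L1.
have s1 : 1 <= s0%:R :> R by rewrite ler1n.
have D0 : 0 < D by exact: lt_trans ltr01 D1.
have n0' : 0 < n%:R :> R by rewrite ltr0n.
have r1 := mle_radius_ge1; have z2 := sqr_ge0 (zeta b k P Y X S0).
set z := zeta b k P Y X S0 in zle z2.
pose kappa := mx_norm X * Num.sqrt ((Kdim + 1) * s0%:R / n%:R) / phi.
have sL1 : 1 <= s0%:R * L by apply: (le_trans s1); rewrite ler_peMr.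
have sL0 : 0 < s0%:R * L by exact: lt_le_trans sL1.
have rs : s0%:R <= mle_radius * s0%:R * L.
  by rewrite -mulrA mulrCA ler_peMr// (le_trans L1)// ler_peMl// ltW.
have rL : L <= mle_radius * s0%:R * L.
  apply: ler_peMl; first exact: ltW.
  by apply: (le_trans s1); rewrite ler_peMl.
have sz : Num.sqrt L * z <= 2^-1.
  rewrite mulrC; apply: mul_sqrt_le_half; first exact: ltW.
  by apply: le_trans zle; apply: ler_wpM2l.
have zr : z * Num.sqrt (mle_radius * s0%:R * L) <= 2^-1.
  apply: mul_sqrt_le_half => //; apply: ltW; exact: lt_le_trans rL.
have zs : z * Num.sqrt s0%:R <= 2^-1.
  by apply: mul_sqrt_le_half => //; apply: le_trans zle; apply: ler_wpM2l.
have lev : (score_level * Num.sqrt L) ^+ 2 = score_level ^+ 2 * L.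
  by rewrite exprMn sqr_sqrtr// ltW.
have rad : 4 * Cdev ^+ 2 * (s0%:R * (score_level * Num.sqrt L) ^+ 2)
    < mle_radius * s0%:R * L.
  rewrite lev (_ : _ * (s0%:R * _) = 4 * Cdev ^+ 2 * score_level ^+ 2 * s0%:R * L);
    last by ring.
  by rewrite -!(mulrA _ s0%:R) ltr_pM2r// ltrDl.
have lnD : 0 <= ln (2 * D ^+ 2) + lambda * L.
  rewrite addr_ge0//; last by rewrite mulr_ge0// ltW.
  have D2 : 1 <= D ^+ 2 by rewrite exprn_ege1// ltW.
  apply: ln_ge0; apply: (le_trans D2); apply: ler_peMl; last by rewrite ler1n.
  exact: le_trans D2.
have kap theta : #|supp theta|%:R <= Kdim * s0%:R -> forall i,
    `|(X *m (theta - theta0)) i 0| <= kappa * Num.sqrt (Q (theta - theta0)).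
  move=> th i; apply: sparse_linpred_le => //.
  by apply: le_trans (_ : (#|supp theta| + s0)%:R <= _);
    rewrite ?ler_nat ?card_supp_sub// natrD mulrDl mul1r lerD2r.
have q0 : 0 < K * s0%:R * L by rewrite -mulrA mulr_gt0.
have kq : kappa * Num.sqrt (K * s0%:R * L) <= 2^-1.
  apply: mul_sqrt_le_half; first exact: ltW.
  have -> : kappa ^+ 2 * (K * s0%:R * L) =
      mx_norm X ^+ 2 * s0%:R ^+ 2 * L / phi ^+ 2 * ((Kdim + 1) * K) / n%:R.
    rewrite !exprMn sqr_sqrtr.
      by field; rewrite !gt_eqF.
    by rewrite divr_ge0// ?mulr_ge0// ?addr_ge0.
  by rewrite ler_pdivrMr.
apply: le_trans (expected_posterior_le b_diff b_convex Cdev1 b_dev mk density1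
  sampleY intk (s := Num.sqrt L) Fu wpmf s0max ws0 l0 D0 lnD a01 tbu mE PE HE _ sz rad zr zs q0
  kap kq Afar) _.
  by rewrite sqrtr_gt0.
apply: leeD2l; rewrite lee_fin lev; apply: lerD; last exact: expo.
apply: lerD => //; apply: score_rate => //; rewrite s00 /=.
by apply: leq_trans (max_card _) _; rewrite card_ord.
Qed.

End sparse_contraction.

(** * Asymptotics *)

Section asymptotics.
Context {R : realType}.

Lemma ln_dim_large (p : nat -> nat) (c : R) : 0 < c ->
  (\forall n \near \oo, n%:R `^ c <= (p n)%:R :> R) ->
  forall K : R, \forall n \near \oo, K <= ln (p n)%:R.
Proof.
move=> c0 hp K; near=> n.
have ncK : expR (K / c) <= n%:R by near: n; exact: nbhs_infty_ger.
have n0 : 0 < n%:R :> R by exact: lt_le_trans (expR_gt0 _) ncK.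
have np : n%:R `^ c <= (p n)%:R :> R by near: n.
have nc0 : 0 < n%:R `^ c :> R by exact: powR_gt0.
apply: (@le_trans _ _ (ln (n%:R `^ c))); last first.
  by rewrite ler_ln ?posrE// (lt_le_trans nc0).
rewrite ln_powR mulrC -ler_pdivrMr// -[leLHS]expRK.
by rewrite ler_ln ?posrE// expR_gt0.
Unshelve. all: by end_near. Qed.

Lemma littleo_near_le (f g : nat -> R) eps : f =o_\oo g -> 0 < eps ->
  \forall n \near \oo, f n <= eps * `|g n|.
Proof.
move=> /eqoP fg e0; have := fg eps e0; apply: filterS => n.
by apply: le_trans; exact: ler_norm.
Qed.

Lemma eventuallyI (U V : set nat) : \oo U -> \oo V -> \oo (U `&` V).
Proof. exact: filterI. Qed.

End asymptotics.

Theorem theorem4p4 (R : realType)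
  (* the exponential family *)
  (b k : R -> R) (nu : {measure set R -> \bar R}) (Cdev : R)
  (hb_convex : strictly_convex b)
  (hb_diff : forall (m : nat) (x : R), (m < 3)%N -> derivable b^`(m)%classic x 1)
  (hk : measurable_fun [set: R] k)
  (h_density : forall eta : R,
    (\int[nu]_y (glm_density b k eta y)%:E = 1)%E)
  (hCdev : 1 <= Cdev)
  (hb_dev : forall x y : R, `|y| <= 2^-1 ->
    b^`(2)%classic (x + y) <= Cdev * b^`(2)%classic x)
  (* the design and the true parameter *)
  (p : nat -> nat) (c : R) (hc : 0 < c)
  (hp : \forall n \near \oo, n%:R `^ c <= (p n)%:R :> R)
  (X : forall n, 'M[R]_(n, p n))
  (theta0 : forall n, 'cV[R]_(p n))
  (s0 : nat -> nat) (hs0 : forall n, s0 n = #|supp (theta0 n)|)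
  (htheta0 : \forall n \near \oo, theta0 n <> 0)
  (* the sample *)
  (disp : nat -> measure_display) (T : forall n, measurableType (disp n))
  (P : forall n, probability (T n) R)
  (Y : forall n, 'I_n -> {RV (P n) >-> R})
  (hY : forall n, glm_sample b k (P n) (Y n) nu (X n) (theta0 n))
  (hkY : forall n (i : 'I_n),
    (P n).-integrable [set: T n] (fun omega => (k (Y n i omega))%:E))
  (* the prior *)
  (smax : nat -> nat) (w : nat -> nat -> R) (lambda : nat -> R)
  (A1 A2 A3 A4 : R)
  (hA : [/\ 0 < A1, 0 < A2, 0 < A3 & 0 < A4])
  (hsmax : \forall n \near \oo, (s0 n <= smax n <= \rank (X n))%N)
  (hw : \forall n \near \oo, pmf_upto (smax n) (w n))
  (hw_decay : \forall n \near \oo, forall s : nat, (1 <= s <= smax n)%N ->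
    A1 * (p n)%:R `^ (- A3) * w n s.-1 <= w n s
      <= A2 * (p n)%:R `^ (- A4) * w n s.-1)
  (* hypothesis (1) *)
  (D : nat -> R)
  (thetabar : forall n (S : {set 'I_(p n)}), 'cV[R]_#|S|)
  (hD : \forall n \near \oo, Num.sqrt 2 < D n)
  (hthetabar : \forall n \near \oo, forall S : {set 'I_(p n)},
    (#|S| <= smax n)%N ->
    fisher b (subcols (X n) S) (thetabar n S) \in unitmx)
  (hmle : \forall n \near \oo, exists E : set (T n),
    [/\ measurable E, ((1 - (p n)%:R^-1)%:E <= P n E)%E &
      forall omega, E omega -> forall S : {set 'I_(p n)}, (#|S| <= smax n)%N ->
        let y := data_vector (Y n) omega in
        let XS := subcols (X n) S in
        let thetahat := mle b k (X n) y S in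
        let Fhat := fisher b XS thetahat in
        let Fbar := fisher b XS (thetabar n S) in
        [/\ is_argmax (loglik b k XS y) thetahat,
            loewner_le ((D n)^-1 *: Fbar) Fhat,
            loewner_le Fhat (D n *: Fbar) &
            l2norm (sqrtmx Fbar *m (thetahat - thetabar n S)) ^+ 2
              <= D n * #|S|%:R * ln (p n)%:R]])
  (hFstar : \forall n \near \oo,
    fisher_star b k (P n) (Y n) (X n) (supp (theta0 n))
      \in unitmx)
  (hzeta : (fun n =>
      zeta b k (P n) (Y n) (X n) (supp (theta0 n)) ^+ 2
        * (s0 n)%:R * ln (p n)%:R) =o_\oo (fun=> 1 : R))
  (* hypothesis (2) *)
  (hlog : (fun n =>
      let F := fisher_star b k (P n) (Y n) (X n)
                 (supp (theta0 n)) in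
      ln (Num.max (\big[Num.max/0]_(i < n) b^`(2)%classic ((X n *m theta0 n) i 0))
            (Num.max (max_row_sum (subcols (X n) (supp (theta0 n))))
              (Num.max (min_eigenvalue F)^-1%R (max_eigenvalue F)))))
      =O_\oo (fun n => ln (p n)%:R : R))
  (hs0n : (fun n => (s0 n)%:R * ln (p n)%:R) =o_\oo (fun n => n%:R : R))
  (A5 A6 A7 : R) (hA5 : 0 < A5) (hA6 : 0 < A6) (hA7 : 0 <= A7)
  (hlambda : \forall n \near \oo,
    (p n)%:R `^ (- A5) <= lambda n <= A6 * (p n)%:R `^ (- A7))
  (alpha : R) (halpha : 0 < alpha < 1)
  (hA64 : \forall n \near \oo, A6 * (p n)%:R `^ (- A7) < A4)
  (hlogD : (fun n => ln (D n) / ln (p n)%:R) =o_\oo (fun=> 1 : R))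
  (* the dimension bound defining K_dim *)
  (Kdim : R) (hKdim : 1 < Kdim)
  (hdim : \forall n \near \oo,
    (expected_posterior b k (P n) (Y n) (X n)
       (w n) (lambda n) alpha
       [set theta | (Kdim * (s0 n)%:R < #|supp theta|%:R)%R]
     <= (tail_bound (s0 n) (p n))%:E)%E)
  (* hypothesis (3) *)
  (hphi2 : \forall n \near \oo,
    0 < phi2 (X n) ((Kdim + 1) * (s0 n)%:R) (weight_mx b (X n) (theta0 n)))
  (hX : (fun n =>
      mx_norm (X n) ^+ 2 * (s0 n)%:R ^+ 2 * ln (p n)%:R
        / phi2 (X n) ((Kdim + 1) * (s0 n)%:R) (weight_mx b (X n) (theta0 n)) ^+ 2)
      =o_\oo (fun n => n%:R : R)) :
  exists Ktheta : R, 0 < Ktheta /\ \forall n \near \oo,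
    let stilde := (Kdim + 1) * (s0 n)%:R in
    let W0 := weight_mx b (X n) (theta0 n) in
    let EPi := expected_posterior b k (P n) (Y n) (X n)
                 (w n) (lambda n) alpha in
    [/\ (EPi [set theta |
          (Ktheta * (s0 n)%:R / phi1 (X n) stilde W0
             * Num.sqrt (ln (p n)%:R / n%:R) < l1norm (theta - theta0 n))%R]
          <= (2 * tail_bound (s0 n) (p n))%:E)%E,
        (EPi [set theta |
          (Ktheta / phi2 (X n) stilde W0
             * Num.sqrt ((s0 n)%:R * ln (p n)%:R / n%:R)
           < l2norm (theta - theta0 n))%R]
          <= (2 * tail_bound (s0 n) (p n))%:E)%E &
        (EPi [set theta |
          (Ktheta * (s0 n)%:R * ln (p n)%:R
           < l2norm (sqrtmx (fisher b (X n) (theta0 n)) *m (theta - theta0 n))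
               ^+ 2)%R]
          <= (2 * tail_bound (s0 n) (p n))%:E)%E].
Proof.
have {}hs0 : s0 = (fun n => #|supp (theta0 n)|) by apply/funext.
subst s0.
have [A10 A20 A30 A40] := hA; have /andP[a0 a1] := halpha.
have C0 : 0 < Cdev by exact: lt_le_trans ltr01 hCdev.
have r1 := mle_radius_ge1 Cdev.
have Kd0 : 0 <= Kdim by exact: le_trans ler01 (ltW hKdim).
have [K [K1 HK]] : exists K : R, 1 <= K /\ forall p (theta0 : 'cV[R]_p) (w : nat -> R) (l2D lambda : R),
    let s0 := #|supp theta0| in let L := ln p%:R in
    (0 < s0)%N -> 1 <= L ->
    expR (- ((`|ln A1| + A3 + 1) * (s0%:R * L))) <= w s0 ->
    expR (- (A5 * L)) <= lambda <= A6 -> l2D <= 3 * L ->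
    expR (Kdim * s0%:R * ((l2D + lambda * L) / 2)) /
      (w s0 / 'C(p, s0)%:R * evidence_factor Cdev theta0
        (s0%:R * (score_level Cdev ^+ 2 * L)) (mle_radius Cdev * s0%:R * L) lambda) *
      expR (- (alpha * (1 - alpha) / (2 * Cdev) * (K * s0%:R * L))) <= p%:R ^- s0.
  apply: contraction_exponent; rewrite ?sqr_ge0 ?(ltW hA5) ?(ltW hA6)//.
  - by rewrite !addr_ge0// ltW.
  - by rewrite divr_gt0// mulr_gt0// subr_gt0.
  - exact: le_trans r1.
have K0 : 0 < K by exact: lt_le_trans ltr01 K1.
have Kd1 : 0 < Kdim + 1 by rewrite ltr_wpDl.
have KK0 : 0 < (Kdim + 1) * K by rewrite mulr_gt0.
(* The l2 case needs Ktheta^2 >= K, the l1 case Ktheta^2 >= (Kdim + 1) K; since K >= 1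
   the choice (Kdim + 1) K serves both. *)
exists ((Kdim + 1) * K); split=> //.
have zeps : 0 < 4^-1 / mle_radius Cdev.
  by apply: divr_gt0; rewrite ?invr_gt0// (lt_le_trans ltr01 r1).
have Xeps : 0 < 4^-1 / ((Kdim + 1) * K) by apply: divr_gt0; rewrite ?invr_gt0.
have zsmall := littleo_near_le hzeta zeps.
have Xsmall := littleo_near_le hX Xeps.
have Dsmall := littleo_near_le hlogD ltr01.
have Llarge := ln_dim_large hc hp.
have nearH := eventuallyI (eventuallyI (eventuallyI (Llarge 1) (Llarge (ln (2 * A2) / A4)))
    (eventuallyI (Llarge (ln 2)) (eventuallyI hsmax (eventuallyI hw hw_decay))))
  (eventuallyI (eventuallyI (eventuallyI hD hthetabar) (eventuallyI hmle (eventuallyI hFstar (nbhs_infty_gt 0))))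
  (eventuallyI (eventuallyI (eventuallyI zsmall hlambda) (eventuallyI Dsmall hdim))
    (eventuallyI (eventuallyI hphi2 Xsmall) htheta0))).
apply: filterS nearH => n.
move=> [[[L1 L2] [l2 [/andP[s0max _] [wpmf dec]]]] [[[D2 tbu] [[E [mE PE HE]] [Fu n0]]]
  [[[z4 lamb] [lD dimle]] [[phi0 Xle] t0]]]].
set s0 := #|supp (theta0 n)| in s0max z4 dimle phi0 Xle *.
set L : R := ln (p n)%:R in L1 L2 l2 HE z4 lD Xle *.
have /andP[llo lup] := lamb.
have L0 : 0 < L by exact: lt_le_trans ltr01 L1.
have p2 : 2 <= (p n)%:R :> R.
  have p0 : 0 < (p n)%:R :> R.
    by rewrite ltNge; apply/negP => /ln0 Lz; move: L1; rewrite /L Lz ler10.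
  by rewrite -[leRHS]lnK ?posrE//; apply: le_trans (expR_ge1Dx _); rewrite lerD2l.
have p0 : 0 < (p n)%:R :> R by exact: lt_le_trans p2.
have s00 : (0 < s0)%N by rewrite lt0n; apply/eqP => /supp_eq0.
have A2p : A2 * (p n)%:R `^ (- A4) <= 2^-1.
  rewrite powR_expR_ln// mulNr expRN -/L ler_pdivrMr ?expR_gt0// ler_pdivlMl//.
  by rewrite -[leLHS]lnK ?posrE ?mulr_gt0// ler_expR (mulrC A4) -ler_pdivrMr.
have wlo : expR (- ((`|ln A1| + A3 + 1) * (s0%:R * L))) <= w n s0.
  by apply: (pmf_upto_rate wpmf _ A10 (ltW A30) L1 dec A2p); rewrite s00.
have ws0 : 0 < w n s0 by exact: lt_le_trans (expR_gt0 _) wlo.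
have l0 : 0 < lambda n by apply: lt_le_trans llo; exact: powR_gt0.
have lbounds : expR (- (A5 * L)) <= lambda n <= A6.
  rewrite -mulNr -powR_expR_ln// llo /=; apply: le_trans lup _.
  apply: ler_piMr; first exact: ltW.
  rewrite powR_expR_ln// -[leRHS]expR0 ler_expR mulNr oppr_le0.
  exact: mulr_ge0 hA7 (ltW L0).
have D1 : 1 < D n.
  by apply: lt_trans D2; rewrite -[ltLHS]sqrtr1 ltr_sqrt// ltr1n.
have l2D : ln (2 * D n ^+ 2) <= 3 * L.
  move: lD; rewrite normr1 mulr1 ler_pdivrMr ?(lt_le_trans ltr01)// mul1r => lD.
  have D0 : 0 < D n by exact: lt_trans ltr01 D1.
  rewrite lnM ?posrE ?exprn_gt0// lnXn// mulr2n.
  by rewrite (_ : 3 * L = L + (L + L)); [exact: lerD l2 (lerD lD lD)|ring].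
have {}z4 : zeta b k (P n) (Y n) (X n) (supp (theta0 n)) ^+ 2 *
    (mle_radius Cdev * s0%:R * L) <= 4^-1.
  move: z4; rewrite normr1 mulr1 ler_pdivlMr ?(lt_le_trans ltr01 r1)//.
  by apply: le_trans; rewrite le_eqVlt; apply/orP; left; apply/eqP; ring.
have {}Xle : mx_norm (X n) ^+ 2 * s0%:R ^+ 2 * L /
    phi2 (X n) ((Kdim + 1) * s0%:R) (weight_mx b (X n) (theta0 n)) ^+ 2 *
    ((Kdim + 1) * K) <= 4^-1 * n%:R.
  by move: Xle; rewrite normr_nat (mulrAC 4^-1) ler_pdivlMr.
have far (A : set 'cV[R]_(p n)) :
    (forall theta, A theta -> #|supp theta|%:R <= Kdim * s0%:R ->
      K * s0%:R * L < quadform (fisher b (X n) (theta0 n)) (theta - theta0 n)) ->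
    (expected_posterior b k (P n) (Y n) (X n) (w n) (lambda n) alpha A <=
      (2 * tail_bound s0 (p n))%:E)%E.
  move=> Afar; apply: le_trans (sparse_contraction hb_diff hb_convex hCdev hb_dev hk
    h_density (hY n) (hkY n) n0 s00 p2 L1 Fu wpmf s0max ws0 l0 D1 halpha Kd0 K0
    tbu mE PE HE z4 phi0 Xle (HK _ _ _ _ _ s00 L1 wlo lbounds l2D) Afar) _.
  apply: le_trans (leeD2r _ dimle) _; rewrite -EFinD lee_fin mulr2n mulrDl mul1r.
  rewrite lerD2l /tail_bound -/L.
  by rewrite -mulr2n -[_ *+ 2]mulr_natl lerD2r lerDr invr_ge0 mulr_ge0// ltW.
have b2p x := b2_ge0 hb_diff hb_convex hCdev hb_dev x.
set Q := quadform _ in far.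
have nR : 0 < n%:R :> R by rewrite ltr0n.
have s1 : 1 <= s0%:R :> R by rewrite ler1n.
have KK1 : 1 <= (Kdim + 1) * K by rewrite -[leLHS]mulr1; apply: ler_pM => //; rewrite lerDr.
(* The difference of a theta of dimension at most Kdim s0 and theta0 has at most
   (Kdim + 1) s0 nonzero entries, which is where the sparsity level comes from. *)
have cone theta : #|supp theta|%:R <= Kdim * s0%:R -> theta <> theta0 n ->
    sparse_cone ((Kdim + 1) * s0%:R) (theta - theta0 n).
  move=> th neq; split.
    by rewrite lt0n; apply/eqP => /supp_eq0/subr0_eq.
  apply: le_trans (_ : (#|supp theta| + s0)%:R <= _);
    by rewrite ?ler_nat ?card_supp_sub// natrD mulrDl mul1r lerD2r.
have Kle : K * s0%:R * L <= (Kdim + 1) * K * s0%:R * L.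
  by rewrite -!mulrA ler_peMl ?lerDr// !mulr_ge0// ltW.
have sq_rate (c1 y : R) : 0 <= y -> (c1 * Num.sqrt (y / n%:R)) ^+ 2 * n%:R = c1 ^+ 2 * y.
  by move=> y0; rewrite exprMn sqr_sqrtr ?divr_ge0// mulrA divfK ?gt_eqF.
split; apply: far => theta /= th dim.
- have neq : theta <> theta0 n.
    move=> teq; move: th; rewrite teq subrr /l1norm big1 => [|i _]; last by rewrite mxE normr0.
    by rewrite ltNge !mulr_ge0 ?invr_ge0 ?sqrtr_ge0// ltW.
  have phi1p := lt_le_trans phi0 (phi2_le_phi1 b2p phi0).
  have r0 : 0 <= (Kdim + 1) * K * s0%:R * Num.sqrt (L / n%:R).
    by rewrite !mulr_ge0 ?sqrtr_ge0// ltW.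
  rewrite mulrAC in th.
  have := l1norm_far b2p (cone _ dim neq) phi1p r0 n0 th.
  rewrite sq_rate ?(ltW L0)//.
  rewrite (_ : _ ^+ 2 * L = (Kdim + 1) * s0%:R * ((Kdim + 1) * K * K * s0%:R * L)); last by ring.
  rewrite ltr_pM2l; last by rewrite mulr_gt0// ltr0n.
  apply: le_lt_trans; apply: le_trans Kle _.
  by rewrite -!mulrA; do 2 (apply: ler_wpM2l; first exact: ltW); rewrite ler_peMl// mulr_ge0// ltW.
- have neq : theta <> theta0 n.
    move=> teq; move: th; rewrite teq subrr.
    have -> : l2norm (0 : 'cV[R]_(p n)) = 0.
      by rewrite /l2norm big1 ?sqrtr0// => i _; rewrite mxE expr0n.
    by rewrite ltNge !mulr_ge0 ?invr_ge0 ?sqrtr_ge0// ltW.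
  have r0 : 0 <= (Kdim + 1) * K * Num.sqrt (s0%:R * L / n%:R).
    by rewrite !mulr_ge0 ?sqrtr_ge0// ltW.
  rewrite mulrAC in th.
  have := l2norm_far b2p (cone _ dim neq) phi0 r0 n0 th.
  rewrite sq_rate ?mulr_ge0 ?(ltW L0)//.
  apply: le_lt_trans; apply: le_trans Kle _.
  by rewrite -(mulrA _ s0%:R) ler_wpM2r ?mulr_ge0 ?(ltW L0)// expr2 ler_peMl// ltW.
- by apply: le_lt_trans Kle _; rewrite /Q -l2norm_sqrtmx//; exact: fisher_psd.
Qed.
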